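(* Let $G$ be a group, regarded as a one-object groupoid, and let $\mathcal V$ be the monoidal category of modules over a fixed commutative ring $k$. Then monoidales in the convolution monoidal bicategory $\mathrm{Ps}(G^{\mathrm{aut}},\mathcal V\text{-}\mathrm{Cat})$ are equivalent to the $G$-crossed categories (over $k$) of Turaev and Virelizier.
   Context: **$G^{\mathrm{aut}}$** is the groupoid whose objects are the elements $a\in G$ and whose morphisms $f:a\to b$ are elements $f\in G$ with $faf^{-1}=b$; write ${}^fa=faf^{-1}$. It is regarded as a locally discrete bicategory; $\mathrm{Ps}(-,-)$ denotes the bicategory of pseudofunctors, pseudonatural transformations and modifications. $\mathcal V\text{-}\mathrm{Cat}$ is the monoidal 2-category of $\mathcal V$-categories (i.e. $k$-linear categories), $\mathcal V$-functors and $\mathcal V$-natural transformations, with its usual tensor product $\otimes$ and unit $\mathcal I$. **Convolution.** $(S\star T)(c)=\sum_{ab=c}S(a)\otimes T(b)$, with $(S\star T)f$ given on summands by $Sf\otimes Tf$; unit $\mathbb J(c)=\mathcal I$ if $c=1$ and the empty $\mathcal V$-category if $c\ne1$. **Monoidales** (= pseudomonoids) $M$ in $\mathrm{Ps}(G^{\mathrm{aut}},\mathcal V\text{-}\mathrm{Cat})$ thus consist of a pseudofunctor $M$, $\mathcal V$-functors $\square_{a,b}:Ma\otimes Mb\to M(ab)$, an object $I\in M1$ (i.e. $\mathcal I\to M1$), and invertible associativity constraints $(A\square_{a,b}B)\square_{ab,c}C\cong A\square_{a,bc}(B\square_{b,c}C)$ and left and right unit constraints, together with isomorphisms $(Mf)(A\square_{a,b}B)\cong(Mf)A\,\square_{{}^fa,{}^fb}\,(Mf)B$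 and $(Mf)I\cong I$ making $\square$ and $I$ pseudonatural, all subject to the modification and the usual pseudomonoid coherence conditions. **$G$-graded category over $k$:** a $k$-linear monoidal category $\mathcal C$ with finite direct sums, endowed with a system of pairwise disjoint full $k$-linear subcategories $\mathcal C_a$, $a\in G$, with finite direct sums, such that (a) each object $X\in\mathcal C$ splits as a direct sum $\oplus_aX_a$ with $X_a\in\mathcal C_a$ and $a$ running over a finite subset of $G$; (b) if $X\in\mathcal C_a$ and $Y\in\mathcal C_b$ then $X\otimes Y\in\mathcal C_{ab}$; (c) if $X\in\mathcal C_a$, $Y\in\mathcal C_b$ with $a\ne b$ then $\mathcal C(X,Y)=0$; (d) the tensor unit is in $\mathcal C_1$. An object $X$ is homogeneous of degree $|X|=a$ if $X\in\mathcal C_a$. **$G$-crossed category:** a $G$-graded category $\mathcal C$ over $k$ with a strong monoidal functor $\phi:\bar G\to\mathrm{Aut}(\mathcal C)$ such that $\phi_a(\mathcal C_b)\subseteq\mathcal C_{a^{-1}ba}$ for all $a,b\in G$. Here $\bar G$ is the discrete monoidal category of elements of $G$ with tensor product $a\otimes b=ba$ (so $\phi_a\phi_b\cong\phi_{ba}$), and $\mathrm{Aut}(\mathcal C)$ is the monoidal category of monoidal ($k$-linear) endo-equivalences of $\mathcal C$ and monoidal natural isomorphisms, with composition of functors as tensor product. **Meaning of ''equivalent''.** The correspondence meant is: to a monoidale $M$ is assigned the finite-direct-sum completion $\mathcal C$ of the coproduct $\sum_aMa$ in $\mathcal V\text{-}\mathrm{Cat}$, with induced tensor product and with $\phi_f$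 given by $M(f^{-1})$; to a $G$-crossed category $\mathcal C$ is assigned the monoidale $M$ with $Ma=\mathcal C_a$ (and $Mf$ the restriction of $\phi_{f^{-1}}$). The two notions correspond up to equivalence, where each $Ma$ is considered up to finite-direct-sum completion. *)

(* Defs.v *)
From HB Require Import structures.
From mathcomp Require Import all_boot all_algebra.

Set Implicit Arguments.
Unset Strict Implicit.
Unset Printing Implicit Defensive.

Import GRing.Theory.
Local Open Scope ring_scope.
Local Open Scope group_scope.

Declare Scope kcat_scope.
Delimit Scope kcat_scope with kcat.
Local Open Scope kcat_scope.

Record kcat (k : comPzRingType) := KCat {
  obj :> Type;
  hom : obj -> obj -> lmodType k;
  idm : forall X, hom X X;
  cmp : forall X Y Z, hom Y Z -> hom X Y -> hom X Z;
  cmpA : forall W X Y Z (h : hom Y Z) (g : hom X Y) (f : hom W X),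
    cmp h (cmp g f) = cmp (cmp h g) f;
  cmp1m : forall X Y (f : hom X Y), cmp (idm Y) f = f;
  cmpm1 : forall X Y (f : hom X Y), cmp f (idm X) = f;
  cmp_linl : forall X Y Z (f : hom X Y), linear (fun g : hom Y Z => cmp g f);
  cmp_linr : forall X Y Z (g : hom Y Z), linear (fun f : hom X Y => cmp g f)
}.

Arguments hom {k k0} : rename.
Arguments idm {k k0} X : rename.
Arguments cmp {k k0} [X Y Z] : rename.

Notation "g \o f" := (cmp g f) : kcat_scope.

Section Enriched.

Variable k : comPzRingType.

Record iso (C : kcat k) (X Y : C) := Iso {
  fwd :> hom X Y;
  bwd : hom Y X;
  fwdK : bwd \o fwd = idm X;
  bwdK : fwd \o bwd = idm Y
}.

(* [S] is a direct sum (biproduct) of the family [X]; [n = 0] is a zero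
   object. *)
Definition is_dsum (C : kcat k) (n : nat) (X : 'I_n -> C) (S : C) : Prop :=
  exists (inj : forall i, hom (X i) S) (proj : forall i, hom S (X i)),
    [/\ forall i, proj i \o inj i = idm (X i),
        forall i j, i <> j -> proj j \o inj i = 0%R &
        (\sum_(i < n) (inj i \o proj i))%R = idm S].

Definition has_fds (C : kcat k) : Prop :=
  forall n (X : 'I_n -> C), exists S, is_dsum X S.

Record kfun (C D : kcat k) := KFun {
  fobj :> C -> D;
  fmap : forall X Y, hom X Y -> hom (fobj X) (fobj Y);
  fmap_lin : forall X Y, linear (@fmap X Y);
  fmap1 : forall X, fmap (idm X) = idm (fobj X);
  fmapM : forall X Y Z (g : hom Y Z) (f : hom X Y),
    fmap (g \o f) = fmap g \o fmap f
}.

Definition kid (C : kcat k) : kfun C C :=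
  @KFun C C (fun X => X) (fun X Y f => f) (fun _ _ _ _ _ => erefl)
    (fun _ => erefl) (fun _ _ _ _ _ => erefl).

Program Definition kcompf (C D E : kcat k) (G : kfun D E) (F : kfun C D) :
    kfun C E :=
  @KFun C E (fun X => G (F X)) (fun X Y f => fmap G (fmap F f)) _ _ _.
Next Obligation. by move=> C D E G F X Y a u v /=; rewrite !fmap_lin. Qed.
Next Obligation. by move=> C D E G F X /=; rewrite !fmap1. Qed.
Next Obligation. by move=> C D E G F X Y Z g f /=; rewrite !fmapM. Qed.

Record ntrans (C D : kcat k) (F G : kfun C D) := NTrans {
  ntc :> forall X, hom (F X) (G X);
  ntcN : forall X Y (f : hom X Y), fmap G f \o ntc X = ntc Y \o fmap F f
}.

Record niso (C D : kcat k) (F G : kfun C D) := NIso {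
  nic :> forall X, iso (F X) (G X);
  nicN : forall X Y (f : hom X Y), fmap G f \o nic X = nic Y \o fmap F f
}.

Definition is_equiv (C D : kcat k) (F : kfun C D) : Prop :=
  exists G : kfun D C,
    inhabited (niso (kcompf G F) (kid C)) /\
    inhabited (niso (kcompf F G) (kid D)).

(* A k-linear functor from the tensor product of k-linear categories, i.e. a
   functor of two variables, k-linear in each. *)
Record kbifun (C D E : kcat k) := KBifun {
  bobj :> C -> D -> E;
  bmap : forall X X' Y Y', hom X X' -> hom Y Y' -> hom (bobj X Y) (bobj X' Y');
  bmap_linl : forall X X' Y Y' (g : hom Y Y'),
    linear (fun f : hom X X' => bmap f g);
  bmap_linr : forall X X' Y Y' (f : hom X X'),
    linear (fun g : hom Y Y' => bmap f g);
  bmap1 : forall X Y, bmap (idm X) (idm Y) = idm (bobj X Y);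
  bmapM : forall X X' X'' Y Y' Y'' (f' : hom X' X'') (f : hom X X')
      (g' : hom Y' Y'') (g : hom Y Y'),
    bmap (f' \o f) (g' \o g) = bmap f' g' \o bmap f g
}.

(* The functors [J i] exhibit [C] as the finite-direct-sum completion of the
   coproduct of the [A i]: [C] has finite direct sums, and restriction along [J]
   is an equivalence from the category of k-linear functors [C -> D] to that of
   families of k-linear functors [A i -> D] (equivalently, of functors from the
   coproduct), for every [D] with finite direct sums. *)
Definition is_fds_completion_of_coprod (I : Type) (A : I -> kcat k) (C : kcat k)
    (J : forall i, kfun (A i) C) : Prop :=
  [/\ has_fds C,
      forall D : kcat k, has_fds D -> forall F : (forall i, kfun (A i) D),
        exists H : kfun C D, forall i, inhabited (niso (kcompf H (J i)) (F i)) &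
      forall D : kcat k, has_fds D -> forall (H H' : kfun C D)
          (t : forall i, ntrans (kcompf H (J i)) (kcompf H' (J i))),
        exists s : ntrans H H', (forall i X, s (J i X) = t i X) /\
          forall s' : ntrans H H', (forall i X, s' (J i X) = t i X) ->
            forall X, s' X = s X].

Definition is_fds_completion (A C : kcat k) (J : kfun A C) : Prop :=
  is_fds_completion_of_coprod (fun _ : unit => J).

Section Full.

Variables (C : kcat k) (P : C -> Prop).

Program Definition full : kcat k :=
  @KCat k {X | P X} (fun X Y => hom (sval X) (sval Y)) (fun X => idm (sval X))
    (fun X Y Z g f => g \o f) _ _ _ _ _.
Next Obligation. by move=> *; exact: cmpA. Qed.
Next Obligation. by move=> *; exact: cmp1m. Qed.
Next Obligation. by move=> *; exact: cmpm1. Qed.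
Next Obligation. by move=> *; exact: cmp_linl. Qed.
Next Obligation. by move=> *; exact: cmp_linr. Qed.

Definition full_iso (X Y : full) (i : iso (sval X) (sval Y)) : iso X Y :=
  @Iso full X Y (fwd i) (bwd i) (fwdK i) (bwdK i).

Definition full_incl : kfun full C :=
  @KFun full C (fun X => sval X) (fun X Y f => f) (fun _ _ _ _ _ => erefl)
    (fun _ => erefl) (fun _ _ _ _ _ => erefl).

End Full.

Section FullFun.

Variables (C D E : kcat k) (P : C -> Prop) (Q : D -> Prop) (R : E -> Prop).

Definition full_fun (F : kfun C D) (FP : forall X, P X -> Q (F X)) :
    kfun (full P) (full Q) :=
  @KFun (full P) (full Q) (fun X => exist Q (F (sval X)) (FP _ (svalP X)))
    (fun X Y f => fmap F f) (fun X Y => fmap_lin F (X := sval X) (Y := sval Y))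
    (fun X => fmap1 F (sval X)) (fun X Y Z g f => fmapM F g f).

Definition full_bifun (B : kbifun C D E)
    (BP : forall X Y, P X -> Q Y -> R (B X Y)) :
    kbifun (full P) (full Q) (full R) :=
  @KBifun (full P) (full Q) (full R)
    (fun X Y => exist R (B (sval X) (sval Y)) (BP _ _ (svalP X) (svalP Y)))
    (fun X X' Y Y' f g => bmap B f g)
    (fun X X' Y Y' g => bmap_linl B (X := sval X) (X' := sval X') g)
    (fun X X' Y Y' f => bmap_linr B (Y := sval Y) (Y' := sval Y') f)
    (fun X Y => bmap1 B (sval X) (sval Y))
    (fun X X' X'' Y Y' Y'' f' f g' g => bmapM B f' f g' g).

End FullFun.

Record kmoncat := KMonCat {
  mcat :> kcat k;
  ten : kbifun mcat mcat mcat;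
  one : mcat;
  asso : forall X Y Z, iso (ten (ten X Y) Z) (ten X (ten Y Z));
  assoN : forall X X' Y Y' Z Z' (f : hom X X') (g : hom Y Y') (h : hom Z Z'),
    bmap ten f (bmap ten g h) \o asso X Y Z =
    asso X' Y' Z' \o bmap ten (bmap ten f g) h;
  lun : forall X, iso (ten one X) X;
  lunN : forall X Y (f : hom X Y), f \o lun X = lun Y \o bmap ten (idm one) f;
  run : forall X, iso (ten X one) X;
  runN : forall X Y (f : hom X Y), f \o run X = run Y \o bmap ten f (idm one);
  pentagon : forall W X Y Z,
    asso W X (ten Y Z) \o asso (ten W X) Y Z =
    bmap ten (idm W) (asso X Y Z) \o
      (asso W (ten X Y) Z \o bmap ten (asso W X Y) (idm Z));
  triangle : forall X Y,
    bmap ten (idm X) (lun Y) \o asso X one Y = bmap ten (run X) (idm Y)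
}.

Record smfun (C D : kmoncat) := SMFun {
  sfun :> kfun C D;
  mu : forall X Y, iso (ten D (sfun X) (sfun Y)) (sfun (ten C X Y));
  muN : forall X X' Y Y' (f : hom X X') (g : hom Y Y'),
    fmap sfun (bmap (ten C) f g) \o mu X Y =
    mu X' Y' \o bmap (ten D) (fmap sfun f) (fmap sfun g);
  eps : iso (one D) (sfun (one C));
  muA : forall X Y Z,
    fmap sfun (asso X Y Z) \o
      (mu (ten C X Y) Z \o bmap (ten D) (mu X Y) (idm (sfun Z))) =
    mu X (ten C Y Z) \o
      (bmap (ten D) (idm (sfun X)) (mu Y Z) \o
        asso (sfun X) (sfun Y) (sfun Z));
  mu1m : forall X,
    fmap sfun (lun X) \o
      (mu (one C) X \o bmap (ten D) eps (idm (sfun X))) = lun (sfun X);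
  mum1 : forall X,
    fmap sfun (run X) \o
      (mu X (one C) \o bmap (ten D) (idm (sfun X)) eps) = run (sfun X)
}.

Definition iso_id (C : kcat k) (X : C) : iso X X :=
  Iso (cmp1m (idm X)) (cmp1m (idm X)).

Program Definition iso_comp (C : kcat k) (X Y Z : C) (j : iso Y Z)
    (i : iso X Y) : iso X Z :=
  @Iso C X Z (fwd j \o fwd i) (bwd i \o bwd j) _ _.
Next Obligation.
by move=> C X Y Z j i; rewrite -cmpA (cmpA (bwd j)) fwdK cmp1m fwdK.
Qed.
Next Obligation.
by move=> C X Y Z j i; rewrite -cmpA (cmpA (fwd i)) bwdK cmp1m bwdK.
Qed.

Program Definition iso_fmap (C D : kcat k) (F : kfun C D) (X Y : C)
    (i : iso X Y) : iso (F X) (F Y) :=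
  @Iso D (F X) (F Y) (fmap F (fwd i)) (fmap F (bwd i)) _ _.
Next Obligation. by move=> C D F X Y i; rewrite -fmapM fwdK fmap1. Qed.
Next Obligation. by move=> C D F X Y i; rewrite -fmapM bwdK fmap1. Qed.

Program Definition smid (C : kmoncat) : smfun C C :=
  @SMFun C C (kid C) (fun X Y => iso_id _) _ (iso_id _) _ _ _.
Next Obligation. by move=> C *; rewrite /= cmpm1 cmp1m. Qed.
Next Obligation.
by move=> C X Y Z /=; rewrite !bmap1 !cmp1m cmpm1.
Qed.
Next Obligation. by move=> C X /=; rewrite bmap1 !cmpm1. Qed.
Next Obligation. by move=> C X /=; rewrite bmap1 !cmpm1. Qed.

Lemma bmapMl (C D E : kcat k) (B : kbifun C D E) X X' X'' (Y : D)
    (f' : hom X' X'') (f : hom X X') :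
  bmap B (f' \o f) (idm Y) = bmap B f' (idm Y) \o bmap B f (idm Y).
Proof. by rewrite -bmapM cmp1m. Qed.

Lemma bmapMr (C D E : kcat k) (B : kbifun C D E) (X : C) Y Y' Y''
    (g' : hom Y' Y'') (g : hom Y Y') :
  bmap B (idm X) (g' \o g) = bmap B (idm X) g' \o bmap B (idm X) g.
Proof. by rewrite -bmapM cmp1m. Qed.

Program Definition smcomp (C D E : kmoncat) (G : smfun D E) (F : smfun C D) :
    smfun C E :=
  @SMFun C E (kcompf G F)
    (fun X Y => iso_comp (iso_fmap G (mu F X Y)) (mu G (F X) (F Y))) _
    (iso_comp (iso_fmap G (eps F)) (eps G)) _ _ _.
Next Obligation.
move=> C D E G F X X' Y Y' f g /=.
by rewrite cmpA -fmapM muN fmapM -cmpA muN cmpA.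
Qed.
Next Obligation.
move=> C D E G F X Y Z /=.
have H := congr1 (@fmap D E G _ _) (muA F X Y Z); rewrite !fmapM in H.
rewrite bmapMl bmapMr -!cmpA.
have NG := muN G (mu F X Y) (idm (F Z)); rewrite fmap1 in NG.
rewrite (cmpA (mu G (F (ten C X Y)) (F Z))) -NG.
have NG' := muN G (idm (F X)) (mu F Y Z); rewrite fmap1 in NG'.
rewrite (cmpA (mu G (F X) (F (ten C Y Z)))) -NG' -!cmpA -muA.
by rewrite !cmpA in H *; rewrite H.
Qed.
Next Obligation.
move=> C D E G F X /=.
have H := congr1 (@fmap D E G _ _) (mu1m F X); rewrite !fmapM in H.
have NG := muN G (eps F) (idm (F X)); rewrite fmap1 in NG.
rewrite bmapMl -!cmpA (cmpA (mu G (F (one C)) (F X))) -NG.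
by rewrite !cmpA in H *; rewrite H -cmpA mu1m.
Qed.
Next Obligation.
move=> C D E G F X /=.
have H := congr1 (@fmap D E G _ _) (mum1 F X); rewrite !fmapM in H.
have NG := muN G (idm (F X)) (eps F); rewrite fmap1 in NG.
rewrite bmapMr -!cmpA (cmpA (mu G (F X) (F (one C)))) -NG.
by rewrite !cmpA in H *; rewrite H -cmpA mum1.
Qed.

Record smniso (C D : kmoncat) (F G : smfun C D) := SMNIso {
  smnic :> niso F G;
  smnic_mu : forall X Y,
    smnic (ten C X Y) \o mu F X Y = mu G X Y \o bmap (ten D) (smnic X) (smnic Y);
  smnic_eps : smnic (one C) \o eps F = eps G
}.

Variable Gp : groupType.

Record graded := Graded {
  gcat :> kmoncat;
  gcat_fds : has_fds gcat;
  deg : Gp -> gcat -> Prop;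
  deg_disj : forall a b X, deg a X -> deg b X -> a = b;
  deg_fds : forall a, has_fds (full (deg a));
  deg_split : forall X, exists n (a : 'I_n -> Gp) (Y : 'I_n -> gcat),
    [/\ injective a, forall i, deg (a i) (Y i) & is_dsum Y X];
  deg_ten : forall a b X Y, deg a X -> deg b Y -> deg (a * b) (ten gcat X Y);
  deg_hom0 : forall a b X Y, deg a X -> deg b Y -> a <> b ->
    forall f : hom X Y, f = 0%R;
  deg_one : deg 1 (one gcat)
}.

Arguments deg : clear implicits.

(* [phi] is a strong monoidal functor from the discrete monoidal category on
   [Gp], with a (x) b = b a, to the k-linear monoidal endo-equivalences of the
   graded category, with composition as tensor product. The constraint
   phi a o phi b ~ phi (b * a) is indexed by all [c] with [b * a = c], so that
   its coherence conditions need no transport. *)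
Record crossed := Crossed {
  ccat :> graded;
  phi : Gp -> smfun ccat ccat;
  phi_equiv : forall a, is_equiv (phi a);
  phi_deg : forall a b X, deg ccat b X -> deg ccat (a^-1 * b * a) (phi a X);
  phi_mul : forall a b c, b * a = c -> smniso (smcomp (phi a) (phi b)) (phi c);
  phi_one : smniso (smid ccat) (phi 1);
  phi_mulA : forall a b c ba cb cba (eba : b * a = ba) (ecb : c * b = cb)
      (e1 : cb * a = cba) (e2 : c * ba = cba) X,
    phi_mul e1 X \o fmap (phi a) (phi_mul ecb X) =
    phi_mul e2 X \o phi_mul eba (phi c X);
  phi_mul1m : forall a (e : a * 1 = a) X,
    phi_mul e X \o phi_one (phi a X) = idm (phi a X);
  phi_mulm1 : forall a (e : 1 * a = a) X,
    phi_mul e X \o fmap (phi a) (phi_one X) = idm (phi a X)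
}.

Record crossed_fun (C D : crossed) := CrossedFun {
  cfun :> smfun C D;
  cfun_deg : forall a X, deg C a X -> deg D a (cfun X);
  cfun_phi : forall a, smniso (smcomp (phi D a) cfun) (smcomp cfun (phi C a));
  cfun_phi_mul : forall a b c (e : b * a = c) X,
    cfun_phi c X \o phi_mul D e (cfun X) =
    fmap cfun (phi_mul C e X) \o
      (cfun_phi a (phi C b X) \o fmap (phi D a) (cfun_phi b X));
  cfun_phi_one : forall X,
    cfun_phi 1 X \o phi_one D (cfun X) = fmap cfun (phi_one C X)
}.

Definition crossed_equiv (C D : crossed) : Prop :=
  exists F : crossed_fun C D, is_equiv F.

(* [f] is a morphism [a -> b] in G^aut. *)
Definition gaut (f a b : Gp) : Prop := f * a * f^-1 = b.

(* A composite h = g f in G^aut and a product c = a b in the convolution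
   (S * T)(c) = \sum_(a b = c) S(a) (x) T(b) are named by equations, so that no
   transport along the laws of [Gp] is needed. Equality proofs in these
   indices are irrelevant, since [Gp] has decidable equality.
   The fields [mon] to [mactm1] form a pseudofunctor; [box] to [boxM_one] and
   [munit] to [unitM_one] are pseudonatural transformations, whose constraints
   are taken in the direction (Mf)A [] (Mf)B -> (Mf)(A [] B) and I -> (Mf)I;
   [massocM], [mlunM] and [mrunM] say that the associativity and unit
   constraints are modifications. *)
Record monoidale := Monoidale {
  mon :> Gp -> kcat k;
  mact : forall f a b, gaut f a b -> kfun (mon a) (mon b);
  mactM : forall a b c f g h (ef : gaut f a b) (eg : gaut g b c)
      (eh : gaut h a c), g * f = h ->
    niso (kcompf (mact eg) (mact ef)) (mact eh);
  mact1 : forall a (e : gaut 1 a a), niso (kid (mon a)) (mact e);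
  mactA : forall a b c d f g h gf hg hgf
      (ef : gaut f a b) (eg : gaut g b c) (eh : gaut h c d)
      (egf : gaut gf a c) (ehg : gaut hg b d) (ehgf : gaut hgf a d)
      (e1 : g * f = gf) (e2 : h * g = hg)
      (e3 : hg * f = hgf) (e4 : h * gf = hgf) A,
    mactM ef ehg ehgf e3 A \o mactM eg eh ehg e2 (mact ef A) =
    mactM egf eh ehgf e4 A \o fmap (mact eh) (mactM ef eg egf e1 A);
  mact1m : forall a b f (ef : gaut f a b) (e1 : gaut 1 b b) (e : 1 * f = f) A,
    mactM ef e1 ef e A \o mact1 e1 (mact ef A) = idm (mact ef A);
  mactm1 : forall a b f (ef : gaut f a b) (e1 : gaut 1 a a) (e : f * 1 = f) A,
    mactM e1 ef ef e A \o fmap (mact ef) (mact1 e1 A) = idm (mact ef A);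
  box : forall a b c, a * b = c -> kbifun (mon a) (mon b) (mon c);
  boxM : forall f a b c a' b' c' (e : a * b = c) (e' : a' * b' = c')
      (ea : gaut f a a') (eb : gaut f b b') (ec : gaut f c c') A B,
    iso (box e' (mact ea A) (mact eb B)) (mact ec (box e A B));
  boxMN : forall f a b c a' b' c' (e : a * b = c) (e' : a' * b' = c')
      (ea : gaut f a a') (eb : gaut f b b') (ec : gaut f c c')
      A A' B B' (u : hom A A') (v : hom B B'),
    fmap (mact ec) (bmap (box e) u v) \o boxM e e' ea eb ec A B =
    boxM e e' ea eb ec A' B' \o
      bmap (box e') (fmap (mact ea) u) (fmap (mact eb) v);
  boxM_comp : forall f g h a b c a' b' c' a'' b'' c''
      (e : a * b = c) (e' : a' * b' = c') (e'' : a'' * b'' = c'')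
      (fa : gaut f a a') (fb : gaut f b b') (fc : gaut f c c')
      (ga : gaut g a' a'') (gb : gaut g b' b'') (gc : gaut g c' c'')
      (ha : gaut h a a'') (hb : gaut h b b'') (hc : gaut h c c'')
      (eh : g * f = h) A B,
    mactM fc gc hc eh (box e A B) \o
      (fmap (mact gc) (boxM e e' fa fb fc A B) \o
        boxM e' e'' ga gb gc (mact fa A) (mact fb B)) =
    boxM e e'' ha hb hc A B \o
      bmap (box e'') (mactM fa ga ha eh A) (mactM fb gb hb eh B);
  boxM_one : forall a b c (e : a * b = c)
      (ea : gaut 1 a a) (eb : gaut 1 b b) (ec : gaut 1 c c) A B,
    (mact1 ec (box e A B) : hom _ _) =
    boxM e e ea eb ec A B \o bmap (box e) (mact1 ea A) (mact1 eb B);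
  munit : mon 1;
  unitM : forall f (e : gaut f 1 1), iso munit (mact e munit);
  unitM_comp : forall f g h (ef : gaut f 1 1) (eg : gaut g 1 1)
      (eh : gaut h 1 1) (e : g * f = h),
    mactM ef eg eh e munit \o (fmap (mact eg) (unitM ef) \o unitM eg) =
    unitM eh;
  unitM_one : forall e : gaut 1 1 1, (mact1 e munit : hom _ _) = unitM e;
  massoc : forall a b c ab bc abc (e1 : a * b = ab) (e2 : ab * c = abc)
      (e3 : b * c = bc) (e4 : a * bc = abc) A B C,
    iso (box e2 (box e1 A B) C) (box e4 A (box e3 B C));
  massocN : forall a b c ab bc abc (e1 : a * b = ab) (e2 : ab * c = abc)
      (e3 : b * c = bc) (e4 : a * bc = abc)
      A A' B B' C C' (u : hom A A') (v : hom B B') (w : hom C C'),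
    bmap (box e4) u (bmap (box e3) v w) \o massoc e1 e2 e3 e4 A B C =
    massoc e1 e2 e3 e4 A' B' C' \o bmap (box e2) (bmap (box e1) u v) w;
  massocM : forall f a b c ab bc abc a' b' c' ab' bc' abc'
      (e1 : a * b = ab) (e2 : ab * c = abc)
      (e3 : b * c = bc) (e4 : a * bc = abc)
      (e1' : a' * b' = ab') (e2' : ab' * c' = abc')
      (e3' : b' * c' = bc') (e4' : a' * bc' = abc')
      (fa : gaut f a a') (fb : gaut f b b') (fc : gaut f c c')
      (fab : gaut f ab ab') (fbc : gaut f bc bc') (fabc : gaut f abc abc')
      A B C,
    fmap (mact fabc) (massoc e1 e2 e3 e4 A B C) \o
      (boxM e2 e2' fab fc fabc (box e1 A B) C \o
        bmap (box e2') (boxM e1 e1' fa fb fab A B) (idm (mact fc C))) =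
    boxM e4 e4' fa fbc fabc A (box e3 B C) \o
      (bmap (box e4') (idm (mact fa A)) (boxM e3 e3' fb fc fbc B C) \o
        massoc e1' e2' e3' e4' (mact fa A) (mact fb B) (mact fc C));
  mlun : forall a (e : 1 * a = a) A, iso (box e munit A) A;
  mlunN : forall a (e : 1 * a = a) A A' (u : hom A A'),
    u \o mlun e A = mlun e A' \o bmap (box e) (idm munit) u;
  mlunM : forall f a a' (e : 1 * a = a) (e' : 1 * a' = a')
      (f1 : gaut f 1 1) (fa : gaut f a a') A,
    fmap (mact fa) (mlun e A) \o
      (boxM e e' f1 fa fa munit A \o
        bmap (box e') (unitM f1) (idm (mact fa A))) =
    mlun e' (mact fa A);
  mrun : forall a (e : a * 1 = a) A, iso (box e A munit) A;
  mrunN : forall a (e : a * 1 = a) A A' (u : hom A A'),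
    u \o mrun e A = mrun e A' \o bmap (box e) u (idm munit);
  mrunM : forall f a a' (e : a * 1 = a) (e' : a' * 1 = a')
      (f1 : gaut f 1 1) (fa : gaut f a a') A,
    fmap (mact fa) (mrun e A) \o
      (boxM e e' fa f1 fa A munit \o
        bmap (box e') (idm (mact fa A)) (unitM f1)) =
    mrun e' (mact fa A);
  mpentagon : forall a b c d ab bc cd abc bcd abcd
      (eab : a * b = ab) (ebc : b * c = bc) (ecd : c * d = cd)
      (eab_c : ab * c = abc) (ea_bc : a * bc = abc)
      (ebc_d : bc * d = bcd) (eb_cd : b * cd = bcd)
      (eabc_d : abc * d = abcd) (eab_cd : ab * cd = abcd)
      (ea_bcd : a * bcd = abcd) A B C D,
    massoc eab eab_cd eb_cd ea_bcd A B (box ecd C D) \o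
      massoc eab_c eabc_d ecd eab_cd (box eab A B) C D =
    bmap (box ea_bcd) (idm A) (massoc ebc ebc_d ecd eb_cd B C D) \o
      (massoc ea_bc eabc_d ebc_d ea_bcd A (box ebc B C) D \o
        bmap (box eabc_d) (massoc eab eab_c ebc ea_bc A B C) (idm D));
  mtriangle : forall a b ab (e : a * b = ab) (ea : a * 1 = a) (eb : 1 * b = b)
      A B,
    bmap (box e) (idm A) (mlun eb B) \o massoc ea e eb e A munit B =
    bmap (box e) (mrun ea A) (idm B)
}.

(* A pseudonatural transformation ([hact_comp], [hact_one]) that is strong
   monoidal, with constraints that are modifications ([hboxM], [hunitM]). *)
Record monoidale_hom (M N : monoidale) := MonoidaleHom {
  hfun :> forall a, kfun (M a) (N a);
  hact : forall f a b (e : gaut f a b),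
    niso (kcompf (mact N e) (hfun a)) (kcompf (hfun b) (mact M e));
  hact_comp : forall a b c f g h (ef : gaut f a b) (eg : gaut g b c)
      (eh : gaut h a c) (e : g * f = h) A,
    hact eh A \o mactM N ef eg eh e (hfun a A) =
    fmap (hfun c) (mactM M ef eg eh e A) \o
      (hact eg (mact M ef A) \o fmap (mact N eg) (hact ef A));
  hact_one : forall a (e : gaut 1 a a) A,
    hact e A \o mact1 N e (hfun a A) = fmap (hfun a) (mact1 M e A);
  hbox : forall a b c (e : a * b = c) A B,
    iso (box N e (hfun a A) (hfun b B)) (hfun c (box M e A B));
  hboxN : forall a b c (e : a * b = c) A A' B B' (u : hom A A') (v : hom B B'),
    fmap (hfun c) (bmap (box M e) u v) \o hbox e A B =
    hbox e A' B' \o bmap (box N e) (fmap (hfun a) u) (fmap (hfun b) v);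
  hboxM : forall f a b c a' b' c' (e : a * b = c) (e' : a' * b' = c')
      (ea : gaut f a a') (eb : gaut f b b') (ec : gaut f c c') A B,
    hact ec (box M e A B) \o
      (fmap (mact N ec) (hbox e A B) \o
        boxM e e' ea eb ec (hfun a A) (hfun b B)) =
    fmap (hfun c') (boxM e e' ea eb ec A B) \o
      (hbox e' (mact M ea A) (mact M eb B) \o
        bmap (box N e') (hact ea A) (hact eb B));
  hunit : iso (munit N) (hfun 1 (munit M));
  hunitM : forall f (e : gaut f 1 1),
    hact e (munit M) \o (fmap (mact N e) hunit \o unitM N e) =
    fmap (hfun 1) (unitM M e) \o hunit;
  hassoc : forall a b c ab bc abc (e1 : a * b = ab) (e2 : ab * c = abc)
      (e3 : b * c = bc) (e4 : a * bc = abc) A B C,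
    fmap (hfun abc) (massoc e1 e2 e3 e4 A B C) \o
      (hbox e2 (box M e1 A B) C \o
        bmap (box N e2) (hbox e1 A B) (idm (hfun c C))) =
    hbox e4 A (box M e3 B C) \o
      (bmap (box N e4) (idm (hfun a A)) (hbox e3 B C) \o
        massoc e1 e2 e3 e4 (hfun a A) (hfun b B) (hfun c C));
  hlun : forall a (e : 1 * a = a) A,
    fmap (hfun a) (mlun e A) \o
      (hbox e (munit M) A \o bmap (box N e) hunit (idm (hfun a A))) =
    mlun e (hfun a A);
  hrun : forall a (e : a * 1 = a) A,
    fmap (hfun a) (mrun e A) \o
      (hbox e A (munit M) \o bmap (box N e) (idm (hfun a A)) hunit) =
    mrun e (hfun a A)
}.

Definition monoidale_equiv (M N : monoidale) : Prop :=
  exists T : monoidale_hom M N, forall a, is_equiv (T a).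

(* Equivalence of monoidales when every component is considered only up to
   finite-direct-sum completion. *)
Definition monoidale_equiv_fds (M N : monoidale) : Prop :=
  exists (P : monoidale) (S : monoidale_hom M P) (T : monoidale_hom N P),
    forall a, is_fds_completion (S a) /\ is_fds_completion (T a).

Section OfCrossed.

Variable C : crossed.

Definition comp_of (a : Gp) : kcat k := full (deg C a).

Lemma act_deg f a b (e : gaut f a b) X :
  deg C a X -> deg C b (phi C f^-1 X).
Proof. by move=> /(phi_deg f^-1); rewrite invgK e. Qed.

Definition act_of f a b (e : gaut f a b) : kfun (comp_of a) (comp_of b) :=
  full_fun (act_deg e).

Lemma inv_prod (f g h : Gp) : g * f = h -> f^-1 * g^-1 = h^-1.
Proof. by move=> <-; rewrite invgM. Qed.

Program Definition actM_of a b c f g h (ef : gaut f a b) (eg : gaut g b c)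
    (eh : gaut h a c) (e : g * f = h) :
    niso (kcompf (act_of eg) (act_of ef)) (act_of eh) :=
  @NIso _ _ _ _
    (fun X => full_iso (X := kcompf (act_of eg) (act_of ef) X)
       (Y := act_of eh X) (phi_mul C (inv_prod e) (sval X))) _.
Next Obligation.
by move=> a b c f g h ef eg eh e X Y u; exact: (nicN (phi_mul C _) u).
Qed.

Definition phi_one_at (u : Gp) (e : 1 = u) : smniso (smid C) (phi C u) :=
  match e with erefl => phi_one C end.

Program Definition act1_of a (e : gaut 1 a a) : niso (kid _) (act_of e) :=
  @NIso _ _ _ _
    (fun X => full_iso (X := X) (Y := act_of e X)
       (phi_one_at (esym (invg1 Gp)) (sval X))) _.
Next Obligation. by move=> a e X Y f; exact: (nicN (phi_one_at _) f). Qed.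

Lemma phi_mul1m_at u (eu : 1 = u) a (e : a * u = a) X :
  phi_mul C e X \o phi_one_at eu (phi C a X) = idm (phi C a X).
Proof. by case: u / eu e => e; exact: phi_mul1m. Qed.

Lemma phi_mulm1_at u (eu : 1 = u) a (e : u * a = a) X :
  phi_mul C e X \o fmap (phi C a) (phi_one_at eu X) = idm (phi C a X).
Proof. by case: u / eu e => e; exact: phi_mulm1. Qed.

Lemma ten_deg a b c (e : a * b = c) X Y :
  deg C a X -> deg C b Y -> deg C c (ten C X Y).
Proof. by rewrite -e; exact: deg_ten. Qed.

Definition box_of a b c (e : a * b = c) :
    kbifun (comp_of a) (comp_of b) (comp_of c) :=
  full_bifun (ten_deg e).

Definition unit_of : comp_of 1 := exist _ (one C) (deg_one C).

(* [M a] is the full subcategory of degree [a], and everything else is the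
   restriction of the structure of [C], [f] acting by [phi f^-1]. *)
Program Definition monoidale_of : monoidale :=
  @Monoidale comp_of act_of actM_of act1_of _ _ _
    box_of
    (fun f a b c a' b' c' e e' ea eb ec A B =>
       full_iso (X := box_of e' (act_of ea A) (act_of eb B))
         (Y := act_of ec (box_of e A B)) (mu (phi C f^-1) (sval A) (sval B)))
    _ _ _
    unit_of
    (fun f e => full_iso (X := unit_of) (Y := act_of e unit_of)
       (eps (phi C f^-1)))
    _ _
    (fun a b c ab bc abc e1 e2 e3 e4 X Y Z =>
       full_iso (X := box_of e2 (box_of e1 X Y) Z)
         (Y := box_of e4 X (box_of e3 Y Z))
         (asso (sval X) (sval Y) (sval Z)))
    _ _
    (fun a e X => full_iso (X := box_of e unit_of X) (Y := X) (lun (sval X)))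
    _ _
    (fun a e X => full_iso (X := box_of e X unit_of) (Y := X) (run (sval X)))
    _ _ _ _.
Next Obligation.
move=> a b c d f g h gf hg hgf ef eg eh egf ehg ehgf e1 e2 e3 e4 A /=.
exact: esym (phi_mulA (inv_prod e2) (inv_prod e1) (inv_prod e4)
  (inv_prod e3) (sval A)).
Qed.
Next Obligation. by move=> *; exact: phi_mul1m_at. Qed.
Next Obligation. by move=> *; exact: phi_mulm1_at. Qed.
Next Obligation. by move=> *; exact: muN. Qed.
Next Obligation. by move=> *; exact: smnic_mu (phi_mul C _) _ _. Qed.
Next Obligation.
move=> a b c e ea eb ec A B /=.
by have := smnic_mu (phi_one_at (esym (invg1 Gp))) (sval A) (sval B);
  rewrite /= cmpm1.
Qed.
Next Obligation. by move=> *; exact: smnic_eps (phi_mul C _). Qed.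
Next Obligation.
by move=> e /=; have := smnic_eps (phi_one_at (esym (invg1 Gp)));
  rewrite /= cmpm1.
Qed.
Next Obligation. by move=> *; exact: assoN. Qed.
Next Obligation. by move=> *; exact: muA. Qed.
Next Obligation. by move=> *; exact: lunN. Qed.
Next Obligation. by move=> *; exact: mu1m. Qed.
Next Obligation. by move=> *; exact: runN. Qed.
Next Obligation. by move=> *; exact: mum1. Qed.
Next Obligation. by move=> *; exact: pentagon. Qed.
Next Obligation. by move=> *; exact: triangle. Qed.

End OfCrossed.

End Enriched.

Arguments deg {k Gp} g a X : rename.

(* Main.v *)
(* Phi M is the coproduct of the M a, with its tensor product and action of G
   defined summand by summand, to which finite direct sums are adjoined as formal
   matrices.  A formal sum may carry a degree as extra datum, so that the
   homogeneous subcategories are disjoint in spite of the zero objects.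

   All the equivalences come from one extension principle.  Let K : M -> C and
   H : M -> D be morphisms to (the monoidales of) crossed categories that are
   componentwise fully faithful and such that every homogeneous object is a
   direct sum of objects of the image.  Writing X in C as a sum of objects
   K A_i, let F X be the corresponding sum of the H A_i in D.  An element
   x : K A -> X induces xi x : H A -> F X, these are jointly epimorphic, and F is
   determined by F f (xi x) = xi (f x), its tensor constraint by
   mu (xi x (x) xi y) = xi ((x (x) y) k^-1) h, with k and h the constraints of K
   and H, and similarly for the action.  Every coherence condition for F thus
   reduces, on elements, to the one for H and K, and F is an equivalence.  Apply
   this to the unit M -> Phi M, to identities, to restrictions of crossed
   functors, and to completions: by comparison with formal matrices, the
   universal property forces a completion to be fully faithful with an image
   that generates under direct sums. *)

Require Import Defs.
From HB Require Import structures.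
From mathcomp Require Import all_boot all_algebra.
From mathcomp Require Import boolp.
Import Defs.

Set Implicit Arguments.
Unset Strict Implicit.
Unset Printing Implicit Defensive.

Import GRing.Theory.
Local Open Scope ring_scope.
Local Open Scope group_scope.
Local Open Scope kcat_scope.
Local Obligation Tactic := idtac.

(** Crossed functors are never inverted or composed by hand: each equivalence comes from a span of
    two generating morphisms with a common source, so symmetry is swapping the legs and transitivity
    costs only a composite of morphisms of monoidales. Two obstacles shape the rest. Degrees are
    group elements whose laws hold only propositionally: (ab)c against a(bc), [f^-1^-1] against [f].
    Hence a degree is always quantified together with an equation for it, a law is checked in
    whichever degree makes both sides comparable, and proof irrelevance makes the result independent
    of the equation. Moreover the subcategories of homogeneous objects are disjoint and not assumed
    closed under isomorphism, so a functor defined by choosing direct sums preserves degrees only if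
    a sum of objects of degree a is itself chosen in degree a. Direct sums, preimages under full
    functors and data hidden in existential statements are chosen classically; the laws are
    insensitive to these choices because they are checked on generalized elements. *)

Definition dep_ext (T : Type) (V : T -> Type) (f g : forall t, V t) :
  (forall t, f t = g t) -> f = g := @functional_extensionality_dep T V f g.

(** * Modules of families and additivity *)

Section PiModule.

Variables (k : comPzRingType) (T : Type) (V : T -> lmodType k).

(** Serves two kinds of hom-modules: matrices, a product over pairs of indices, and the coproduct, a
    product over the proofs that two degrees agree. In the latter case an empty product is what
    makes morphisms between different degrees vanish. *)
Definition pi_lmod : Type := forall t, V t.

HB.instance Definition _ := gen_eqMixin pi_lmod.
HB.instance Definition _ := gen_choiceMixin pi_lmod.

Implicit Types f g h : pi_lmod.

Definition pi_add f g : pi_lmod := fun t => f t + g t.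
Definition pi_opp f : pi_lmod := fun t => - f t.
Definition pi_zero : pi_lmod := fun t => 0.
Definition pi_scale (a : k) f : pi_lmod := fun t => a *: f t.

Fact pi_addA : associative pi_add.
Proof. by move=> f g h; apply: dep_ext => t; exact: addrA. Qed.
Fact pi_addC : commutative pi_add.
Proof. by move=> f g; apply: dep_ext => t; exact: addrC. Qed.
Fact pi_add0 : left_id pi_zero pi_add.
Proof. by move=> f; apply: dep_ext => t; exact: add0r. Qed.
Fact pi_addN : left_inverse pi_zero pi_opp pi_add.
Proof. by move=> f; apply: dep_ext => t; exact: addNr. Qed.

HB.instance Definition _ :=
  GRing.isZmodule.Build pi_lmod pi_addA pi_addC pi_add0 pi_addN.

Fact pi_scaleA a b f : pi_scale a (pi_scale b f) = pi_scale (a * b)%R f.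
Proof. by apply: dep_ext => t; exact: scalerA. Qed.
Fact pi_scale1 : left_id 1%R pi_scale.
Proof. by move=> f; apply: dep_ext => t; exact: scale1r. Qed.
Fact pi_scaleDr : right_distributive pi_scale +%R.
Proof. by move=> a f g; apply: dep_ext => t; exact: scalerDr. Qed.
Fact pi_scaleDl f : {morph pi_scale^~ f : a b / (a + b)%R}.
Proof. by move=> a b; apply: dep_ext => t; exact: scalerDl. Qed.

HB.instance Definition _ := GRing.Zmodule_isLmodule.Build k pi_lmod
  pi_scaleA pi_scale1 pi_scaleDr pi_scaleDl.

End PiModule.

Lemma pi_linE (k : comPzRingType) T (V : T -> lmodType k) a
  (f g : pi_lmod V) t : (a *: f + g : pi_lmod V) t = a *: f t + g t.
Proof. by []. Qed.

Lemma pi_sumE (k : comPzRingType) T (V : T -> lmodType k) I (r : seq I) P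
  (f : I -> pi_lmod V) t :
  (\sum_(i <- r | P i) f i : pi_lmod V) t = \sum_(i <- r | P i) f i t.
Proof.
by elim: r => [|i r IH]; rewrite ?big_nil // !big_cons; case: ifP => // _; rewrite -IH.
Qed.

Section LinearMaps.

Variables (k : comPzRingType) (U V : lmodType k) (f : U -> V).
Hypothesis f_lin : linear f.

Let fL : {linear U -> V} :=
  HB.pack f (GRing.isLinear.Build k U V *:%R f f_lin).

Lemma lin0 : f 0 = 0. Proof. exact: (raddf0 fL). Qed.
Lemma lin_sum I (r : seq I) P (F : I -> U) :
  f (\sum_(i <- r | P i) F i) = \sum_(i <- r | P i) f (F i).
Proof. exact: (raddf_sum fL). Qed.

End LinearMaps.

Section Additivity.

Variables (k : comPzRingType) (C D E : kcat k).

Lemma cmp0m (X Y Z : C) (f : hom X Y) : (0 : hom Y Z) \o f = 0.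
Proof. exact: (lin0 (cmp_linl f)). Qed.
Lemma cmpm0 (X Y Z : C) (g : hom Y Z) : g \o (0 : hom X Y) = 0.
Proof. exact: (lin0 (cmp_linr g)). Qed.
Lemma cmp_suml (X Y Z : C) (f : hom X Y) I (r : seq I) P
    (F : I -> hom Y Z) :
  (\sum_(i <- r | P i) F i) \o f = \sum_(i <- r | P i) (F i \o f).
Proof. exact: (lin_sum (cmp_linl f)). Qed.
Lemma cmp_sumr (X Y Z : C) (g : hom Y Z) I (r : seq I) P
    (F : I -> hom X Y) :
  g \o (\sum_(i <- r | P i) F i) = \sum_(i <- r | P i) (g \o F i).
Proof. exact: (lin_sum (cmp_linr g)). Qed.
Lemma fmap0 (F : kfun C D) (X Y : C) : fmap F (0 : hom X Y) = 0.
Proof. exact: (lin0 (fmap_lin F (X:=X) (Y:=Y))). Qed.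
Lemma fmap_sum (F : kfun C D) (X Y : C) I (r : seq I) P (f : I -> hom X Y) :
  fmap F (\sum_(i <- r | P i) f i) = \sum_(i <- r | P i) fmap F (f i).
Proof. exact: (lin_sum (fmap_lin F (X:=X) (Y:=Y))). Qed.
Lemma bmap0m (B : kbifun C D E) (X X' : C) (Y Y' : D) (g : hom Y Y') :
  bmap B (0 : hom X X') g = 0.
Proof. exact: (lin0 (bmap_linl B g)). Qed.
Lemma bmapm0 (B : kbifun C D E) (X X' : C) (Y Y' : D) (f : hom X X') :
  bmap B f (0 : hom Y Y') = 0.
Proof. exact: (lin0 (bmap_linr B f)). Qed.
Lemma bmap_suml (B : kbifun C D E) (X X' : C) (Y Y' : D) I (r : seq I) P
    (f : I -> hom X X') (g : hom Y Y') :
  bmap B (\sum_(i <- r | P i) f i) g = \sum_(i <- r | P i) bmap B (f i) g.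
Proof. exact: (lin_sum (bmap_linl B g)). Qed.
Lemma bmap_sumr (B : kbifun C D E) (X X' : C) (Y Y' : D) I (r : seq I) P
    (f : hom X X') (g : I -> hom Y Y') :
  bmap B f (\sum_(i <- r | P i) g i) = \sum_(i <- r | P i) bmap B f (g i).
Proof. exact: (lin_sum (bmap_linr B f)). Qed.

End Additivity.

(** * Categories induced along a map of objects *)

Section Induced.

Variables (k : comPzRingType) (C : kcat k) (O : Type) (u : O -> C).

(** Equivalent to the full image of [u], but two names of the same object stay distinct. A functor
    on [ind] may thus depend on the name, and one object may carry several tags. *)
Definition ind : kcat k :=
  @KCat k O (fun X Y => hom (u X) (u Y)) (fun X => idm (u X))
    (fun X Y Z g f => g \o f) (fun _ _ _ _ => @cmpA _ _ _ _ _ _)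
    (fun _ _ => @cmp1m _ _ _ _) (fun _ _ => @cmpm1 _ _ _ _)
    (fun _ _ _ => @cmp_linl _ _ _ _ _) (fun _ _ _ => @cmp_linr _ _ _ _ _).

Definition ind_iso (X Y : ind) (i : iso (u X) (u Y)) : iso X Y :=
  @Iso _ ind X Y (fwd i) (bwd i) (fwdK i) (bwdK i).

End Induced.

(** * Matrices over a k-linear category *)

Section Matrices.

Variables (k : comPzRingType).

(** Indexing by an arbitrary finite type lets tensor products be indexed by product types and sums
    by dependent pairs, with no arithmetic on ordinals. *)
Record mobj (O : Type) := MObj { idx : finType; ent :> idx -> O }.

Section MatCat.

Variable B : kcat k.

Definition mhom (X Y : mobj B) : lmodType k :=
  pi_lmod (fun i => pi_lmod (fun j => hom (X i) (Y j))).

Lemma mhomP (X Y : mobj B) (f g : mhom X Y) :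
  (forall i j, f i j = g i j) -> f = g.
Proof. by move=> e; apply: dep_ext => i; apply: dep_ext => j. Qed.

Definition mcmp (X Y Z : mobj B) (g : mhom Y Z) (f : mhom X Y) : mhom X Z :=
  fun i l => \sum_j (g j l \o f i j).

(** Every structural constraint on matrices has this shape, supported on the graph of [e]. Such
    matrices are closed under composition, tensor product and functors, so coherence conditions
    reduce to an equation between entries. *)
Definition diag (X Y : mobj B) (e : idx X -> idx Y)
    (m : forall i, hom (X i) (Y (e i))) : mhom X Y :=
  fun i j => match e i =P j with
    | ReflectT p => match p in _ = j return hom (X i) (Y j) with
                    | erefl => m i end
    | ReflectF _ => 0
    end.

(** The transposed shape: the inverse of [diag] when [e] is bijective, and the projection onto a
    block when [e] is injective. *)
Definition codiag (X Y : mobj B) (e : idx X -> idx Y)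
    (m : forall i, hom (Y (e i)) (X i)) : mhom Y X :=
  fun j i => match e i =P j with
    | ReflectT p => match p in _ = j return hom (Y j) (X i) with
                    | erefl => m i end
    | ReflectF _ => 0
    end.

Section Diag.

Variables (X Y : mobj B) (e : idx X -> idx Y).

Lemma diagE (m : forall i, hom (X i) (Y (e i))) i : diag m i (e i) = m i.
Proof.
by rewrite /diag; case: eqP => // p; rewrite (eq_irrelevance p erefl).
Qed.

Lemma diag0 (m : forall i, hom (X i) (Y (e i))) i j :
  e i <> j -> diag m i j = 0.
Proof. by rewrite /diag; case: eqP. Qed.

Lemma codiagE (m : forall i, hom (Y (e i)) (X i)) i : codiag m (e i) i = m i.
Proof.
by rewrite /codiag; case: eqP => // p; rewrite (eq_irrelevance p erefl).
Qed.

Lemma codiag0 (m : forall i, hom (Y (e i)) (X i)) i j :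
  e i <> j -> codiag m j i = 0.
Proof. by rewrite /codiag; case: eqP. Qed.

Lemma diagP (m : forall i, hom (X i) (Y (e i))) (f : mhom X Y) :
  (forall i, f i (e i) = m i) -> (forall i j, e i <> j -> f i j = 0) ->
  f = diag m.
Proof.
move=> f1 f0; apply: mhomP => i j.
case: (e i =P j) => [<-|ne]; first by rewrite diagE.
by rewrite diag0 ?f0.
Qed.

Lemma mcmp_diagr (m : forall i, hom (X i) (Y (e i))) Z (g : mhom Y Z) i l :
  mcmp g (diag m) i l = g (e i) l \o m i.
Proof.
rewrite /mcmp (bigD1 (e i)) //= diagE big1 ?addr0 // => j /eqP ne.
by rewrite diag0 ?cmpm0 //; exact: nesym.
Qed.

(** Here injectivity matters: the column [e i] collects every row that [e] sends to the same index,
    and only the row [i] should contribute. *)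
Lemma mcmp_diagl (m : forall i, hom (X i) (Y (e i))) W (f : mhom W X) h i :
  injective e -> mcmp (diag m) f h (e i) = m i \o f h i.
Proof.
move=> inj_e; rewrite /mcmp (bigD1 i) //= diagE big1 ?addr0 // => j /eqP ne.
by rewrite diag0 ?cmp0m // => /inj_e.
Qed.

End Diag.

Lemma mcmp_diag (X Y Z : mobj B) (e : idx X -> idx Y) (e' : idx Y -> idx Z)
    (m : forall i, hom (X i) (Y (e i))) (m' : forall i, hom (Y i) (Z (e' i))) :
  mcmp (diag m') (diag m) =
  @diag X Z (fun i => e' (e i)) (fun i => m' (e i) \o m i).
Proof.
apply: diagP => [i|i j ne]; first by rewrite mcmp_diagr diagE.
by rewrite mcmp_diagr diag0 ?cmp0m.
Qed.

Lemma eq_diag (X Y : mobj B) (e : idx X -> idx Y)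
    (m m' : forall i, hom (X i) (Y (e i))) :
  (forall i, m i = m' i) -> diag m = diag m'.
Proof. by move=> mm; congr diag; apply: dep_ext. Qed.

Definition midm (X : mobj B) : mhom X X := @diag X X id (fun i => idm (X i)).

Program Definition mat : kcat k :=
  @KCat k (mobj B) mhom midm mcmp _ _ _ _ _.
Next Obligation.
move=> W X Y Z h g f; apply: mhomP => i l; rewrite /mcmp.
under eq_bigr do rewrite cmp_sumr.
under [in RHS]eq_bigr do rewrite cmp_suml.
rewrite exchange_big; apply: eq_bigr => j _; apply: eq_bigr => j' _.
exact: cmpA.
Qed.
Next Obligation.
move=> X Y f; apply: mhomP => i j.
by rewrite (@mcmp_diagl Y Y id _ _ f i j) ?cmp1m.
Qed.
Next Obligation.
by move=> X Y f; apply: mhomP => i j; rewrite mcmp_diagr cmpm1.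
Qed.
Next Obligation.
move=> X Y Z f a g g'; apply: mhomP => i l; rewrite !pi_linE /mcmp scaler_sumr.
by rewrite -big_split; apply: eq_bigr => j _ /=; rewrite cmp_linl.
Qed.
Next Obligation.
move=> X Y Z g a f f'; apply: mhomP => i l; rewrite !pi_linE /mcmp scaler_sumr.
by rewrite -big_split; apply: eq_bigr => j _ /=; rewrite cmp_linr.
Qed.

Program Definition diag_iso (X Y : mat) (e : idx X -> idx Y)
    (e' : idx Y -> idx X) (eK : cancel e e') (e'K : cancel e' e)
    (m : forall i, iso (X i) (Y (e i))) : iso X Y :=
  @Iso _ mat X Y (diag (fun i => fwd (m i))) (codiag (fun i => bwd (m i))) _ _.
Next Obligation.
move=> X Y e e' eK e'K m; apply: diagP => [i|i j ne] /=.
  by rewrite mcmp_diagr codiagE fwdK.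
rewrite mcmp_diagr codiag0 ?cmp0m // => /esym /(can_inj eK); exact: ne.
Qed.
Next Obligation.
move=> X Y e e' eK e'K m; apply: diagP => [j|j j' ne] /=.
  rewrite -(e'K j) /mcmp (bigD1 (e' j)) //= codiagE diagE bwdK big1 ?addr0 //.
  move=> i ne; rewrite codiag0 ?cmpm0 // => /(can_inj eK) eij.
  by rewrite eij eqxx in ne.
rewrite /mcmp big1 // => i _; case: (e i =P j) => [ei|ne']; last first.
  by rewrite codiag0 ?cmpm0.
by rewrite diag0 ?cmp0m // ei.
Qed.

End MatCat.

Section MatFun.

Variables C D : kcat k.

Definition mapm (O O' : Type) (h : O -> O') (X : mobj O) : mobj O' :=
  @MObj O' (idx X) (fun i => h (X i)).

Lemma map_diag (F : kfun C D) (X Y : mobj C) (e : idx X -> idx Y)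
    (m : forall i, hom (X i) (Y (e i))) :
  (fun i j => fmap F (diag m i j)) =
  @diag D (mapm F X) (mapm F Y) e (fun i => fmap F (m i)).
Proof.
apply: (@diagP D (mapm F X) (mapm F Y)) => [i|i j ne] /=.
  by rewrite diagE.
by rewrite diag0 ?fmap0.
Qed.

Program Definition mat_fun (F : kfun C D) : kfun (mat C) (mat D) :=
  @KFun _ (mat C) (mat D) (mapm F) (fun X Y f i j => fmap F (f i j)) _ _ _.
Next Obligation.
by move=> F X Y a f g; apply: mhomP => i j; rewrite !pi_linE fmap_lin.
Qed.
Next Obligation.
move=> F X; apply: etrans (map_diag F _) _; apply: (@eq_diag D (mapm F X) (mapm F X) id) => i; exact: fmap1.
Qed.
Next Obligation.
move=> F X Y Z g f; apply: mhomP => i j /=.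
by rewrite /mcmp fmap_sum; apply: eq_bigr => l _; rewrite fmapM.
Qed.

End MatFun.

Section MatBifun.

Variables C D E : kcat k.

Definition mapm2 (O O' O'' : Type) (h : O -> O' -> O'') (X : mobj O)
    (Y : mobj O') : mobj O'' :=
  @MObj O'' (idx X * idx Y)%type (fun i => h (X i.1) (Y i.2)).

Variable B : kbifun C D E.

Definition mat_bmap (X X' : mobj C) (Y Y' : mobj D) (f : mhom X X')
    (g : mhom Y Y') : mhom (mapm2 B X Y) (mapm2 B X' Y') :=
  fun i j => bmap B (f i.1 j.1) (g i.2 j.2).

Lemma bmap_diag (X X' : mobj C) (Y Y' : mobj D) (e : idx X -> idx X')
    (m : forall i, hom (X i) (X' (e i))) (e' : idx Y -> idx Y')
    (m' : forall i, hom (Y i) (Y' (e' i))) :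
  mat_bmap (diag m) (diag m') =
  @diag E (mapm2 B X Y) (mapm2 B X' Y') (fun i => (e i.1, e' i.2))
    (fun i => bmap B (m i.1) (m' i.2)).
Proof.
apply: (@diagP E (mapm2 B X Y) (mapm2 B X' Y')) => [i|i j ne] /=.
  by rewrite /mat_bmap !diagE.
rewrite /mat_bmap; case: (e i.1 =P j.1) => [e1|ne1]; last first.
  by rewrite (diag0 _ ne1) bmap0m.
case: (e' i.2 =P j.2) => [e2|ne2]; last by rewrite (diag0 _ ne2) bmapm0.
by case: ne; rewrite e1 e2 -surjective_pairing.
Qed.

Program Definition mat_bifun : kbifun (mat C) (mat D) (mat E) :=
  @KBifun _ (mat C) (mat D) (mat E) (mapm2 B) mat_bmap _ _ _ _.
Next Obligation.
move=> X X' Y Y' g a f f'; apply: mhomP => i j.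
by rewrite /mat_bmap !pi_linE bmap_linl.
Qed.
Next Obligation.
move=> X X' Y Y' g a f f'; apply: mhomP => i j.
by rewrite /mat_bmap !pi_linE bmap_linr.
Qed.
Next Obligation.
move=> X Y; rewrite bmap_diag; apply: diagP => [i|i j ne].
  by case: i => i j; rewrite (@diagE E (mapm2 B X Y) (mapm2 B X Y) _ _ (i, j)) bmap1.
by rewrite diag0 // -surjective_pairing.
Qed.
Next Obligation.
move=> X X' X'' Y Y' Y'' f' f g' g; apply: mhomP => i j.
rewrite /mat_bmap /= /mcmp bmap_suml.
under eq_bigr do rewrite bmap_sumr.
by rewrite pair_bigA; apply: eq_bigr => p _; rewrite bmapM.
Qed.

End MatBifun.

End Matrices.

(* [apply: eq_diag] would unify the carriers of the equality first, where
   simplification may have hidden the two objects. *)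
Ltac eq_diag := match goal with
  |- @eq _ (@diag ?k ?B ?X ?Y ?e ?m) (@diag _ _ _ _ _ ?m') =>
    refine (@eq_diag k B X Y e m m' _) end.

(** * Monoidal structure on matrices *)

Section MatMon.

Variables (k : comPzRingType).

(** Surjectivity of [e'] brings every column into the form [e' j], and injectivity leaves a single
    term there, so naturality may be tested entry by entry. *)
Lemma diag_natural (B : kcat k) (X Y X' Y' : mobj B)
    (e : idx X -> idx Y) (e' : idx X' -> idx Y')
    (m : forall i, hom (X i) (Y (e i))) (m' : forall i, hom (X' i) (Y' (e' i)))
    (f : mhom X X') (g : mhom Y Y') :
  bijective e' -> (forall i j, g (e i) (e' j) \o m i = m' j \o f i j) ->
  mcmp g (diag m) = mcmp (diag m') f.
Proof.
move=> [r eK rK] nat_m; apply: mhomP => i j; rewrite -(rK j) mcmp_diagr nat_m.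
by rewrite mcmp_diagl //; exact: can_inj eK.
Qed.

Lemma mcmp_map_diag (C D : kcat k) (F : kfun C D) (X Y : mobj C)
    (e : idx X -> idx Y) (m : forall i, hom (X i) (Y (e i))) (W : mat D)
    (f : hom W (mat_fun F X)) :
  fmap (mat_fun F) (diag m : @hom k (mat C) X Y) \o f =
  mcmp (@diag k D (mapm F X) (mapm F Y) e (fun i => fmap F (m i))) f.
Proof. by rewrite -map_diag. Qed.

Section Mon.

Variable B : kmoncat k.

Definition matA (X Y Z : mat B) :=
  @diag_iso k B (mat_bifun (ten B) (mat_bifun (ten B) X Y) Z)
    (mat_bifun (ten B) X (mat_bifun (ten B) Y Z))
    (fun p => (p.1.1, (p.1.2, p.2))) (fun q => ((q.1, q.2.1), q.2.2))
    (fun p => let: ((i, j), l) := p in erefl)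
    (fun q => let: (i, (j, l)) := q in erefl)
    (fun p => asso (X p.1.1) (Y p.1.2) (Z p.2)).

Definition mat_one : mat B := @MObj B unit (fun _ => Defs.one B).

Definition matL (X : mat B) :=
  @diag_iso k B (mat_bifun (ten B) mat_one X) X
    (fun p => p.2) (fun i => (tt, i))
    (fun p => let: (tt, i) := p in erefl) (fun=> erefl)
    (fun p => lun (X p.2)).

Definition matR (X : mat B) :=
  @diag_iso k B (mat_bifun (ten B) X mat_one) X
    (fun p => p.1) (fun i => (i, tt))
    (fun p => let: (i, tt) := p in erefl) (fun=> erefl)
    (fun p => run (X p.1)).

Program Definition mat_mon : kmoncat k :=
  @KMonCat k (mat B) (mat_bifun (ten B)) mat_one matA _ matL _ matR _ _ _.
Next Obligation.
move=> X X' Y Y' Z Z' f g h; apply: diag_natural => [|i j]; last exact: assoN.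
by exists (fun q => ((q.1, q.2.1), q.2.2)) => [[[]]|[? []]].
Qed.
Next Obligation.
move=> X Y f; apply: diag_natural => [|[[] i] [[] j]].
  by exists (fun i => (tt, i)) => [[[]]|].
rewrite /= /mat_bmap /=; rewrite /midm (@diagE k B mat_one mat_one id); exact: lunN.
Qed.
Next Obligation.
move=> X Y f; apply: diag_natural => [|[i []] [j []]].
  by exists (fun i => (i, tt)) => [[? []]|].
rewrite /= /mat_bmap /=; rewrite /midm (@diagE k B mat_one mat_one id); exact: runN.
Qed.
Next Obligation.
move=> W X Y Z /=; rewrite !bmap_diag /= !mcmp_diag.
by eq_diag => -[[[i1 i2] i3] i4]; exact: pentagon.
Qed.
Next Obligation.
move=> X Y /=; rewrite !bmap_diag /= !mcmp_diag.
by eq_diag => -[[i []] j]; exact: triangle.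
Qed.

End Mon.

Section MonFun.

Variables (B D : kmoncat k).

Section SM.

Variable F : smfun B D.

Program Definition mat_sm : smfun (mat_mon B) (mat_mon D) :=
  @SMFun k (mat_mon B) (mat_mon D) (mat_fun F)
    (fun X Y =>
       @diag_iso k D (mat_bifun (ten D) (mat_fun F X) (mat_fun F Y))
         (mat_fun F (mat_bifun (ten B) X Y)) id id (fun=> erefl) (fun=> erefl)
         (fun p => mu F (X p.1) (Y p.2)))
    _
    (@diag_iso k D (mat_one D) (mat_fun F (mat_one B))
       id id (fun=> erefl) (fun=> erefl) (fun=> eps F)) _ _ _.
Next Obligation.
move=> X X' Y Y' f g; apply: diag_natural => [|i j]; last exact: muN.
by exists id.
Qed.
Next Obligation.
move=> X Y Z; refine (etrans (@mcmp_map_diag B D F (mat_bifun (ten B) (mat_bifun (ten B) X Y) Z)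
  (mat_bifun (ten B) X (mat_bifun (ten B) Y Z))
  (fun p => (p.1.1, (p.1.2, p.2)))
  (fun p => fwd (asso (X p.1.1) (Y p.1.2) (Z p.2))) _ _) _).
rewrite /= /midm !bmap_diag /= !mcmp_diag.
by eq_diag => -[[i1 i2] i3]; exact: muA.
Qed.
Next Obligation.
move=> X; refine (etrans (@mcmp_map_diag B D F (mat_bifun (ten B) (mat_one B) X) X
  (fun p => p.2)
  (fun p => fwd (lun (X p.2))) _ _) _).
rewrite /= /midm !bmap_diag /= !mcmp_diag.
by eq_diag => -[[] i]; exact: mu1m.
Qed.
Next Obligation.
move=> X; refine (etrans (@mcmp_map_diag B D F (mat_bifun (ten B) X (mat_one B)) X
  (fun p => p.1)
  (fun p => fwd (run (X p.1))) _ _) _).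
rewrite /= /midm !bmap_diag /= !mcmp_diag.
by eq_diag => -[i []]; exact: mum1.
Qed.

End SM.

End MonFun.

End MatMon.

(** * Coproducts of k-linear categories *)

Section Coproduct.

Variable k : comPzRingType.

Section Cat.

Variables (I : eqType) (A : I -> kcat k).

Definition cobj := {i : I & A i}.

Definition cpair (i : I) (X : A i) : cobj := existT (fun i => A i : Type) i X.

(** Equality proofs between indices are unique, so this is a copy of the hom-module of [A i] when
    both objects have index [i], and zero when the indices differ. The module structure is obtained
    without deciding which case occurs. *)
Definition chom (x y : cobj) : lmodType k :=
  pi_lmod (fun p : projT1 x = projT1 y =>
    hom (match p in _ = i return A i with erefl => projT2 x end) (projT2 y)).

Definition cin0 (i : I) (X Y : A i) (u : hom X Y) : chom (cpair X) (cpair Y) :=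
  fun p : i = i => match eq_irrelevance erefl p in _ = q
    return hom (match q in _ = j return A j with erefl => X end) Y
    with erefl => u end.

(* The two equations keep the endpoints of a morphism flexible: any equality
   between indices is absorbed by them. *)
Definition cin (i : I) (X Y : A i) (x y : cobj) (px : x = cpair X)
    (py : y = cpair Y) (u : hom X Y) : chom x y :=
  eq_rect_r (fun x => chom x y)
    (eq_rect_r (fun y => chom (cpair X) y) (cin0 u) py) px.

Lemma cin0K (i : I) (X Y : A i) (u : hom X Y) : cin0 u erefl = u.
Proof. by rewrite /cin0 (Prop_irrelevance (eq_irrelevance _ _) erefl). Qed.

Lemma cin0_out (i : I) (X Y : A i) (f : chom (cpair X) (cpair Y)) :
  f = cin0 (f erefl).
Proof.
by apply: dep_ext => p; rewrite (Prop_irrelevance p erefl) cin0K.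
Qed.

Lemma cin_lin (i : I) (X Y : A i) x y (px : x = cpair X) (py : y = cpair Y) :
  linear (cin px py).
Proof.
move=> a u v; subst x y; apply: dep_ext => p.
by rewrite (Prop_irrelevance p erefl) pi_linE /cin /eq_rect_r /= !cin0K.
Qed.

Lemma cin0_lin (i : I) (X Y : A i) : linear (@cin0 i X Y).
Proof. exact: (@cin_lin i X Y _ _ erefl erefl). Qed.

Lemma chom0 x y (f : chom x y) : projT1 x <> projT1 y -> f = 0.
Proof. by move=> ne; apply: dep_ext => p. Qed.

(** The case analysis behind all laws of the coproduct: both sides are linear in each morphism, so
    only morphisms inside one summand need checking. The presentation of the source is given and
    that of the target produced, so that a composable string is treated from its source onwards. *)
Lemma chomP (i : I) (X : A i) x (px : x = cpair X) y (f : chom x y) :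
  (exists (Y : A i) (py : y = cpair Y) (u : hom X Y), f = cin px py u) \/ f = 0.
Proof.
subst x; case: y f => j Y f; case: (i =P j) => [p|ne]; last first.
  by right; exact: chom0.
by subst j; left; exists Y, erefl, (f erefl); exact: cin0_out.
Qed.

Definition ccmp (x y z : cobj) (g : chom y z) (f : chom x y) : chom x z.
Proof.
case: x f => a X; case: y g => b Y; case: z => c Z g f.
case: (a =P b) => [p|_]; last exact: 0.
case: (b =P c) => [q|_]; last exact: 0.
destruct p, q; exact: cin0 (g erefl \o f erefl).
Defined.

Lemma ccmpE (i : I) (X Y Z : A i) x y z (px : x = cpair X) (py : y = cpair Y)
    (pz : z = cpair Z) (v : hom Y Z) (u : hom X Y) :
  ccmp (cin py pz v) (cin px py u) = cin px pz (v \o u).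
Proof.
subst x y z; rewrite /ccmp /=; case: (i =P i) => // p.
by rewrite (Prop_irrelevance p erefl) /cin /eq_rect_r /= !cin0K.
Qed.

Lemma ccmp_linl x y z (f : chom x y) : linear (fun g : chom y z => ccmp g f).
Proof.
move=> a g g'; case: x f => i X; case: y g g' => j Y; case: z => l Z.
move=> g g' f; rewrite /ccmp /=.
case: (i =P j) => [p|_]; last by rewrite scaler0 addr0.
case: (j =P l) => [q|_]; last by rewrite scaler0 addr0.
by destruct p, q; rewrite /= cmp_linl cin0_lin.
Qed.

Lemma ccmp_linr x y z (g : chom y z) : linear (fun f : chom x y => ccmp g f).
Proof.
move=> a f f'; case: x f f' => i X; case: y g => j Y; case: z => l Z.
move=> g f f'; rewrite /ccmp /=.
case: (i =P j) => [p|_]; last by rewrite scaler0 addr0.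
case: (j =P l) => [q|_]; last by rewrite scaler0 addr0.
by destruct p, q; rewrite /= cmp_linr cin0_lin.
Qed.

Definition cidm (x : cobj) : chom x x :=
  let: existT i X := x in cin0 (idm X).

Lemma cidE (i : I) (X : A i) x (px : x = cpair X) :
  @cidm x = cin px px (idm X).
Proof. by subst x. Qed.

Program Definition coprod : kcat k :=
  @KCat k cobj chom (@cidm) ccmp _ _ _ ccmp_linl ccmp_linr.
Next Obligation.
move=> [i X] y z t h g f.
have [[Y [py [u ->]]]|->] := chomP erefl f; last by rewrite !(lin0 (ccmp_linr _)).
have [[Z [pz [v ->]]]|->] := chomP py g; last first.
  by rewrite !(lin0 (ccmp_linl _), lin0 (ccmp_linr _)).
have [[T [pt [w ->]]]|->] := chomP pz h; last by rewrite !(lin0 (ccmp_linl _)).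
by rewrite !ccmpE cmpA.
Qed.
Next Obligation.
move=> [i X] y f.
have [[Y [py [u ->]]]|->] := chomP erefl f; last by rewrite (lin0 (ccmp_linr _)).
by rewrite (cidE py) ccmpE cmp1m.
Qed.
Next Obligation.
move=> [i X] y f.
have [[Y [py [u ->]]]|->] := chomP erefl f; last by rewrite (lin0 (ccmp_linl _)).
by rewrite (@cidE _ X) ccmpE cmpm1.
Qed.

Lemma cin1 (i : I) (X : A i) (x : coprod) (px : x = cpair X) :
  idm x = cin px px (idm X).
Proof. exact: cidE. Qed.

Lemma cobjP (x : coprod) : exists i (X : A i), x = cpair X.
Proof. by case: x => i X; exists i, X. Qed.

Lemma cinM (i : I) (X Y Z : A i) (x y z : coprod) (px : x = cpair X)
    (py : y = cpair Y) (pz : z = cpair Z) (v : hom Y Z) (u : hom X Y) :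
  @cmp k coprod x y z (cin py pz v) (cin px py u) = cin px pz (v \o u).
Proof. exact: ccmpE. Qed.

Definition cin_iso (i : I) (X Y : A i) (x y : coprod) (px : x = cpair X)
    (py : y = cpair Y) (u : iso X Y) : iso x y :=
  @Iso _ coprod x y (cin px py (fwd u)) (cin py px (bwd u))
    (etrans (cinM _ _ _ _ _) (etrans (congr1 _ (fwdK u)) (esym (cin1 px))))
    (etrans (cinM _ _ _ _ _) (etrans (congr1 _ (bwdK u)) (esym (cin1 py)))).

End Cat.

Section Fun.

Variables (I J : eqType) (A : I -> kcat k) (A' : J -> kcat k) (h : I -> J).
Variable F : forall i, kfun (A i) (A' (h i)).

Definition cfobj (x : coprod A) : coprod A' :=
  @cpair J A' (h (projT1 x)) (F (projT1 x) (projT2 x)).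

Definition cfmap (x y : coprod A) (f : hom x y) : hom (cfobj x) (cfobj y).
Proof.
case: x f => i X; case: y => j Y f.
case: (i =P j) => [p|_]; last exact: 0.
destruct p; exact: cin0 (fmap (F i) (f erefl)).
Defined.

Lemma cfmapE0 (i : I) (X Y : A i) (x y : coprod A) (px : x = cpair X)
    (py : y = cpair Y) (u : hom X Y)
    (pz : cfobj x = cpair (F i X)) (pz' : cfobj y = cpair (F i Y)) :
  cfmap (cin px py u) = cin pz pz' (fmap (F i) u).
Proof.
subst x y; rewrite /cfmap /=; case: (i =P i) => // p.
rewrite (Prop_irrelevance p erefl) (Prop_irrelevance pz erefl).
by rewrite (Prop_irrelevance pz' erefl) /cin /eq_rect_r /= !cin0K.
Qed.

Lemma cfmap_lin (x y : coprod A) : linear (@cfmap x y).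
Proof.
move=> a f g; case: x f g => i X; case: y => j Y f g; rewrite /cfmap /=.
case: (i =P j) => [p|_]; last by rewrite scaler0 addr0.
by destruct p; rewrite /= fmap_lin cin0_lin.
Qed.

Program Definition coprod_fun : kfun (coprod A) (coprod A') :=
  @KFun _ (coprod A) (coprod A') cfobj cfmap cfmap_lin _ _.
Next Obligation.
move=> x; have [i [X px]] := cobjP x.
have pFx : cfobj x = cpair (F i X) by rewrite px.
by rewrite (cin1 px) (cfmapE0 _ _ _ pFx pFx) (cin1 pFx) fmap1.
Qed.
Next Obligation.
move=> x y z g f; have [i [X px]] := cobjP x.
have [[Y [py [u ->]]]|->] := chomP px f; last first.
  by rewrite cmpm0 !(lin0 (@cfmap_lin _ _)) cmpm0.
have [[Z [pz [v ->]]]|->] := chomP py g; last first.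
  by rewrite cmp0m !(lin0 (@cfmap_lin _ _)) cmp0m.
have pFx : cfobj x = cpair (F i X) by rewrite px.
have pFy : cfobj y = cpair (F i Y) by rewrite py.
have pFz : cfobj z = cpair (F i Z) by rewrite pz.
rewrite cinM (cfmapE0 _ _ _ pFx pFz) (cfmapE0 _ _ _ pFx pFy).
by rewrite (cfmapE0 _ _ _ pFy pFz) cinM fmapM.
Qed.

End Fun.

Section Bifun.

Variables (I J ext_lam : eqType) (A : I -> kcat k) (A' : J -> kcat k).
Variables (A'' : ext_lam -> kcat k) (h : I -> J -> ext_lam).
Variable F : forall i j, kbifun (A i) (A' j) (A'' (h i j)).

Definition cbobj (x : coprod A) (y : coprod A') : coprod A'' :=
  @cpair ext_lam A'' (h (projT1 x) (projT1 y)) (F _ _ (projT2 x) (projT2 y)).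

Lemma pcbobj i j (X : A i) (Y : A' j) x y :
  x = cpair X -> y = cpair Y -> cbobj x y = cpair (F i j X Y).
Proof. by move=> -> ->. Qed.

Definition cbmap (x x' : coprod A) (y y' : coprod A') (f : hom x x')
    (g : hom y y') : hom (cbobj x y) (cbobj x' y').
Proof.
case: x f => i X; case: x' => i' X' f; case: y g => j Y; case: y' => j' Y' g.
case: (i =P i') => [p|_]; last exact: 0.
case: (j =P j') => [q|_]; last exact: 0.
destruct p, q; exact: cin0 (bmap (F i j) (f erefl) (g erefl)).
Defined.

Lemma cbmapE0 (i : I) (j : J) (X X' : A i) (Y Y' : A' j) x x' y y'
    (px : x = cpair X) (px' : x' = cpair X') (py : y = cpair Y)
    (py' : y' = cpair Y') (u : hom X X') (v : hom Y Y')
    (pz : cbobj x y = cpair (F i j X Y))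
    (pz' : cbobj x' y' = cpair (F i j X' Y')) :
  cbmap (cin px px' u) (cin py py' v) = cin pz pz' (bmap (F i j) u v).
Proof.
subst x x' y y'; rewrite /cbmap /=; case: (i =P i) => // p.
rewrite (Prop_irrelevance p erefl); case: (j =P j) => // q.
rewrite (Prop_irrelevance q erefl) (Prop_irrelevance pz erefl).
rewrite (Prop_irrelevance pz' erefl).
by rewrite /cin /eq_rect_r /= !cin0K.
Qed.

Lemma cbmap_linl x x' y y' g : linear (fun f => @cbmap x x' y y' f g).
Proof.
move=> a f f'; case: x f f' => i X; case: x' => i' X' f f'.
case: y g => j Y; case: y' => j' Y' g; rewrite /cbmap /=.
case: (i =P i') => [p|_]; last by rewrite scaler0 addr0.
case: (j =P j') => [q|_]; last by rewrite scaler0 addr0.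
by destruct p, q; rewrite /= bmap_linl cin0_lin.
Qed.

Lemma cbmap_linr x x' y y' f : linear (fun g => @cbmap x x' y y' f g).
Proof.
move=> a g g'; case: x f => i X; case: x' => i' X' f.
case: y g g' => j Y; case: y' => j' Y' g g'; rewrite /cbmap /=.
case: (i =P i') => [p|_]; last by rewrite scaler0 addr0.
case: (j =P j') => [q|_]; last by rewrite scaler0 addr0.
by destruct p, q; rewrite /= bmap_linr cin0_lin.
Qed.

Program Definition coprod_bifun : kbifun (coprod A) (coprod A') (coprod A'') :=
  @KBifun _ (coprod A) (coprod A') (coprod A'') cbobj cbmap
    cbmap_linl cbmap_linr _ _.
Next Obligation.
move=> x y; have [i [X px]] := cobjP x; have [j [Y py]] := cobjP y.
have pz := pcbobj px py.
by rewrite (cin1 px) (cin1 py) (cbmapE0 _ _ _ _ _ _ pz pz) (cin1 pz) bmap1.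
Qed.
Next Obligation.
move=> x x' x'' y y' y'' f' f g' g.
have [i [X px]] := cobjP x; have [j [Y py]] := cobjP y.
have [[X' [px' [u ->]]]|->] := chomP px f; last first.
  by rewrite cmpm0 !(lin0 (@cbmap_linl _ _ _ _ _)) cmpm0.
have [[X'' [px'' [u' ->]]]|->] := chomP px' f'; last first.
  by rewrite cmp0m !(lin0 (@cbmap_linl _ _ _ _ _)) cmp0m.
have [[Y' [py' [v ->]]]|->] := chomP py g; last first.
  by rewrite cmpm0 !(lin0 (@cbmap_linr _ _ _ _ _)) cmpm0.
have [[Y'' [py'' [v' ->]]]|->] := chomP py' g'; last first.
  by rewrite cmp0m !(lin0 (@cbmap_linr _ _ _ _ _)) cmp0m.
rewrite !cinM (cbmapE0 _ _ _ _ _ _ (pcbobj px py) (pcbobj px'' py'')).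
rewrite (cbmapE0 _ _ _ _ _ _ (pcbobj px py) (pcbobj px' py')).
rewrite (cbmapE0 _ _ _ _ _ _ (pcbobj px' py') (pcbobj px'' py'')).
by rewrite cinM bmapM.
Qed.

End Bifun.

End Coproduct.

(** * The crossed structure on the coproduct *)

Section Precrossed.

Variables (k : comPzRingType) (G : groupType).

(* A crossed category without direct sums, in which every object is
   homogeneous. *)
Record precrossed := Precrossed {
  pcat :> kmoncat k;
  pdeg : pcat -> G;
  pdeg_ten : forall x y, pdeg (ten pcat x y) = pdeg x * pdeg y;
  pdeg_one : pdeg (Defs.one pcat) = 1;
  pdeg_hom0 : forall x y (f : hom x y), pdeg x <> pdeg y -> f = 0%R;
  pphi : G -> smfun pcat pcat;
  pphi_deg : forall a x, pdeg (pphi a x) = a^-1 * pdeg x * a;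
  pphi_mul : forall a b c, b * a = c ->
    smniso (smcomp (pphi a) (pphi b)) (pphi c);
  pphi_one : smniso (smid pcat) (pphi 1);
  pphi_mulA : forall a b c ba cb cba (eba : b * a = ba) (ecb : c * b = cb)
      (e1 : cb * a = cba) (e2 : c * ba = cba) X,
    pphi_mul e1 X \o fmap (pphi a) (pphi_mul ecb X) =
    pphi_mul e2 X \o pphi_mul eba (pphi c X);
  pphi_mul1m : forall a (e : a * 1 = a) X,
    pphi_mul e X \o pphi_one (pphi a X) = idm (pphi a X);
  pphi_mulm1 : forall a (e : 1 * a = a) X,
    pphi_mul e X \o fmap (pphi a) (pphi_one X) = idm (pphi a X)
}.

Section OfMonoidale.

Variable M : monoidale k G.

Let B := coprod (fun a : G => M a).

Definition cten : kbifun B B B :=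
  coprod_bifun (fun a b => box M (erefl (a * b))).

Definition cact (f : G) : kfun B B :=
  coprod_fun (fun a => mact M (erefl : gaut f a (f * a * f^-1))).

Definition cone : B := cpair (munit M).

Lemma cpair_eta (x : B) : x = cpair (projT2 x).
Proof. by case: x. Qed.

(** The degree [c] is free up to the equation [e]. Both bracketings of a triple tensor product can
    therefore be presented in one and the same degree. *)
Lemma pten a b c (e : a * b = c) (X : M a) (Y : M b) (x y : B) :
  x = cpair X -> y = cpair Y -> cten x y = cpair (box M e X Y).
Proof. by move=> -> ->; subst c. Qed.

Lemma pact f a b (e : gaut f a b) (X : M a) (x : B) :
  x = cpair X -> cact f x = cpair (mact M e X).
Proof. by move=> ->; unfold gaut in e; subst b. Qed.

Lemma ctenE a b c (e : a * b = c) (X X' : M a) (Y Y' : M b) (x x' y y' : B)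
    (px : x = cpair X) (px' : x' = cpair X') (py : y = cpair Y)
    (py' : y' = cpair Y') (u : hom X X') (v : hom Y Y')
    (pz : cten x y = cpair (box M e X Y))
    (pz' : cten x' y' = cpair (box M e X' Y')) :
  bmap cten (cin px px' u) (cin py py' v) = cin pz pz' (bmap (box M e) u v).
Proof. by subst c; exact: cbmapE0. Qed.

Lemma cactE f a b (e : gaut f a b) (X Y : M a) (x y : B) (px : x = cpair X)
    (py : y = cpair Y) (u : hom X Y) (pz : cact f x = cpair (mact M e X))
    (pz' : cact f y = cpair (mact M e Y)) :
  fmap (cact f) (cin px py u) = cin pz pz' (fmap (mact M e) u).
Proof. by unfold gaut in e; subst b; exact: cfmapE0. Qed.

Lemma cin_irr a (X Y : M a) (x y : B) (p p' : x = cpair X)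
    (q q' : y = cpair Y) u : cin p q u = cin p' q' u.
Proof. by rewrite (Prop_irrelevance p p') (Prop_irrelevance q q'). Qed.

Lemma ctenl_in a b c (e : a * b = c) (X : M a) (Y Y' : M b) (x y y' : B)
    (px : x = cpair X) (py : y = cpair Y) (py' : y' = cpair Y')
    (v : hom Y Y') (pz : cten x y = cpair (box M e X Y))
    (pz' : cten x y' = cpair (box M e X Y')) :
  bmap cten (idm x) (cin py py' v) = cin pz pz' (bmap (box M e) (idm X) v).
Proof. by rewrite (cin1 px); exact: ctenE. Qed.

Lemma ctenr_in a b c (e : a * b = c) (X X' : M a) (Y : M b) (x x' y : B)
    (px : x = cpair X) (px' : x' = cpair X') (py : y = cpair Y)
    (u : hom X X') (pz : cten x y = cpair (box M e X Y))
    (pz' : cten x' y = cpair (box M e X' Y)) :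
  bmap cten (cin px px' u) (idm y) = cin pz pz' (bmap (box M e) u (idm Y)).
Proof. by rewrite (cin1 py); exact: ctenE. Qed.

Section Constraints.

Variables x y z : B.

Definition casso : iso (cten (cten x y) z) (cten x (cten y z)) :=
  cin_iso (pten (esym (mulgA _ _ _))
             (pten erefl (cpair_eta x) (cpair_eta y)) (cpair_eta z))
    (pten erefl (cpair_eta x) (pten erefl (cpair_eta y) (cpair_eta z)))
    (massoc erefl (esym (mulgA _ _ _)) erefl erefl _ _ _).

Definition clun : iso (cten cone x) x :=
  cin_iso (pten (mul1g _) erefl (cpair_eta x)) (cpair_eta x)
    (mlun (mul1g _) _).

Definition crun : iso (cten x cone) x :=
  cin_iso (pten (mulg1 _) (cpair_eta x) erefl) (cpair_eta x)
    (mrun (mulg1 _) _).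

Lemma cbox_deg f (a b : G) :
  f * a * f^-1 * (f * b * f^-1) = f * (a * b) * f^-1.
Proof. by rewrite !mulgA mulgVK. Qed.

Definition cmu f : iso (cten (cact f x) (cact f y)) (cact f (cten x y)) :=
  cin_iso (pten (cbox_deg f _ _) (pact erefl (cpair_eta x))
             (pact erefl (cpair_eta y)))
    (pact erefl (pten erefl (cpair_eta x) (cpair_eta y)))
    (boxM erefl (cbox_deg f _ _) erefl erefl erefl _ _).

Lemma gaut_one (f : G) : gaut f 1 1.
Proof. by rewrite /gaut mulg1 mulgV. Qed.

Definition ceps f : iso cone (cact f cone) :=
  cin_iso (erefl cone) (pact (gaut_one f) (erefl cone))
    (unitM M (gaut_one f)).

Lemma gaut1 (a : G) : gaut 1 a a.
Proof. by rewrite /gaut mul1g invg1 mulg1. Qed.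

Definition cact1 : iso x (cact 1 x) :=
  cin_iso (cpair_eta x) (pact (gaut1 _) (cpair_eta x)) (mact1 M (gaut1 _) _).

(** The intermediate degree is the one that the action of [f] produces, and the final one is the one
    that [h] produces, so the composite and the direct action end in the same summand. *)
Lemma gaut_comp (f g h a : G) : g * f = h ->
  gaut g (f * a * f^-1) (h * a * h^-1).
Proof. by rewrite /gaut => <-; rewrite invgM !mulgA. Qed.

Definition cactM (f g h : G) (e : g * f = h) :
    iso (cact g (cact f x)) (cact h x) :=
  cin_iso (pact (gaut_comp _ e) (pact erefl (cpair_eta x)))
    (pact erefl (cpair_eta x)) (mactM M erefl (gaut_comp _ e) erefl e _).

End Constraints.

Section ConstraintsE.

Variables (x y z : B) (a b c : G) (X : M a) (Y : M b) (Z : M c).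
Hypotheses (px : x = cpair X) (py : y = cpair Y) (pz : z = cpair Z).

(** The constraint was defined with one choice of degrees and is computed here with any other, by
    irrelevance of equality proofs. With the analogous lemmas below, each side of a coherence
    condition collapses to a single [cin], and the condition becomes the one for [M]. *)
Lemma cassoE ab bc abc (e1 : a * b = ab) (e2 : ab * c = abc)
    (e3 : b * c = bc) (e4 : a * bc = abc) p q :
  fwd (casso x y z) = cin p q (massoc e1 e2 e3 e4 X Y Z).
Proof.
subst x y z ab bc; case: abc / e4 e2 p q => e2 p q.
move: p q; rewrite (Prop_irrelevance e2 (esym (mulgA a b c))) => p q; exact: cin_irr.
Qed.

Lemma clunE (e : 1 * a = a) p q : fwd (clun x) = cin p q (mlun e X).
Proof. subst x; move: p q; rewrite (Prop_irrelevance e (mul1g a)) => p q; exact: cin_irr. Qed.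

Lemma crunE (e : a * 1 = a) p q : fwd (crun x) = cin p q (mrun e X).
Proof. subst x; move: p q; rewrite (Prop_irrelevance e (mulg1 a)) => p q; exact: cin_irr. Qed.

Lemma cmuE (f : G) ab a' b' c' (e : a * b = ab) (e' : a' * b' = c')
    (ea : gaut f a a') (eb : gaut f b b') (ec : gaut f ab c') p q :
  fwd (cmu x y f) = cin p q (boxM e e' ea eb ec X Y).
Proof.
subst x y ab; unfold gaut in *; subst a' b'.
case: c' / ec e' p q => e' p q.
move: p q; rewrite (Prop_irrelevance e' (cbox_deg f a b)) => p q; exact: cin_irr.
Qed.

Lemma cepsE f (e : gaut f 1 1) p q : fwd (ceps f) = cin p q (unitM M e).
Proof. move: p q; rewrite (Prop_irrelevance e (gaut_one f)) => p q; exact: cin_irr. Qed.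

Lemma cact1E (e : gaut 1 a a) p q : fwd (cact1 x) = cin p q (mact1 M e X).
Proof. subst x; move: p q; rewrite (Prop_irrelevance e (gaut1 a)) => p q; exact: cin_irr. Qed.

Lemma cactME (f g h : G) a' a'' (ef : gaut f a a') (eg : gaut g a' a'')
    (eh : gaut h a a'') (e : g * f = h) p q :
  fwd (cactM x e) = cin p q (mactM M ef eg eh e X).
Proof.
subst x; unfold gaut in *; subst a'; case: a'' / eh eg p q => eg p q.
move: p q; rewrite (Prop_irrelevance eg (gaut_comp a e)) => p q; exact: cin_irr.
Qed.

End ConstraintsE.

Program Definition cmon : kmoncat k :=
  @KMonCat k B cten cone casso _ clun _ crun _ _ _.
Next Obligation.
move=> x x' y y' z z' f g h.
have [a [X px]] := cobjP x; have [b [Y py]] := cobjP y.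
have [c [Z pz]] := cobjP z.
have [[X' [px' [u ->]]]|->] := chomP px f; last first.
  by rewrite !bmap0m cmp0m cmpm0.
have [[Y' [py' [v ->]]]|->] := chomP py g; last first.
  by rewrite bmap0m !bmapm0 bmap0m cmp0m cmpm0.
have [[Z' [pz' [w ->]]]|->] := chomP pz h; last first.
  by rewrite !bmapm0 cmp0m cmpm0.
(* Both bracketings are presented in degree a(bc), so that [cinM] can compose across the
   associator. *)
have e := esym (mulgA a b c).
have p := pten e (pten erefl px py) pz.
have p' := pten e (pten erefl px' py') pz'.
have q := pten erefl px (pten erefl py pz).
have q' := pten erefl px' (pten erefl py' pz').
rewrite (cassoE px py pz p q) (cassoE px' py' pz' p' q').
rewrite (ctenE _ _ _ _ _ _ (pten erefl py pz) (pten erefl py' pz')).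
rewrite (ctenE _ _ _ _ _ _ q q').
rewrite (ctenE _ _ _ _ _ _ (pten erefl px py) (pten erefl px' py')).
by rewrite (ctenE _ _ _ _ _ _ p p') !cinM massocN.
Qed.
Next Obligation.
move=> x y f; have [a [X px]] := cobjP x.
have [[Y [py [u ->]]]|->] := chomP px f; last by rewrite bmapm0 cmp0m cmpm0.
have p := pten (mul1g a) (erefl cone) px.
have q := pten (mul1g a) (erefl cone) py.
rewrite (clunE px p px) (clunE py q py) (ctenl_in (erefl cone) _ _ _ p q).
by rewrite !cinM mlunN.
Qed.
Next Obligation.
move=> x y f; have [a [X px]] := cobjP x.
have [[Y [py [u ->]]]|->] := chomP px f; last by rewrite bmap0m cmp0m cmpm0.
have p := pten (mulg1 a) px (erefl cone).
have q := pten (mulg1 a) py (erefl cone).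
rewrite (crunE px p px) (crunE py q py) (ctenr_in _ _ (erefl cone) _ p q).
by rewrite !cinM mrunN.
Qed.
Next Obligation.
move=> w x y z; have [a [W pw]] := cobjP w; have [b [X px]] := cobjP x.
have [c [Y py]] := cobjP y; have [d [Z pz]] := cobjP z.
have pwx := pten erefl pw px; have pxy := pten erefl px py.
have pyz := pten erefl py pz.
have pwx_y := pten (erefl (a * b * c)) pwx py.
have pw_xy' := pten (mulgA a b c) pw pxy.
have pxy_z := pten (erefl (b * c * d)) pxy pz.
have px_yz := pten (mulgA b c d) px pyz.
have e1 : a * b * c * d = a * b * c * d by [].
have e2 : a * b * (c * d) = a * b * c * d by rewrite !mulgA.
have e3 : a * (b * c * d) = a * b * c * d by rewrite !mulgA.
have p1 := pten e1 pwx_y pz; have p2 := pten e2 pwx pyz.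
have p3 := pten e3 pw px_yz; have p4 := pten e1 pw_xy' pz.
have p5 := pten e3 pw pxy_z.
rewrite (cassoE pw px pyz p2 p3) (cassoE pwx py pz p1 p2).
rewrite (cassoE pw px py pwx_y pw_xy') (cassoE pw pxy pz p4 p5).
rewrite (cassoE px py pz pxy_z px_yz).
rewrite (ctenl_in pw _ _ _ p5 p3) (ctenr_in _ _ pz _ p1 p4).
rewrite !cinM; congr cin; exact: mpentagon.
Qed.
Next Obligation.
move=> x y; have [a [X px]] := cobjP x; have [b [Y py]] := cobjP y.
have p1 := pten (mulg1 a) px (erefl cone).
have p2 := pten (mul1g b) (erefl cone) py.
have q1 := pten (erefl (a * b)) p1 py; have q2 := pten (erefl (a * b)) px p2.
have q3 := pten (erefl (a * b)) px py.
rewrite (cassoE px (erefl cone) py q1 q2) (clunE py p2 py) (crunE px p1 px).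
rewrite (ctenl_in px _ _ _ q2 q3) (ctenr_in _ _ py _ q1 q3) cinM.
by rewrite mtriangle.
Qed.

Program Definition csm (f : G) : smfun cmon cmon :=
  @SMFun k cmon cmon (cact f) (fun x y => cmu x y f) _ (ceps f) _ _ _.
Next Obligation.
move=> f x x' y y' u v.
have [a [X px]] := cobjP x; have [b [Y py]] := cobjP y.
have [[X' [px' [{}u ->]]]|->] := chomP px u; last first.
  by rewrite fmap0 !bmap0m fmap0 cmp0m cmpm0.
have [[Y' [py' [{}v ->]]]|->] := chomP py v; last first.
  by rewrite fmap0 !bmapm0 fmap0 cmp0m cmpm0.
have e := cbox_deg f a b.
have qx := pact (erefl : gaut f a _) px; have qx' := pact (erefl : gaut f a _) px'.
have qy := pact (erefl : gaut f b _) py; have qy' := pact (erefl : gaut f b _) py'.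
have p := pten (erefl (a * b)) px py; have p' := pten (erefl (a * b)) px' py'.
have q := pact (erefl : gaut f (a * b) _) p.
have q' := pact (erefl : gaut f (a * b) _) p'.
have r := pten e qx qy; have r' := pten e qx' qy'.
rewrite (cmuE px py r q) (cmuE px' py' r' q') (ctenE _ _ _ _ _ _ p p').
rewrite (cactE _ _ _ q q') (cactE _ _ _ qx qx') (cactE _ _ _ qy qy').
by rewrite (ctenE _ _ _ _ _ _ r r') !cinM boxMN.
Qed.
Next Obligation.
move=> f x y z; have [a [X px]] := cobjP x; have [b [Y py]] := cobjP y.
have [c [Z pz]] := cobjP z.
have conjM := cbox_deg f; have asG := esym (mulgA a b c).
have qx := pact (erefl : gaut f a _) px; have qy := pact (erefl : gaut f b _) py.
have qz := pact (erefl : gaut f c _) pz.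
have pxy := pten (erefl (a * b)) px py; have pyz := pten (erefl (b * c)) py pz.
have pl := pten asG pxy pz; have pr := pten (erefl _) px pyz.
have ql := pact (erefl : gaut f _ _) pl; have qr := pact (erefl : gaut f _ _) pr.
have qxy := pact (erefl : gaut f _ _) pxy.
have qyz := pact (erefl : gaut f _ _) pyz.
have e1 : f * (a * b) * f^-1 * (f * c * f^-1) = f * (a * (b * c)) * f^-1.
  by rewrite conjM asG.
have rxy := pten (conjM a b) qx qy; have ryz := pten (conjM b c) qy qz.
have rl := pten e1 qxy qz; have rr := pten (conjM a (b * c)) qx qyz.
have rl' := pten e1 rxy qz; have rr' := pten (conjM a (b * c)) qx ryz.
rewrite (cassoE px py pz pl pr) (cmuE pxy pz rl ql) (cmuE px py rxy qxy).
rewrite (cmuE px pyz rr qr) (cmuE py pz ryz qyz) (cassoE qx qy qz rl' rr').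
rewrite (cactE _ _ _ ql qr) (ctenr_in _ _ qz _ rl' rl).
rewrite (ctenl_in qx _ _ _ rr' rr) !cinM; congr cin; exact: massocM.
Qed.
Next Obligation.
move=> f x; have [a [X px]] := cobjP x.
have qx := pact (erefl : gaut f a _) px.
have q1 := pact (gaut_one f) (erefl cone).
have p := pten (mul1g a) (erefl cone) px.
have q := pact (erefl : gaut f a _) p.
have r := pten (mul1g _) q1 qx; have r' := pten (mul1g _) (erefl cone) qx.
rewrite (clunE px p px) (cmuE (erefl cone) px r q) (clunE qx r' qx).
rewrite (cepsE (erefl cone) q1) (cactE _ _ _ q qx).
by rewrite (ctenr_in _ _ qx _ r' r) !cinM; congr cin; exact: mlunM.
Qed.
Next Obligation.
move=> f x; have [a [X px]] := cobjP x.
have qx := pact (erefl : gaut f a _) px.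
have q1 := pact (gaut_one f) (erefl cone).
have p := pten (mulg1 a) px (erefl cone).
have q := pact (erefl : gaut f a _) p.
have r := pten (mulg1 _) qx q1; have r' := pten (mulg1 _) qx (erefl cone).
rewrite (crunE px p px) (cmuE px (erefl cone) r q) (crunE qx r' qx).
rewrite (cepsE (erefl cone) q1) (cactE _ _ _ q qx).
by rewrite (ctenl_in qx _ _ _ r' r) !cinM; congr cin; exact: mrunM.
Qed.

Lemma cactM_nat (f g h : G) (e : g * f = h) (x y : B) (u : hom x y) :
  fmap (cact h) u \o cactM x e = cactM y e \o fmap (cact g) (fmap (cact f) u).
Proof.
have [a [X px]] := cobjP x.
have [[Y [py [{}u ->]]]|->] := chomP px u; last first.
  by rewrite !fmap0 cmp0m cmpm0.
have qx := pact (erefl : gaut f a _) px; have qy := pact (erefl : gaut f a _) py.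
have eg := gaut_comp a e.
have rx := pact eg qx; have ry := pact eg qy.
have sx := pact (erefl : gaut h a _) px; have sy := pact (erefl : gaut h a _) py.
rewrite (cactME px e rx sx) (cactME py e ry sy) (cactE _ _ _ sx sy).
by rewrite (cactE _ _ _ qx qy) (cactE _ _ _ rx ry) !cinM (nicN (mactM _ _ _ _ _)).
Qed.
Lemma cactM_mu (f g h : G) (e : g * f = h) (x y : B) :
  cactM (cten x y) e \o (fmap (cact g) (cmu x y f) \o cmu (cact f x) (cact f y) g) =
  cmu x y h \o bmap cten (cactM x e) (cactM y e).
Proof.
have [a [X px]] := cobjP x; have [b [Y py]] := cobjP y.
have qx := pact (erefl : gaut f a _) px; have qy := pact (erefl : gaut f b _) py.
have rx := pact (gaut_comp a e) qx; have ry := pact (gaut_comp b e) qy.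
have sx := pact (erefl : gaut h a _) px; have sy := pact (erefl : gaut h b _) py.
have p := pten (erefl (a * b)) px py.
have q := pact (erefl : gaut f _ _) p; have r := pact (gaut_comp _ e) q.
have s := pact (erefl : gaut h _ _) p.
have p' := pten (cbox_deg f a b) qx qy.
have q' := pact (gaut_comp _ e) p'.
have p'' := pten (cbox_deg h a b) rx ry; have s' := pten (cbox_deg h a b) sx sy.
rewrite (cactME p e r s) (cmuE px py p' q) (cmuE px py s' s).
rewrite (cactE _ _ _ q' r) (cmuE qx qy p'' q').
rewrite (cactME px e rx sx) (cactME py e ry sy) (ctenE _ _ _ _ _ _ p'' s').
by rewrite !cinM; congr cin; exact: boxM_comp.
Qed.
Lemma cactM_eps (f g h : G) (e : g * f = h) :
  cactM cone e \o (fmap (cact g) (ceps f) \o ceps g) = ceps h.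
Proof.
have p := pact (gaut_one f) (erefl cone).
have q := pact (gaut_one g) (erefl cone); have s := pact (gaut_one h) (erefl cone).
have r := pact (gaut_one g) p.
rewrite (cactME (erefl cone) e r s) (cepsE (erefl cone) p).
rewrite (cepsE (erefl cone) q) (cepsE (erefl cone) s).
by rewrite (cactE _ _ _ q r) !cinM; congr cin; exact: unitM_comp.
Qed.

Definition csmM (f g h : G) (e : g * f = h) :
    smniso (smcomp (csm g) (csm f)) (csm h) :=
  @SMNIso k cmon cmon (smcomp (csm g) (csm f)) (csm h)
    (@NIso _ _ _ (smcomp (csm g) (csm f)) (csm h) (fun x => cactM x e)
       (cactM_nat e)) (cactM_mu e) (cactM_eps e).

Lemma cact1_nat (x y : B) (u : hom x y) :
  fmap (cact 1) u \o cact1 x = cact1 y \o u.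
Proof.
have [a [X px]] := cobjP x.
have [[Y [py [{}u ->]]]|->] := chomP px u; last first.
  by rewrite fmap0 cmp0m cmpm0.
have qx := pact (gaut1 a) px; have qy := pact (gaut1 a) py.
rewrite (cact1E px px qx) (cact1E py py qy) (cactE _ _ _ qx qy).
by rewrite !cinM (nicN (mact1 _ _)).
Qed.
Lemma cact1_mu (x y : B) :
  cact1 (cten x y) \o idm _ = cmu x y 1 \o bmap cten (cact1 x) (cact1 y).
Proof.
have [a [X px]] := cobjP x; have [b [Y py]] := cobjP y.
have qx := pact (gaut1 a) px; have qy := pact (gaut1 b) py.
have p := pten (erefl (a * b)) px py; have q := pact (gaut1 (a * b)) p.
have r := pten (erefl (a * b)) qx qy.
rewrite cmpm1 (cact1E p p q) (cact1E px px qx) (cact1E py py qy).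
rewrite (cmuE px py r q) (ctenE _ _ _ _ _ _ p r) !cinM; congr cin.
exact: boxM_one.
Qed.
Lemma cact1_eps : cact1 cone \o idm _ = ceps 1.
Proof.
have q := pact (gaut1 1) (erefl cone).
rewrite cmpm1 (cact1E (erefl cone) (erefl cone) q).
by rewrite (cepsE (erefl cone) q); congr cin; exact: unitM_one.
Qed.

Definition csm1 : smniso (smid cmon) (csm 1) :=
  @SMNIso k cmon cmon (smid cmon) (csm 1)
    (@NIso _ _ _ (smid cmon) (csm 1) cact1 cact1_nat) cact1_mu cact1_eps.

Lemma cinv_prod (a b c : G) : b * a = c -> a^-1 * b^-1 = c^-1.
Proof. by move=> <-; rewrite invgM. Qed.

(** The crossed action of 1 is [csm 1^-1], and [1^-1] equals 1 only propositionally; the transport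
    is confined to this definition. *)
Definition csm1_at (u : G) (e : 1 = u) : smniso (smid cmon) (csm u) :=
  match e with erefl => csm1 end.

Lemma cactM_1l (u f : G) (eu : 1 = u) (e : u * f = f) (x : B) :
  cactM x e \o csm1_at eu (cact f x) = idm (cact f x).
Proof.
subst u; change (cactM x e \o cact1 (cact f x) = idm (cact f x)).
have [a [X px]] := cobjP x; have qx := pact (erefl : gaut f a _) px; have r := pact (gaut1 _) qx.
by rewrite (cactME px e r qx) (cact1E qx qx r) cinM mact1m (cin1 qx).
Qed.

Lemma cactM_1r (u f : G) (eu : 1 = u) (e : f * u = f) (x : B) :
  cactM x e \o fmap (cact f) (csm1_at eu x) = idm (cact f x).
Proof.
subst u; have [a [X px]] := cobjP x; have qx := pact (erefl : gaut f a _) px; have r := pact (gaut1 _) px.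
have s := pact (erefl : gaut f a _) r.
change (cactM x e \o fmap (cact f) (cact1 x) = idm (cact f x)).
rewrite (cactME px e s qx) (cact1E px px r) (cactE _ _ _ qx s) cinM.
by rewrite mactm1 (cin1 qx).
Qed.

Lemma cactM_A (f g h gf hg hgf : G) (e1 : g * f = gf) (e2 : h * g = hg)
    (e3 : hg * f = hgf) (e4 : h * gf = hgf) (x : B) :
  cactM x e4 \o fmap (cact h) (cactM x e1) =
  cactM x e3 \o cactM (cact f x) e2.
Proof.
have [a [X px]] := cobjP x; have qf := pact (erefl : gaut f a _) px.
have qgf := pact (erefl : gaut gf a _) px.
have q := pact (erefl : gaut hgf a _) px.
have r := pact (gaut_comp a e1) qf; have r' := pact (gaut_comp a e4) qgf.
have r'' := pact (gaut_comp a e3) qf.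
have s := pact (gaut_comp a e4) r.
rewrite (cactME px e1 r qgf) (cactME px e4 r' q) (cactME px e3 r'' q).
rewrite (cactME qf e2 s r'') (cactE _ _ _ s r') !cinM; congr cin.
exact: esym (mactA _ _ _ _ _ _ _ _ _ _ _).
Qed.

Program Definition precrossed_of : precrossed :=
  @Precrossed cmon (fun x => projT1 x) (fun _ _ => erefl) erefl _
    (fun a => csm a^-1) _ (fun a b c e => csmM (cinv_prod e))
    (csm1_at (esym (invg1 G))) _ _ _.
Next Obligation. by move=> x y f; exact: chom0. Qed.
Next Obligation. by move=> a x /=; rewrite invgK. Qed.
Next Obligation.
move=> a b c ba cb cba eba ecb e1 e2 x; exact: cactM_A.
Qed.
Next Obligation. move=> a e x; exact: cactM_1l. Qed.
Next Obligation. move=> a e x; exact: cactM_1r. Qed.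

End OfMonoidale.

End Precrossed.

(** * Adjoining direct sums *)

Section MatSum.

Variables (k : comPzRingType) (B : kcat k).

Lemma codiagK (X Y : mobj B) (e : idx X -> idx Y)
    (m : forall i, iso (X i) (Y (e i))) :
  injective e ->
  mcmp (codiag (fun i => bwd (m i))) (diag (fun i => fwd (m i))) = @midm k B X.
Proof.
move=> inj_e; apply: diagP => [i|i j ne].
  by rewrite mcmp_diagr codiagE fwdK.
by rewrite mcmp_diagr codiag0 ?cmp0m // => /inj_e /esym.
Qed.

(** A formal sum is the direct sum of the blocks of any partition of its index type. Entries need
    only agree up to isomorphism, which matters when an entry is merely known to be equal to an
    object coming from [M a]. *)
Lemma dsum_mat n (Y : 'I_n -> mat B) (S : mat B)
    (e : forall i, idx (Y i) -> idx S)
    (m : forall i a, iso (Y i a) (S (e i a))) :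
  (forall s, exists i a, e i a = s) -> (forall i, injective (e i)) ->
  (forall i j a b, e i a = e j b -> i = j) ->
  is_dsum Y S.
Proof.
move=> surj_e inj_e inj_i.
exists (fun i => diag (fun a => fwd (m i a))).
exists (fun i => codiag (fun a => bwd (m i a))).
split=> [i|i j ne|]; first exact: codiagK.
  apply: mhomP => a b; rewrite [LHS]mcmp_diagr codiag0 ?cmp0m // => /inj_i.
  by move/esym.
apply: mhomP => s t; rewrite !pi_sumE.
have [i [a <-]] := surj_e s.
rewrite (bigD1 i) //= big1 ?addr0 => [|j /eqP ne]; last first.
  rewrite /mcmp big1 // => b _; rewrite codiag0 ?cmpm0 // => /inj_i.
  exact: ne.
rewrite /mcmp (bigD1 a) //= codiagE big1 ?addr0 => [|b /eqP ne]; last first.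
  by rewrite codiag0 ?cmpm0 // => /inj_e.
case: (e i a =P t) => [<-|ne]; last by rewrite diag0 // cmp0m /midm diag0.
by rewrite diagE bwdK /midm (@diagE _ _ S S id).
Qed.

Definition msum n (X : 'I_n -> mobj B) : mobj B :=
  @MObj _ {i : 'I_n & idx (X i)} (fun s => X (tag s) (tagged s)).

Lemma msumP n (X : 'I_n -> mat B) : is_dsum X (msum X : mat B).
Proof.
apply: (@dsum_mat n X (msum X) (fun i a => Tagged (fun i => idx (X i)) a)
  (fun i a => iso_id _)).
- by case=> i a; exists i, a.
- by move=> i a b /eqP; rewrite -tag_eqE /tag_eq eqxx tagged_asE => /eqP.
- by move=> i j a b [].
Qed.

Lemma mat_fds : has_fds (mat B).
Proof. by move=> n X; exists (msum X); exact: msumP. Qed.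

End MatSum.

(** * Monoidal categories of objects with additional data *)

Section Tagged.

Variables (k : comPzRingType).

Section Mon.

Variables (C : kmoncat k) (T : C -> Type).
Variable tenT : forall X Y, T X -> T Y -> T (ten C X Y).
Variable oneT : T (Defs.one C).

Definition tcat : kcat k := @ind k C {X : C & T X} (fun X => projT1 X).

Definition tten : kbifun tcat tcat tcat :=
  @KBifun k tcat tcat tcat
    (fun X Y => existT _ _ (tenT (projT2 X) (projT2 Y)))
    (fun X X' Y Y' f g => bmap (ten C) f g)
    (fun X X' Y Y' g =>
       bmap_linl (ten C) (X := projT1 X) (X' := projT1 X') g)
    (fun X X' Y Y' f =>
       bmap_linr (ten C) (Y := projT1 Y) (Y' := projT1 Y') f)
    (fun X Y => bmap1 (ten C) (projT1 X) (projT1 Y))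
    (fun X X' X'' Y Y' Y'' f' f g' g => bmapM (ten C) f' f g' g).

Definition tone : tcat := existT _ _ oneT.

Definition tiso (X Y : tcat) (i : iso (projT1 X) (projT1 Y)) : iso X Y :=
  @ind_iso k C _ (fun X : {X : C & T X} => projT1 X) X Y i.

Program Definition tmon : kmoncat k :=
  @KMonCat k tcat tten tone
    (fun X Y Z => @tiso (tten (tten X Y) Z) (tten X (tten Y Z))
       (asso (projT1 X) (projT1 Y) (projT1 Z))) _
    (fun X => @tiso (tten tone X) X (lun (projT1 X))) _
    (fun X => @tiso (tten X tone) X (run (projT1 X))) _ _ _.
Next Obligation. by move=> *; exact: assoN. Qed.
Next Obligation. by move=> *; exact: lunN. Qed.
Next Obligation. by move=> *; exact: runN. Qed.
Next Obligation. by move=> *; exact: pentagon. Qed.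
Next Obligation. by move=> *; exact: triangle. Qed.

Program Definition tsm (F : smfun C C) (FT : forall X, T X -> T (F X)) :
    smfun tmon tmon :=
  @SMFun k tmon tmon
    (@KFun k tcat tcat (fun X => existT _ _ (FT _ (projT2 X)))
       (fun X Y f => fmap F f)
       (fun X Y => fmap_lin F (X := projT1 X) (Y := projT1 Y))
       (fun X => fmap1 F (projT1 X)) (fun X Y Z g f => fmapM F g f))
    (fun X Y => @tiso (tten (existT _ _ (FT _ (projT2 X)))
        (existT _ _ (FT _ (projT2 Y))))
      (existT _ _ (FT _ (projT2 (tten X Y)))) (mu F (projT1 X) (projT1 Y)))
    _ (@tiso tone (existT _ _ (FT _ oneT)) (eps F)) _ _ _.
Next Obligation. by move=> *; exact: muN. Qed.
Next Obligation. by move=> *; exact: muA. Qed.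
Next Obligation. by move=> *; exact: mu1m. Qed.
Next Obligation. by move=> *; exact: mum1. Qed.

Program Definition tniso (F G H : smfun C C) FT GT HT
    (t : smniso (smcomp G F) H) : smniso (smcomp (@tsm G GT) (@tsm F FT)) (@tsm H HT) :=
  @SMNIso k tmon tmon (smcomp (@tsm G GT) (@tsm F FT)) (@tsm H HT)
    (@NIso k tmon tmon (smcomp (@tsm G GT) (@tsm F FT)) (@tsm H HT)
       (fun X => @tiso (smcomp (@tsm G GT) (@tsm F FT) X) (@tsm H HT X) (t (projT1 X)))
       (fun X Y f => nicN t (X := projT1 X) (Y := projT1 Y) f))
    (fun X Y => smnic_mu t (projT1 X) (projT1 Y)) (smnic_eps t).

Definition tniso1 (H : smfun C C) HT (t : smniso (smid C) H) :
    smniso (smid tmon) (@tsm H HT) :=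
  @SMNIso k tmon tmon (smid tmon) (@tsm H HT)
    (@NIso k tmon tmon (smid tmon) (@tsm H HT)
       (fun X => @tiso X (@tsm H HT X) (t (projT1 X)))
       (fun X Y f => nicN t (X := projT1 X) (Y := projT1 Y) f))
    (fun X Y => smnic_mu t (projT1 X) (projT1 Y)) (smnic_eps t).

End Mon.

End Tagged.

Lemma fmap_diag (k : comPzRingType) (C D : kcat k) (F : kfun C D) (X Y : mobj C) (e : idx X -> idx Y)
    (m : forall i, hom (X i) (Y (e i))) :
  fmap (mat_fun F) (diag m : @hom k (mat C) X Y) =
  @diag k D (mapm F X) (mapm F Y) e (fun i => fmap F (m i)).
Proof. by rewrite -map_diag. Qed.

Section MatNiso.

Variables (k : comPzRingType) (C D E : kmoncat k).

Program Definition mat_niso (F : smfun C D) (G : smfun D E) (H : smfun C E)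
    (t : smniso (smcomp G F) H) :
    smniso (smcomp (mat_sm G) (mat_sm F)) (mat_sm H) :=
  @SMNIso k (mat_mon C) (mat_mon E) (smcomp (mat_sm G) (mat_sm F)) (mat_sm H)
    (@NIso k (mat_mon C) (mat_mon E) (smcomp (mat_sm G) (mat_sm F)) (mat_sm H)
       (fun X => @diag_iso k E (mapm G (mapm F X)) (mapm H X) id id
          (fun=> erefl) (fun=> erefl) (fun i => t (X i))) _) _ _.
Next Obligation.
move=> F G H t X Y f; apply: diag_natural => [|i j]; first by exists id.
exact: (nicN t (f i j)).
Qed.
Next Obligation.
move=> F G H t X Y.
have fm := @fmap_diag k _ _ G (mapm2 (ten D) (mapm F X) (mapm F Y))
  (mapm F (mapm2 (ten C) X Y)) id (fun i => fwd (mu F (X i.1) (Y i.2))).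
apply: etrans (congr1 (fun f => mcmp _ (mcmp f _)) fm) _.
rewrite /= !bmap_diag /= !mcmp_diag.
apply: (@diagP k E (mapm2 (ten E) (mapm G (mapm F X)) (mapm G (mapm F Y)))
  (mapm H (mapm2 (ten C) X Y)) _ _ _ _ _) => -[i j]; last exact: diag0.
apply: etrans (@diagE k E (mapm2 (ten E) (mapm G (mapm F X)) (mapm G (mapm F Y)))
  (mapm H (mapm2 (ten C) X Y)) id _ (i, j)) _.
exact: (smnic_mu t (X i) (Y j)).
Qed.
Next Obligation.
move=> F G H t.
have fm := @fmap_diag k _ _ G (mat_one D) (mapm F (mat_one C)) id
  (fun i => fwd (eps F)).
apply: etrans (congr1 (fun f => mcmp _ (mcmp f _)) fm) _.
by rewrite /= !mcmp_diag; eq_diag => i; exact: (smnic_eps t).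
Qed.

Program Definition mat_niso1 (H : smfun C C) (t : smniso (smid C) H) :
    smniso (smid (mat_mon C)) (mat_sm H) :=
  @SMNIso k (mat_mon C) (mat_mon C) (smid (mat_mon C)) (mat_sm H)
    (@NIso k (mat_mon C) (mat_mon C) (smid (mat_mon C)) (mat_sm H)
       (fun X => @diag_iso k C X (mapm H X) id id
          (fun=> erefl) (fun=> erefl) (fun i => t (X i))) _) _ _.
Next Obligation.
move=> H t X Y f; apply: diag_natural => [|i j]; first by exists id.
exact: (nicN t (f i j)).
Qed.
Next Obligation.
move=> H t X Y; apply: etrans (@cmpm1 k (mat_mon C) _ _ _) _.
rewrite /= !bmap_diag /= !mcmp_diag.
apply: (@diagP k C (mapm2 (ten C) X Y)
  (mapm H (mapm2 (ten C) X Y)) _ _ _ _ _) => -[i j]; last exact: diag0.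
apply: etrans (@diagE k C (mapm2 (ten C) X Y)
  (mapm H (mapm2 (ten C) X Y)) id _ (i, j)) _.
have := smnic_mu t (X i) (Y j).
by rewrite /= cmpm1; exact.
Qed.
Next Obligation.
move=> H t; apply: etrans (@cmpm1 k (mat_mon C) _ _ _) _.
rewrite /=; eq_diag => i; have := smnic_eps t; rewrite /= cmpm1; exact.
Qed.

End MatNiso.

Section Niso.

Variable k : comPzRingType.

Lemma iso_inj (C : kcat k) (X Y Z : C) (i : iso X Y) (f g : hom Z X) :
  i \o f = i \o g -> f = g.
Proof.
move=> e; rewrite -(cmp1m f) -(fwdK i) -cmpA e cmpA fwdK.
exact: cmp1m.
Qed.

Lemma iso_surj (C : kcat k) (X Y Z : C) (i : iso X Y) (f g : hom Y Z) :
  f \o i = g \o i -> f = g.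
Proof.
move=> e; rewrite -(cmpm1 f) -(bwdK i) cmpA e -cmpA bwdK.
exact: cmpm1.
Qed.

Definition iso_inv (C : kcat k) (X Y : C) (i : iso X Y) : iso Y X :=
  Iso (bwdK i) (fwdK i).

Program Definition niso_inv (C D : kcat k) (F H : kfun C D) (t : niso F H) :
    niso H F :=
  @NIso k C D H F (fun X => iso_inv (t X)) _.
Next Obligation.
move=> C D F H t X Y f /=; apply: (@iso_inj _ _ _ _ (t Y)).
by rewrite cmpA -(nicN t) -cmpA bwdK cmpm1 cmpA bwdK cmp1m.
Qed.

Program Definition niso_comp (C D : kcat k) (E F H : kfun C D) (t : niso F H)
    (s : niso E F) : niso E H :=
  @NIso k C D E H (fun X => iso_comp (t X) (s X)) _.
Next Obligation.
by move=> C D E F H t s X Y f /=; rewrite cmpA (nicN t) -!cmpA (nicN s).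
Qed.

End Niso.

(** * The crossed category of formal direct sums *)

Section Completion.

Variables (k : comPzRingType) (G : groupType) (P : precrossed k G).

Let B : kmoncat k := mat_mon P.

(* A homogeneous object remembers its degree: the zero object has to lie in
   each of the pairwise disjoint subcategories of homogeneous objects. *)
Definition degtag (X : B) := {t : option G |
  forall a, t = Some a -> forall i, pdeg (X i) = a}.

Definition opt_mul (s t : option G) : option G :=
  if s is Some a then if t is Some b then Some (a * b) else None else None.

Definition tag_ten (X Y : B) (s : degtag X) (t : degtag Y) :
  degtag (ten B X Y).
Proof.
exists (opt_mul (sval s) (sval t)) => c.
case: s t => [[a|] sP] [[b|] tP] //= [<-] i.
by rewrite pdeg_ten (sP a) // (tP b).
Defined.

Definition tag_one : degtag (Defs.one B).
Proof. by exists (Some 1) => a [<-] i; exact: pdeg_one. Defined.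

Definition tag_phi (a : G) (X : B) (t : degtag X) : degtag (mat_sm (pphi P a) X).
Proof.
exists (omap (fun b => a^-1 * b * a) (sval t)).
case: t => -[b|] //= tP c [<-] i; by rewrite pphi_deg (tP b).
Defined.

Definition ccomp : kmoncat k := tmon tag_ten tag_one.

Definition cdeg (a : G) (X : ccomp) : Prop := sval (projT2 X) = Some a.

Lemma cdegP a X i : cdeg a X -> pdeg (projT1 X i) = a.
Proof. by move=> e; exact: (svalP (projT2 X) a e i). Qed.

Lemma ccomp_fds : has_fds ccomp.
Proof.
(* The summands may have various degrees, so the sum is tagged as having none. *)
move=> n X; have tP : degtag (msum (fun i => projT1 (X i))) by exists None.
exists (existT _ (msum (fun i => projT1 (X i))) tP).
exact: (msumP (fun i => projT1 (X i))).
Qed.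

Lemma cdeg_fds a : has_fds (full (cdeg a)).
Proof.
move=> n X.
have sP : forall b, Some a = Some b ->
    forall i, pdeg (msum (fun i => projT1 (sval (X i))) i) = b.
  by move=> b [<-] [i s]; exact: (cdegP s (svalP (X i))).
exists (exist (cdeg a) (existT degtag (msum (fun i => projT1 (sval (X i))))
  (exist _ (Some a) sP)) erefl).
exact: (msumP (fun i => projT1 (sval (X i)))).
Qed.

Lemma ccomp_split (X : ccomp) : exists n (a : 'I_n -> G) (Y : 'I_n -> ccomp),
  [/\ injective a, forall i, cdeg (a i) (Y i) & is_dsum Y X].
Proof.
(* The degrees that occur, each listed once so that [a] is injective; the entries are then grouped
   by degree. *)
set D := undup [seq pdeg (projT1 X i) | i : idx (projT1 X)].
pose a (i : 'I_(size D)) := tnth (in_tuple D) i.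
pose I i : finType := {j : idx (projT1 X) | pdeg (projT1 X j) == a i}.
have tP i b : Some (a i) = Some b ->
    forall j, pdeg (@MObj _ (I i) (fun j => projT1 X (val j)) j) = b.
  by move=> [<-] j; apply/eqP; exact: (valP j).
have inj_a : injective a by apply/tuple_uniqP; exact: undup_uniq.
exists (size D), a, (fun i => existT degtag
  (@MObj _ (I i) (fun j => projT1 X (val j))) (exist _ (Some (a i)) (tP i))).
split=> //; apply: (@dsum_mat k P _
  (fun i => @MObj _ (I i) (fun j => projT1 X (val j))) (projT1 X)
  (fun i j => val j) (fun i j => iso_id _)).
- move=> s; have /tnthP[i Ds] : pdeg (projT1 X s) \in in_tuple D.
    by rewrite mem_undup; apply: map_f; rewrite mem_enum.
  by exists i, (Sub s (introT eqP Ds)); exact: SubK.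
- by move=> i; exact: val_inj.
- move=> i j s t e; apply: inj_a.
  by rewrite -(eqP (valP s)) -(eqP (valP t)) /= e.
Qed.

Lemma ccomp_ten a b X Y :
  cdeg a X -> cdeg b Y -> cdeg (a * b) (ten ccomp X Y).
Proof. by rewrite /cdeg /= => -> ->. Qed.

Lemma ccomp_hom0 a b X Y :
  cdeg a X -> cdeg b Y -> a <> b -> forall f : hom X Y, f = 0%R.
Proof.
move=> aX bY ne f; apply: mhomP => i j; apply: pdeg_hom0.
by rewrite (cdegP i aX) (cdegP j bY).
Qed.

Definition ccomp_graded : graded k G :=
  @Graded k G ccomp ccomp_fds cdeg
    (fun a b X aX bX => Some_inj (etrans (esym aX) bX)) cdeg_fds ccomp_split
    ccomp_ten ccomp_hom0 erefl.

Definition cphi (a : G) : smfun ccomp_graded ccomp_graded :=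
  tsm _ _ (@tag_phi a).

Definition cphi_mul (a b c : G) (e : b * a = c) :
    smniso (smcomp (cphi a) (cphi b)) (cphi c) :=
  tniso _ _ _ _ _ (mat_niso (pphi_mul P e)).

Definition cphi_one : smniso (smid ccomp_graded) (cphi 1) :=
  tniso1 _ _ _ (mat_niso1 (pphi_one P)).

Lemma cphi_equiv a : is_equiv (cphi a).
Proof.
exists (cphi a^-1); split; constructor.
  exact: niso_comp (niso_inv cphi_one) (cphi_mul (mulgV a)).
exact: niso_comp (niso_inv cphi_one) (cphi_mul (mulVg a)).
Qed.

Lemma cphi_deg a b X : cdeg b X -> cdeg (a^-1 * b * a) (cphi a X).
Proof. by rewrite /cdeg /= => ->. Qed.

Program Definition completion : crossed k G :=
  @Crossed k G ccomp_graded cphi cphi_equiv cphi_deg cphi_mul cphi_one _ _ _.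
Next Obligation.
move=> a b c ba cb cba eba ecb e1 e2 X.
have fm := @fmap_diag k _ _ (pphi P a)
  (mapm (pphi P b) (mapm (pphi P c) (projT1 X)))
  (mapm (pphi P cb) (projT1 X)) id
  (fun i => fwd (pphi_mul P ecb (projT1 X i))).
apply: etrans (congr1 (fun f => mcmp _ f) fm) _.
rewrite /= !mcmp_diag.
by eq_diag => i; exact: pphi_mulA.
Qed.
Next Obligation.
move=> a e X; rewrite /= /midm !mcmp_diag.
by eq_diag => i; exact: pphi_mul1m.
Qed.
Next Obligation.
move=> a e X.
have fm := @fmap_diag k _ _ (pphi P a) (projT1 X) (mapm (pphi P 1) (projT1 X))
  id (fun i => fwd (pphi_one P (projT1 X i))).
apply: etrans (congr1 (fun f => mcmp _ f) fm) _.
by rewrite /= /midm !mcmp_diag; eq_diag => i; exact: pphi_mulm1.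
Qed.

End Completion.

(** * The unit of the completion *)

Section Singletons.

Variables (k : comPzRingType) (B : kcat k).

Definition sng (x : B) : mobj B := @MObj _ unit (fun=> x).

Lemma diag_sngE (X : mobj B) (y : B) (e : idx X -> unit)
    (m : forall i, hom (X i) y) i : @diag k B X (sng y) e m i tt = m i.
Proof.
rewrite /diag; case: eqP => [p|]; last by case: (e i).
by case: _ / p.
Qed.

(** The two index maps come from different composites and need not be convertible. Their values in
    [unit] agree anyway, so only the entries are compared. *)
Lemma eq_diag_sng (X : mobj B) (y : B) (e e' : idx X -> unit)
    (m m' : forall i, hom (X i) y) : (forall i, m i = m' i) ->
  @diag k B X (sng y) e m = @diag k B X (sng y) e' m'.
Proof. by move=> mm; apply: mhomP => i []; rewrite !diag_sngE. Qed.

Definition sng_map (x y : B) (f : hom x y) : mhom (sng x) (sng y) :=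
  @diag k B (sng x) (sng y) id (fun=> f).

End Singletons.

Ltac eq_sng := match goal with
  |- @eq _ (@diag ?k ?B ?X ?Y ?e ?m) (@diag _ _ _ _ ?e' ?m') =>
    refine (@eq_diag_sng k B X (@ent _ Y tt) e e' m m' _) end.

Definition ccomp_iso (k : comPzRingType) (G : groupType) (P : precrossed k G)
    a (X Y : comp_of (completion P) a)
    (i : @iso k (mat_mon P) (projT1 (sval X)) (projT1 (sval Y))) : iso X Y :=
  full_iso (C := completion P) (X := X) (Y := Y)
    (@ind_iso k (mat_mon P) {X : mat_mon P & degtag X} (fun X => projT1 X)
       (sval X) (sval Y) i).

Section Unit.

Variables (k : comPzRingType) (G : groupType) (M : monoidale k G).

Let B := coprod (fun a : G => M a).

Definition Phi : crossed k G := completion (precrossed_of M).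

Lemma sng_tag a (A : M a) b : Some a = Some b ->
  forall i : unit, projT1 (sng (cpair A : B) i) = b.
Proof. by case. Qed.

Definition sng_obj a (A : M a) : comp_of Phi a :=
  exist (cdeg (P := precrossed_of M) a)
    (existT (degtag (P := precrossed_of M)) (sng (cpair A : B))
       (exist _ (Some a) (sng_tag A))) erefl.

Definition sng_fmap a (X Y : M a) (u : hom X Y) :
    @hom k (mat B) (sng (cpair X : B)) (sng (cpair Y : B)) :=
  sng_map (cin (erefl (cpair X)) (erefl (cpair Y)) u : @hom k B _ _).

Lemma sng_fmap_lin a (X Y : M a) : linear (@sng_fmap a X Y).
Proof.
move=> l u v; apply: mhomP => -[] []; rewrite !pi_linE.
by rewrite /sng_fmap /sng_map !diag_sngE cin_lin.
Qed.

Lemma sng_fmap1 a (X : M a) : sng_fmap (idm X) = idm _.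
Proof.
rewrite /sng_fmap -(cin1 (erefl (cpair X) : (cpair X : B) = _)).
by apply: mhomP => i [].
Qed.

Lemma sng_fmapM a (X Y Z : M a) (v : hom Y Z) (u : hom X Y) :
  sng_fmap (v \o u) = sng_fmap v \o sng_fmap u.
Proof.
rewrite /= /sng_fmap /sng_map !mcmp_diag; eq_sng => i.
exact: esym (cinM _ _ _ _ _).
Qed.

Definition sng_fun a : kfun (M a) (comp_of Phi a) :=
  @KFun k (M a) (comp_of Phi a) (@sng_obj a) (@sng_fmap a) (@sng_fmap_lin a)
    (@sng_fmap1 a) (@sng_fmapM a).

(* The action of [f] on [Phi] is [cact] of the propositionally equal
   [f^-1^-1]. *)
Lemma pactV (f0 f a b : G) (ff : f0 = f) (e : gaut f a b) (X : M a) (x : B) :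
  x = cpair X -> cact M f0 x = cpair (mact M e X).
Proof. by subst f0; exact: pact. Qed.

Lemma cactVE (f0 f a b : G) (ff : f0 = f) (e : gaut f a b) (X Y : M a)
    (x y : B) (px : x = cpair X) (py : y = cpair Y) (u : hom X Y) pz pz' :
  fmap (cact M f0) (cin px py u) =
  @cin _ _ _ _ (mact M e X) (mact M e Y) _ _ pz pz' (fmap (mact M e) u).
Proof. by subst f0; exact: cactE. Qed.

Lemma cmuVE (f0 f a b ab a' b' c' : G) (ff : f0 = f) (X : M a) (Y : M b)
    (x y : B) (px : x = cpair X) (py : y = cpair Y)
    (e : a * b = ab) (e' : a' * b' = c')
    (ea : gaut f a a') (eb : gaut f b b') (ec : gaut f ab c') p q :
  fwd (cmu x y f0) =
  @cin _ _ _ _ _ _ _ _ p q (fwd (boxM e e' ea eb ec X Y)).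
Proof. by subst f0; exact: cmuE. Qed.

Lemma cepsVE (f0 f : G) (ff : f0 = f) (e : gaut f 1 1) p q :
  fwd (ceps M f0) = @cin _ _ _ _ _ _ _ _ p q (fwd (unitM M e)).
Proof. by subst f0; exact: cepsE. Qed.

Lemma cactMVE (f0 g0 h0 f g h a a' a'' : G) (ff : f0 = f) (gg : g0 = g)
    (hh : h0 = h) (X : M a) (x : B) (px : x = cpair X)
    (ef : gaut f a a') (eg : gaut g a' a'') (eh : gaut h a a'')
    (e0 : g0 * f0 = h0) (e : g * f = h) p q :
  fwd (cactM x e0) =
  @cin _ _ _ _ _ _ _ _ p q (fwd (mactM M ef eg eh e X)).
Proof.
by subst f0 g0 h0; rewrite (Prop_irrelevance e0 e); exact: cactME.
Qed.

Lemma csm1_atE (u : G) (eu : 1 = u) a (X : M a) (x : B) (px : x = cpair X)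
    (e : gaut 1 a a) p q :
  fwd (csm1_at M eu x) = @cin _ _ _ _ _ _ _ _ p q (fwd (mact1 M e X)).
Proof. by subst u; exact: cact1E. Qed.

Local Notation "[: X :]" := (sng (cpair X : B)) (format "[: X :]").
Local Notation vv f := (f^-1^-1).
Local Notation act f := (mat_fun (cact M f)).
Local Notation mten := (mat_bifun (cten M)).

(** The action on [Phi M] is that of [M] on each entry, so this constraint is an identity of [M b]
    read along an equality of objects of the coproduct. The lemmas below state the axioms of a
    morphism of monoidales at the level of matrices, where neither tags nor proofs of homogeneity
    appear. *)
Definition sng_act f a b (e : gaut f a b) (X : M a) :
    @iso k (mat B) (act (vv f) [: X :]) [: mact M e X :] :=
  @diag_iso k B (mapm (cact M (vv f)) [: X :]) [: mact M e X :] id id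
    (fun=> erefl) (fun=> erefl)
    (fun=> cin_iso (pactV (invgK f) e erefl) erefl (iso_id _)).

Definition sng_box a b c (e : a * b = c) (X : M a) (Y : M b) :
    @iso k (mat B) (mten [: X :] [: Y :]) [: box M e X Y :] :=
  @diag_iso k B (mapm2 (cten M) [: X :] [: Y :]) [: box M e X Y :]
    (fun=> tt) (fun=> (tt, tt)) (fun p => let: (tt, tt) := p in erefl)
    (fun p => let: tt := p in erefl)
    (fun p => cin_iso (pten e erefl erefl) erefl (iso_id _)).

Lemma fmap_sng f (x y : B) (u : hom x y) :
  fmap (act f) (sng_map u) = sng_map (fmap (cact M f) u).
Proof. exact: fmap_diag. Qed.

Lemma sng_actE f a b (e : gaut f a b) (X : M a) :
  fwd (sng_act e X) =
  @diag k B (mapm (cact M (vv f)) [: X :]) [: mact M e X :] id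
    (fun=> cin (pactV (invgK f) e erefl) erefl (idm _)).
Proof. by []. Qed.

Lemma sng_boxE a b c (e : a * b = c) (X : M a) (Y : M b) :
  fwd (sng_box e X Y) =
  @diag k B (mapm2 (cten M) [: X :] [: Y :]) [: box M e X Y :] (fun=> tt)
    (fun=> cin (pten e erefl erefl) erefl (idm _)).
Proof. by []. Qed.

Lemma cmp_diag (X Y Z : mobj B) (e : idx X -> idx Y) (e' : idx Y -> idx Z)
    (m : forall i, hom (X i) (Y (e i))) (m' : forall i, hom (Y i) (Z (e' i))) :
  @cmp k (mat B) X Y Z (diag m') (diag m) =
  @diag k B X Z (fun i => e' (e i)) (fun i => m' (e i) \o m i).
Proof. exact: mcmp_diag. Qed.

Let pv f a b (e : gaut f a b) (X : M a) := pactV (invgK f) e (erefl (cpair X)).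

Lemma sng_actN f a b (e : gaut f a b) (X Y : M a) (u : hom X Y) :
  sng_fmap (fmap (mact M e) u) \o sng_act e X =
  sng_act e Y \o fmap (act (vv f)) (sng_fmap u).
Proof.
rewrite /sng_fmap fmap_sng !sng_actE !cmp_diag; eq_sng => i.
by rewrite (cactVE (invgK f) _ _ _ (pv e X) (pv e Y)) !cinM cmpm1 cmp1m.
Qed.

Lemma sng_act_comp f g h a b c (ef : gaut f a b) (eg : gaut g b c)
    (eh : gaut h a c) (e : g * f = h) (e0 : vv g * vv f = vv h) (X : M a) :
  sng_act eh X \o
    @diag k B (act (vv g) (act (vv f) [: X :])) (act (vv h) [: X :]) id
      (fun=> fwd (cactM (cpair X) e0)) =
  sng_fmap (mactM M ef eg eh e X) \o
    (sng_act eg (mact M ef X) \o fmap (act (vv g)) (sng_act ef X)).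
Proof.
rewrite !sng_actE fmap_diag !cmp_diag; eq_sng => i.
have p := pactV (invgK g) eg (pv ef X).
rewrite (cactMVE (invgK f) (invgK g) (invgK h) erefl e0 e p (pv eh X)).
rewrite (cactVE (invgK g) _ _ _ p (pv eg (mact M ef X))).
by rewrite !cinM fmap1 !cmp1m cmpm1.
Qed.

Lemma sng_act_one a (e : gaut 1 a a) (eu : 1 = vv 1) (X : M a) :
  sng_act e X \o
    @diag k B [: X :] (act (vv 1) [: X :]) id (fun=> fwd (csm1_at M eu (cpair X)))
  = sng_fmap (mact1 M e X).
Proof.
rewrite /sng_fmap /sng_map sng_actE cmp_diag; eq_sng => i.
by rewrite (csm1_atE eu erefl erefl (pv e X)) cinM cmp1m.
Qed.

Lemma sng_boxN a b c (e : a * b = c) (X X' : M a) (Y Y' : M b) (u : hom X X')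
    (v : hom Y Y') :
  sng_fmap (bmap (box M e) u v) \o sng_box e X Y =
  sng_box e X' Y' \o bmap mten (sng_fmap u) (sng_fmap v).
Proof.
rewrite /sng_fmap /sng_map [bmap mten _ _]bmap_diag !sng_boxE !cmp_diag.
eq_sng => i; rewrite (ctenE _ _ _ _ _ _ (pten e erefl erefl) (pten e erefl erefl)).
by rewrite !cinM cmpm1 cmp1m.
Qed.

Lemma sng_boxM f a b c a' b' c' (e : a * b = c) (e' : a' * b' = c')
    (ea : gaut f a a') (eb : gaut f b b') (ec : gaut f c c') (X : M a) (Y : M b) :
  sng_act ec (box M e X Y) \o
    (fmap (act (vv f)) (sng_box e X Y) \o
      @diag k B (mten (act (vv f) [: X :]) (act (vv f) [: Y :]))
        (act (vv f) (mten [: X :] [: Y :])) id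
        (fun=> fwd (cmu (cpair X) (cpair Y) (vv f)))) =
  sng_fmap (boxM e e' ea eb ec X Y) \o
    (sng_box e' (mact M ea X) (mact M eb Y) \o
      bmap mten (sng_act ea X) (sng_act eb Y)).
Proof.
rewrite sng_actE !sng_boxE !sng_actE [bmap mten _ _]bmap_diag fmap_diag !cmp_diag.
eq_sng => i.
have p := pten e' (pv ea X) (pv eb Y).
have q := pactV (invgK f) ec (pten e (erefl (cpair X)) (erefl (cpair Y))).
rewrite (cmuVE (invgK f) erefl erefl p q).
rewrite (cactVE (invgK f) _ _ _ q (pv ec (box M e X Y))).
rewrite (ctenE _ _ _ _ _ _ p (pten e' erefl erefl)) !cinM.
by rewrite fmap1 bmap1 !cmp1m cmpm1.
Qed.

Lemma sng_unitM f (e : gaut f 1 1) :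
  sng_act e (munit M) \o (fmap (act (vv f)) (idm (mat_one (cmon M))) \o
    @diag k B [: munit M :] (act (vv f) [: munit M :]) id
      (fun=> fwd (ceps M (vv f)))) =
  sng_fmap (unitM M e) \o idm _.
Proof.
rewrite fmap1 cmp1m cmpm1 /sng_fmap /sng_map sng_actE cmp_diag; eq_sng => i.
rewrite (cepsVE (invgK f) (erefl (cone M)) (pv e (munit M))) cinM.
by rewrite cmp1m.
Qed.

Lemma sng_assoc a b c ab bc abc (e1 : a * b = ab) (e2 : ab * c = abc)
    (e3 : b * c = bc) (e4 : a * bc = abc) (X : M a) (Y : M b) (Z : M c) :
  sng_fmap (massoc e1 e2 e3 e4 X Y Z) \o
    (sng_box e2 (box M e1 X Y) Z \o
      bmap mten (sng_box e1 X Y) (idm ([: Z :] : mat B))) =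
  sng_box e4 X (box M e3 Y Z) \o
    (bmap mten (idm ([: X :] : mat B)) (sng_box e3 Y Z) \o
      matA (B := cmon M) [: X :] [: Y :] [: Z :]).
Proof.
have asE : fwd (matA (B := cmon M) [: X :] [: Y :] [: Z :]) =
  @diag k B (mten (mten [: X :] [: Y :]) [: Z :])
    (mten [: X :] (mten [: Y :] [: Z :])) (fun p => (p.1.1, (p.1.2, p.2)))
    (fun=> fwd (casso (cpair X) (cpair Y) (cpair Z))) by [].
rewrite asE !sng_boxE ![bmap mten _ _]bmap_diag !cmp_diag; eq_sng => i.
have pXY := pten e1 (erefl (cpair X)) (erefl (cpair Y)).
have pYZ := pten e3 (erefl (cpair Y)) (erefl (cpair Z)).
have p := pten e2 pXY (erefl (cpair Z)).
have q := pten e4 (erefl (cpair X)) pYZ.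
rewrite (cassoE erefl erefl erefl p q).
rewrite (ctenr_in _ _ (erefl (cpair Z)) _ p (pten e2 erefl erefl)).
rewrite (ctenl_in (erefl (cpair X)) _ _ _ q (pten e4 erefl erefl)).
by rewrite !cinM !bmap1 !cmp1m !cmpm1.
Qed.

Lemma sng_lun a (e : 1 * a = a) (X : M a) :
  sng_fmap (mlun e X) \o
    (sng_box e (munit M) X \o
      bmap mten (idm ([: munit M :] : mat B)) (idm ([: X :] : mat B))) =
  matL (B := cmon M) [: X :].
Proof.
have uE : fwd (matL (B := cmon M) [: X :]) =
  @diag k B (mten [: munit M :] [: X :]) [: X :] (fun p => p.2)
    (fun=> fwd (clun (cpair X))) by [].
rewrite uE bmap1 cmpm1 sng_boxE cmp_diag; eq_sng => i.
rewrite (clunE (erefl (cpair X)) (pten e erefl erefl) (erefl _)).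
by rewrite cinM cmpm1.
Qed.

Lemma sng_run a (e : a * 1 = a) (X : M a) :
  sng_fmap (mrun e X) \o
    (sng_box e X (munit M) \o
      bmap mten (idm ([: X :] : mat B)) (idm ([: munit M :] : mat B))) =
  matR (B := cmon M) [: X :].
Proof.
have uE : fwd (matR (B := cmon M) [: X :]) =
  @diag k B (mten [: X :] [: munit M :]) [: X :] (fun p => p.1)
    (fun=> fwd (crun (cpair X))) by [].
rewrite uE bmap1 cmpm1 sng_boxE cmp_diag; eq_sng => i.
rewrite (crunE (erefl (cpair X)) (pten e erefl erefl) (erefl _)).
by rewrite cinM cmpm1.
Qed.

Definition unit_act f a b (e : gaut f a b) :
    niso (kcompf (mact (monoidale_of Phi) e) (sng_fun a))
      (kcompf (sng_fun b) (mact M e)) :=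
  @NIso k _ _ (kcompf (mact (monoidale_of Phi) e) (sng_fun a))
    (kcompf (sng_fun b) (mact M e))
    (fun X => @ccomp_iso k G (precrossed_of M) b
       (kcompf (mact (monoidale_of Phi) e) (sng_fun a) X)
       (kcompf (sng_fun b) (mact M e) X) (sng_act e X))
    (fun X Y u => sng_actN e u).

Definition unit_box a b c (e : a * b = c) (X : M a) (Y : M b) :
    iso (box (monoidale_of Phi) e (sng_fun a X) (sng_fun b Y))
      (sng_fun c (box M e X Y)) :=
  @ccomp_iso k G (precrossed_of M) c
    (box (monoidale_of Phi) e (sng_fun a X) (sng_fun b Y))
    (sng_fun c (box M e X Y)) (sng_box e X Y).

Definition unit_unit : iso (munit (monoidale_of Phi)) (sng_fun 1 (munit M)) :=
  @ccomp_iso k G (precrossed_of M) 1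
    (munit (monoidale_of Phi)) (sng_fun 1 (munit M)) (iso_id _).

(** Two transports meet: [monoidale_of] lets 1 act by the crossed action of [1^-1], which in [Phi M]
    is the action of [1^-1^-1]. They combine into a single [csm1_at]. *)
Lemma phi_one_atE (u v : G) (eu : 1 = u) (ev : u^-1 = v) (ev' : 1 = v)
    (X : Phi) :
  fwd (phi_one_at Phi eu X) =
  @diag k B (projT1 X) (act u^-1 (projT1 X)) id
    (fun i => fwd (csm1_at M (etrans ev' (esym ev)) (projT1 X i))).
Proof.
subst u; have -> : etrans ev' (esym ev) = esym (invg1 G) by exact: Prop_irrelevance.
by [].
Qed.

Program Definition unit_hom : monoidale_hom M (monoidale_of Phi) :=
  @MonoidaleHom k G M (monoidale_of Phi) sng_fun unit_act _ _ unit_box _ _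
    unit_unit _ _ _ _.
Next Obligation.
move=> a b c f g h ef eg eh e X.
exact: (sng_act_comp ef eg eh e (cinv_prod (inv_prod e)) X).
Qed.
Next Obligation.
move=> a e X.
have ev' : 1 = vv 1 :> G by rewrite !invg1.
have E := phi_one_atE (esym (invg1 G)) erefl ev' (sval (sng_fun a X)).
refine (etrans _ (sng_act_one e (etrans ev' (esym erefl)) X)).
refine (congr1 (fun t => @cmp k (mat B) [: X :] (act (vv 1) [: X :])
  [: mact M e X :] (fwd (sng_act e X)) t) _).
exact: E.
Qed.
Next Obligation. by move=> *; exact: sng_boxN. Qed.
Next Obligation. by move=> *; exact: sng_boxM. Qed.
Next Obligation. by move=> *; exact: sng_unitM. Qed.
Next Obligation. by move=> *; exact: sng_assoc. Qed.
Next Obligation. by move=> *; exact: sng_lun. Qed.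
Next Obligation. by move=> *; exact: sng_run. Qed.

End Unit.

(** * Extension of functors along a dense family *)

Section Extension.

Variables (k : comPzRingType) (C D : kcat k) (O : Type) (u : O -> C).

(* Orthogonality of the summands is not recorded: [sprojK] is all that is needed
   of it, and it spares every comparison of indices. *)
Record decomp (H : kfun (ind u) D) (X : C) (S : D) := Decomp {
  dn : nat;
  dob : 'I_dn -> O;
  dinj : forall i, hom (u (dob i)) X;
  dproj : forall i, hom X (u (dob i));
  dsum : (\sum_i (dinj i \o dproj i))%R = idm X;
  sinj : forall i, hom (H (dob i)) S;
  sproj : forall i, hom S (H (dob i));
  ssum : (\sum_i (sinj i \o sproj i))%R = idm S;
  sprojK : forall i j, sproj j \o sinj i =
    fmap H (X := dob i) (Y := dob j) (dproj j \o dinj i)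
}.

Arguments dob {H X S} d i : rename.
Arguments dinj {H X S} d i : rename.
Arguments dproj {H X S} d i : rename.
Arguments sinj {H X S} d i : rename.
Arguments sproj {H X S} d i : rename.
Arguments sprojK {H X S} d i j : rename.

Lemma decompP (H : kfun (ind u) D) n (o : 'I_n -> O) X S :
  is_dsum (fun i => u (o i)) X -> is_dsum (fun i => H (o i)) S ->
  inhabited (decomp H X S).
Proof.
move=> [p [q [qp1 qp0 pq]]] [p' [q' [qp1' qp0' pq']]]; constructor.
apply: (@Decomp H X S n o p q pq p' q' pq') => i j.
case: (i =P j) => [ij|ne]; last by rewrite qp0 // qp0' // fmap0.
by subst j; rewrite qp1 qp1'; exact: esym (fmap1 H (o i)).
Qed.

Variables (H : kfun (ind u) D) (S : C -> D) (dec : forall X, decomp H X (S X)).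

Local Notation Hm o o' f := (@fmap k (ind u) D H o o' f).

Let HmM o o' o'' (g : hom (u o') (u o'')) (f : hom (u o) (u o')) :
  Hm o o'' (g \o f) = Hm o' o'' g \o Hm o o' f.
Proof. exact: (@fmapM k (ind u) D H o o' o''). Qed.

Let Hm1 o : Hm o o (idm (u o)) = idm (H o).
Proof. exact: (@fmap1 k (ind u) D H o). Qed.

Let Hm_lin o o' : linear (fun f : hom (u o) (u o') => Hm o o' f).
Proof. exact: (@fmap_lin k (ind u) D H o o'). Qed.

(* The sums below are locked, lest the additivity lemmas see through them. *)
Fact ext_key : unit. Proof. by []. Qed.

Section Elements.

Variable X : C.

Local Notation d := (dec X).

(* [H o -> S X] corresponding to the generalized element [x] of [X]. *)
Definition xi (o : O) (x : hom (u o) X) : hom (H o) (S X) :=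
  locked_with ext_key
    (\sum_i (sinj d i \o Hm o (dob d i) (dproj d i \o x)))%R.

(** The dual of [xi], for generalized coelements. Since [coxi p \o xi x] is the image of [p \o x],
    it provides the explicit inverses of the constraints built from [xi]. *)
Definition coxi (o : O) (p : hom X (u o)) : hom (S X) (H o) :=
  locked_with ext_key
    (\sum_i (Hm (dob d i) o (p \o dinj d i) \o sproj d i))%R.

Lemma xi_def o (x : hom (u o) X) :
  xi x = (\sum_i (sinj d i \o Hm o (dob d i) (dproj d i \o x)))%R.
Proof. by rewrite /xi unlock. Qed.

Lemma coxi_def o (p : hom X (u o)) :
  coxi p = (\sum_i (Hm (dob d i) o (p \o dinj d i) \o sproj d i))%R.
Proof. by rewrite /coxi unlock. Qed.

Lemma xi_lin o : linear (@xi o).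
Proof.
move=> a x y; rewrite !xi_def scaler_sumr -big_split; apply: eq_bigr => i _ /=.
by rewrite cmp_linr Hm_lin cmp_linr.
Qed.

Lemma xiM o o' (x : hom (u o') X) (v : hom (u o) (u o')) :
  xi (x \o v) = xi x \o Hm o o' v.
Proof.
by rewrite !xi_def cmp_suml; apply: eq_bigr => i _; rewrite -cmpA -HmM cmpA.
Qed.

(** Insert the decomposition of [idm X] in front of [x]; [sprojK] then matches the sum on the other
    side term by term. Consequently neither [xi] nor its behaviour under maps depends on the chosen
    decomposition. *)
Lemma sproj_xi o (x : hom (u o) X) i :
  sproj d i \o xi x = Hm o (dob d i) (dproj d i \o x).
Proof.
rewrite !xi_def cmp_sumr -[in RHS](cmp1m x) -(dsum d) cmp_suml.
rewrite cmp_sumr (lin_sum (@Hm_lin _ _)); apply: eq_bigr => j _.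
by rewrite cmpA sprojK -HmM !cmpA.
Qed.

Lemma coxi_xi o o' (p : hom X (u o')) (x : hom (u o) X) :
  coxi p \o xi x = Hm o o' (p \o x).
Proof.
rewrite coxi_def cmp_suml -[in RHS](cmp1m x) -(dsum d) cmp_suml.
rewrite cmp_sumr (lin_sum (@Hm_lin _ _)); apply: eq_bigr => j _.
by rewrite -cmpA sproj_xi -HmM !cmpA.
Qed.

Lemma xi_dinj i : xi (dinj d i) = sinj d i.
Proof.
rewrite xi_def -[RHS]cmp1m -(ssum d) cmp_suml; apply: eq_bigr => j _.
by rewrite -cmpA sprojK.
Qed.

Lemma coxi_dproj i : coxi (dproj d i) = sproj d i.
Proof.
rewrite coxi_def -[RHS]cmpm1 -(ssum d) cmp_sumr; apply: eq_bigr => j _.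
by rewrite cmpA sprojK.
Qed.

Lemma xi_sum : (\sum_i (xi (dinj d i) \o coxi (dproj d i)))%R = idm (S X).
Proof.
by rewrite -(ssum d); apply: eq_bigr => i _; rewrite xi_dinj coxi_dproj.
Qed.

Lemma xi_epi Z (f g : hom (S X) Z) :
  (forall o (x : hom (u o) X), f \o xi x = g \o xi x) -> f = g.
Proof.
move=> fg; rewrite -(cmpm1 f) -(cmpm1 g) -xi_sum !cmp_sumr.
by apply: eq_bigr => i _; rewrite !cmpA fg.
Qed.

End Elements.

Definition ext_map X Y (f : hom X Y) : hom (S X) (S Y) :=
  locked_with ext_key
    (\sum_i (xi (f \o dinj (dec X) i) \o coxi (dproj (dec X) i)))%R.

Lemma ext_mapE X Y (f : hom X Y) o (x : hom (u o) X) :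
  ext_map f \o xi x = xi (f \o x).
Proof.
rewrite /ext_map unlock cmp_suml -[in RHS](cmp1m x) -(dsum (dec X)).
rewrite cmp_suml cmp_sumr (lin_sum (@xi_lin _ _)); apply: eq_bigr => i _.
by rewrite -cmpA coxi_xi -xiM !cmpA.
Qed.

Program Definition ext : kfun C D := @KFun k C D S ext_map _ _ _.
Next Obligation.
move=> X Y a f g; apply: xi_epi => o x.
by rewrite cmp_linl !ext_mapE cmp_linl xi_lin.
Qed.
Next Obligation.
by move=> X; apply: xi_epi => o x; rewrite ext_mapE !cmp1m.
Qed.
Next Obligation.
move=> X Y Z g f; apply: xi_epi => o x.
by rewrite -cmpA !ext_mapE cmpA.
Qed.

Program Definition ext_iso o : iso (H o) (ext (u o)) :=
  @Iso k D (H o) (ext (u o)) (xi (idm (u o))) (coxi (idm (u o))) _ _.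
Next Obligation. by move=> o; rewrite coxi_xi cmp1m Hm1. Qed.
Next Obligation.
move=> o; apply: xi_epi => o' x; rewrite -cmpA coxi_xi cmp1m cmp1m -xiM.
by rewrite cmp1m.
Qed.

Lemma xiE X o (x : hom (u o) X) : xi x = fmap ext x \o ext_iso o.
Proof. by rewrite /= ext_mapE cmpm1. Qed.

Lemma ext_isoN o o' (v : hom (u o) (u o')) :
  fmap ext v \o ext_iso o = ext_iso o' \o Hm o o' v.
Proof. by rewrite -xiE /= -xiM cmp1m. Qed.

End Extension.

Arguments dob {k C D O u H X S} d i : rename.
Arguments dinj {k C D O u H X S} d i : rename.
Arguments dproj {k C D O u H X S} d i : rename.
Arguments sinj {k C D O u H X S} d i : rename.
Arguments sproj {k C D O u H X S} d i : rename.
Arguments sprojK {k C D O u H X S} d i j : rename.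

(** * Universal property of the completion *)

Section Equivalences.

Variables (k : comPzRingType).

Definition is_full (C D : kcat k) (F : kfun C D) : Prop :=
  forall X Y (v : hom (F X) (F Y)), exists u : hom X Y, fmap F u = v.

Definition is_faithful (C D : kcat k) (F : kfun C D) : Prop :=
  forall X Y, injective (@fmap k C D F X Y).

Definition ess_surj (C D : kcat k) (F : kfun C D) : Prop :=
  forall Y, exists X, inhabited (iso (F X) Y).

Lemma is_equiv_sym (C D : kcat k) (F : kfun C D) :
  is_equiv F -> exists2 H : kfun D C, is_equiv H &
    inhabited (niso (kcompf H F) (kid C)) /\
    inhabited (niso (kcompf F H) (kid D)).
Proof.
move=> [H [HF FH]]; exists H; last by split.
by exists F; split.
Qed.

Lemma is_equiv_faithful (C D : kcat k) (F : kfun C D) :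
  is_equiv F -> is_faithful F.
Proof.
move=> [H [[t] _]] X Y u v e.
have [Nu Nv] := (nicN t u, nicN t v).
by apply: (@iso_surj _ _ _ _ _ (t X)); rewrite Nu Nv /= e.
Qed.

Lemma is_equiv_full (C D : kcat k) (F : kfun C D) : is_equiv F -> is_full F.
Proof.
move=> eF X Y v; have [H /is_equiv_faithful fH [[t] _]] := is_equiv_sym eF.
exists (t Y \o (fmap H v \o bwd (t X))); apply: fH.
apply: (@iso_inj _ _ _ _ _ (t Y)).
have N := nicN t (t Y \o (fmap H v \o bwd (t X))); rewrite /= in N.
by rewrite -N -!cmpA fwdK cmpm1.
Qed.

Lemma is_equiv_surj (C D : kcat k) (F : kfun C D) : is_equiv F -> ess_surj F.
Proof. by move=> [H [_ [t]]] Y; exists (H Y); constructor; exact: t Y. Qed.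

(** Isomorphisms are asserted in [Prop] by the definitions of equivalence and completion; building a
    functor or a transformation out of them requires choice. *)
Definition witness (T : Type) (h : inhabited T) : T :=
  sval (cid (match h with inhabits x => ex_intro (fun=> True) x I end)).

Section EquivI.

Variables (C D : kcat k) (F : kfun C D).
Hypotheses (Ffull : is_full F) (Ffaithful : is_faithful F).
Hypothesis Fsurj : ess_surj F.

Let qobj Y := sval (cid (Fsurj Y)).
Let qiso Y : iso (F (qobj Y)) Y := witness (svalP (cid (Fsurj Y))).
Let qmap Y Y' (v : hom Y Y') : hom (qobj Y) (qobj Y') :=
  sval (cid (Ffull (bwd (qiso Y') \o (v \o qiso Y)))).

Let qmapE Y Y' (v : hom Y Y') :
  fmap F (qmap v) = bwd (qiso Y') \o (v \o qiso Y).
Proof. exact: (svalP (cid (Ffull (bwd (qiso Y') \o (v \o qiso Y))))). Qed.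

Program Definition quasi_inv : kfun D C := @KFun k D C qobj qmap _ _ _.
Next Obligation.
move=> Y Y' a v w; apply: Ffaithful.
by rewrite fmap_lin !qmapE cmp_linl cmp_linr.
Qed.
Next Obligation.
by move=> Y; apply: Ffaithful; rewrite qmapE fmap1 cmp1m fwdK.
Qed.
Next Obligation.
move=> X Y Z g f; apply: Ffaithful; rewrite fmapM !qmapE -!cmpA.
by congr (_ \o (_ \o _)); rewrite !cmpA bwdK cmp1m.
Qed.

Lemma is_equivI : is_equiv F.
Proof.
exists quasi_inv; split; constructor; last first.
  apply: (@NIso k D D (kcompf F quasi_inv) (kid D) qiso) => Y Y' v /=.
  by rewrite qmapE cmpA bwdK cmp1m.
(* The isomorphism onto [F X] is the image under [F] of a unique morphism to [X]. Lifting its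
   inverse too, faithfulness makes the two lifts mutually inverse. *)
have lift X : {i : iso (quasi_inv (F X)) X | fmap F i = qiso (F X)}.
  have [u uE] := cid (Ffull (fwd (qiso (F X)) : hom (F (quasi_inv (F X))) _)).
  have [v vE] := cid (Ffull (bwd (qiso (F X)) : hom _ (F (quasi_inv (F X))))).
  have vu : v \o u = idm _.
    by apply: Ffaithful; rewrite fmapM uE vE fwdK fmap1.
  have uv : u \o v = idm _.
    by apply: Ffaithful; rewrite fmapM uE vE bwdK fmap1.
  by exists (Iso vu uv).
apply: (@NIso k C C (kcompf quasi_inv F) (kid C) (fun X => sval (lift X))).
move=> X Y f; apply: Ffaithful; rewrite /= !fmapM !(svalP (lift _)) qmapE.
by rewrite cmpA bwdK cmp1m.
Qed.

End EquivI.

End Equivalences.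

(** * Dense families determine natural transformations *)

Section Dense.

Variables (k : comPzRingType) (C : kcat k) (O : Type) (u : O -> C).

Definition dense : Prop :=
  forall X, exists n (o : 'I_n -> O), is_dsum (fun i => u (o i)) X.

Hypothesis dC : dense.

Lemma dense_sum X : exists n (o : 'I_n -> O) (p : forall i, hom (u (o i)) X)
  (q : forall i, hom X (u (o i))), (\sum_i (p i \o q i))%R = idm X.
Proof. by have [n [o [p [q [_ _ pq]]]]] := dC X; exists n, o, p, q. Qed.

Variables (D : kcat k).

Lemma dense_epi (F : kfun C D) X Z (f g : hom (F X) Z) :
  (forall o (x : hom (u o) X), f \o fmap F x = g \o fmap F x) -> f = g.
Proof.
move=> fg; have [n [o [p [q pq]]]] := dense_sum X.
rewrite -(cmpm1 f) -(cmpm1 g) -(fmap1 F) -pq fmap_sum !cmp_sumr.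
by apply: eq_bigr => i _; rewrite fmapM !cmpA fg.
Qed.

Lemma dense_ntrans (H H' : kfun C D)
    (t : forall o, hom (H (u o)) (H' (u o))) :
  (forall o o' (v : hom (u o) (u o')),
    fmap H' v \o t o = t o' \o fmap H v) ->
  exists s : ntrans H H', (forall o, s (u o) = t o) /\
    forall s' : ntrans H H', (forall o, s' (u o) = t o) ->
      forall X, s' X = s X.
Proof.
move=> tN.
have sX X : exists s : hom (H X) (H' X),
    forall o (x : hom (u o) X), s \o fmap H x = fmap H' x \o t o.
  have [n [o [p [q pq]]]] := dense_sum X.
  (* This value is forced by naturality on the summands of [X]. The property recorded about it
     mentions no decomposition, which is what makes naturality provable afterwards. *)
  exists (\sum_i (fmap H' (p i) \o (t (o i) \o fmap H (q i))))%R => o' x.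
  rewrite -[in RHS](cmp1m x) -pq !cmp_suml fmap_sum cmp_suml.
  apply: eq_bigr => i _.
  by rewrite -[in RHS]cmpA fmapM -!cmpA tN -fmapM.
pose s X := sval (cid (sX X)).
have sE X o (x : hom (u o) X) : s X \o fmap H x = fmap H' x \o t o.
  exact: (svalP (cid (sX X)) o x).
have sN X Y (f : hom X Y) : fmap H' f \o s X = s Y \o fmap H f.
  apply: dense_epi => o x.
  by rewrite -!cmpA -fmapM !sE cmpA -fmapM.
exists (NTrans sN); split=> [o|s' s't X] /=.
  by have := sE _ o (idm (u o)); rewrite !fmap1 cmpm1 cmp1m.
by apply: dense_epi => o x; rewrite -(ntcN s') s't sE.
Qed.

End Dense.

(** * Gluing functors along orthogonal families *)

Section Family.

Variables (k : comPzRingType) (I : eqType) (A : I -> kcat k) (C : kcat k).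
Variable J : forall i, kfun (A i) C.

Definition fam_obj (o : {i : I & A i}) : C := J (projT1 o) (projT2 o).

Hypotheses (Jfull : forall i, is_full (J i)).
Hypotheses (Jfaithful : forall i, is_faithful (J i)).
Hypothesis Jorth : forall i j (X : A i) (Y : A j), i <> j ->
  forall f : hom (J i X) (J j Y), f = 0%R.

Variables (D : kcat k) (F : forall i, kfun (A i) D).

Definition lam_obj (o : {i : I & A i}) : D := F (projT1 o) (projT2 o).

(** Between different indices orthogonality leaves only zero; within one index a preimage under
    [J i] is chosen, which faithfulness makes unique. *)
Definition lam_map (o o' : {i : I & A i}) (f : hom (fam_obj o) (fam_obj o')) :
  hom (lam_obj o) (lam_obj o').
Proof.
case: o f => i X; case: o' => j Y f.
case: (i =P j) => [p|_]; last exact: 0%R.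
destruct p; exact: (fmap (F i) (sval (cid (Jfull f)))).
Defined.

Lemma lam_mapE i (X Y : A i) (v : hom X Y) :
  @lam_map (existT _ i X) (existT _ i Y) (fmap (J i) v) = fmap (F i) v.
Proof.
rewrite /lam_map /=; case: (i =P i) => // p.
rewrite (Prop_irrelevance p erefl) /=; congr (fmap _ _); apply: Jfaithful.
exact: (svalP (cid (Jfull (fmap (J i) v)))).
Qed.

Lemma lam_map0 (o o' : {i : I & A i}) : @lam_map o o' 0%R = 0%R.
Proof.
case: o o' => i X [j Y]; case: (i =P j) => [p|ne].
  by subst j; rewrite -(fmap0 (J i)) lam_mapE fmap0.
by rewrite /lam_map /=; case: (i =P j).
Qed.

(** Both objects are generalized in [P], so statements that carry equations between the degrees of
    [o] and [o'] can be proved by this induction. *)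
Lemma fam_ind (P : forall o o', hom (fam_obj o) (fam_obj o') -> Prop) :
  (forall i (X Y : A i) (v : hom X Y),
    P (existT _ i X) (existT _ i Y) (fmap (J i) v)) ->
  (forall o o', P o o' 0%R) -> forall o o' f, P o o' f.
Proof.
move=> PJ P0 [i X] [j Y] f; case: (i =P j) => [p|ne].
  by subst j; have [v <-] := Jfull f; exact: PJ.
by rewrite (Jorth ne f).
Qed.

Program Definition lam : kfun (ind fam_obj) D :=
  @KFun k (ind fam_obj) D lam_obj lam_map _ _ _.
Next Obligation.
move=> [i X] [j Y] a f g; case: (i =P j) => [p|ne]; last first.
  have -> : f = 0%R by exact: (Jorth ne f).
  have -> : g = 0%R by exact: (Jorth ne g).
  by rewrite scaler0 addr0 lam_map0 scaler0 addr0.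
subst j; have [u <-] := Jfull (f : hom (J i X) (J i Y)).
have [v <-] := Jfull (g : hom (J i X) (J i Y)).
rewrite !lam_mapE.
refine (etrans (congr1 (@lam_map (existT _ i X) (existT _ i Y))
  (esym (fmap_lin (J i) a u v))) _).
by rewrite lam_mapE fmap_lin.
Qed.
Next Obligation.
move=> [i X]; rewrite /= /lam_obj -fmap1.
exact: etrans (congr1 (@lam_map (existT _ i X) (existT _ i X))
  (esym (fmap1 (J i) X))) (lam_mapE _).
Qed.
Next Obligation.
move=> [i X] [j Y] [l Z] g f; case: (i =P j) => [p|ne]; last first.
  have -> : f = 0%R by exact: (Jorth ne f).
  by rewrite cmpm0 !lam_map0 cmpm0.
subst j; have [u <-] := Jfull (f : hom (J i X) (J i Y)).
case: (i =P l) => [p|ne]; last first.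
  have -> : g = 0%R by exact: (Jorth ne g).
  by rewrite cmp0m !lam_map0 cmp0m.
subst l; have [v <-] := Jfull (g : hom (J i Y) (J i Z)).
rewrite !lam_mapE -fmapM.
exact: etrans (congr1 (@lam_map (existT _ i X) (existT _ i Z))
  (esym (fmapM (J i) v u))) (lam_mapE _).
Qed.

End Family.

Section FamilyCompletion.

Variables (k : comPzRingType) (I : eqType) (A : I -> kcat k) (C : kcat k).
Variable J : forall i, kfun (A i) C.
Hypotheses (Jfull : forall i, is_full (J i)).
Hypotheses (Jfaithful : forall i, is_faithful (J i)).
Hypothesis Jorth : forall i j (X : A i) (Y : A j), i <> j ->
  forall f : hom (J i X) (J j Y), f = 0%R.
Hypothesis Jdense : dense (fam_obj J).
Hypothesis C_fds : has_fds C.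

(** A functor extends by choosing in [D] the direct sums that decompose objects of [C]. A
    transformation extends uniquely by density, the zero morphisms between different indices
    imposing no condition. *)
Lemma fds_completion_fam : is_fds_completion_of_coprod J.
Proof.
split=> // D D_fds.
  move=> F; pose H := lam Jfull Jfaithful Jorth F.
  have SX X : exists S, inhabited (decomp H X S).
    have [n [o oX]] := Jdense X.
    have [S oS] := D_fds n (fun i => H (o i)).
    by exists S; exact: decompP oX oS.
  pose S X := sval (cid (SX X)).
  pose dec X : decomp H X (S X) := witness (svalP (cid (SX X))).
  exists (ext dec) => i; constructor.
  apply: niso_inv; apply: (@NIso k _ _ (F i) (kcompf (ext dec) (J i))
    (fun X => ext_iso dec (existT _ i X))) => X Y f.
  have N := @ext_isoN _ _ _ _ _ _ _ dec (existT _ i X) (existT _ i Y)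
    (fmap (J i) f).
  by rewrite [fmap H _]lam_mapE in N.
move=> H H' t.
have tN o o' (v : hom (fam_obj J o) (fam_obj J o')) :
    fmap H' v \o t (projT1 o) (projT2 o) = t (projT1 o') (projT2 o') \o fmap H v.
  move: o o' v; apply: (fam_ind Jfull Jorth) => [i X Y v|o o'] /=.
    exact: (ntcN (t i) v).
  by rewrite !fmap0 cmp0m cmpm0.
have [s [st s_uniq]] := dense_ntrans Jdense tN.
exists s; split=> [i X|s' s't]; first exact: (st (existT _ i X)).
by apply: s_uniq => o; exact: s't.
Qed.

End FamilyCompletion.

Section SingleCompletion.

Variables (k : comPzRingType) (A C : kcat k) (J : kfun A C).

Lemma fds_completionI :
  is_full J -> is_faithful J -> has_fds C -> dense J -> is_fds_completion J.
Proof.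
move=> fJ hJ fdsC dJ; apply: fds_completion_fam => //.
- by move=> [] [].
move=> X; have [n [o oX]] := dJ X.
by exists n, (fun i => existT (fun=> A : Type) tt (o i)).
Qed.

End SingleCompletion.

(** * Formal matrices as a completion *)

Section Embedding.

Variables (k : comPzRingType) (B : kcat k).

Lemma sng_dsum (X : mat B) :
  is_dsum (fun i : 'I_#|idx X| => sng (X (enum_val i)) : mat B) X.
Proof.
apply: (@dsum_mat k B _ (fun i : 'I_#|idx X| => sng (X (enum_val i))) X
  (fun i _ => enum_val i) (fun i _ => iso_id _)).
- by move=> s; exists (enum_rank s), tt; exact: enum_rankK.
- by move=> i [] [].
- by move=> i j _ _ /enum_val_inj.
Qed.

Program Definition sng_embed : kfun B (mat B) :=
  @KFun k B (mat B) (@sng k B)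
    (@sng_map k B) _ _ _.
Next Obligation.
by move=> x y a u v; apply: mhomP => -[] []; rewrite !pi_linE /sng_map !diag_sngE.
Qed.
Next Obligation. by move=> x; apply: mhomP => i []. Qed.
Next Obligation.
by move=> x y z g f; rewrite /= /sng_map mcmp_diag; eq_sng.
Qed.

Lemma sng_embed_full : is_full sng_embed.
Proof.
move=> X Y v; exists (v tt tt); apply: mhomP => -[] [].
by rewrite /= /sng_map diag_sngE.
Qed.

Lemma sng_embed_faithful : is_faithful sng_embed.
Proof.
move=> X Y u v /= /(congr1 (fun f : mhom (sng X) (sng Y) => f tt tt)).
by rewrite /sng_map !diag_sngE.
Qed.

Lemma sng_embed_dense : dense sng_embed.
Proof. by move=> X; exists #|idx X|, (fun i => X (enum_val i)); exact: sng_dsum. Qed.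

Lemma sng_embed_completion : is_fds_completion sng_embed.
Proof.
apply: fds_completionI => //; first exact: sng_embed_full.
- exact: sng_embed_faithful.
- exact: mat_fds.
exact: sng_embed_dense.
Qed.

End Embedding.

(** * Uniqueness and characterization of completions *)

Section CompletionUnique.

Variables (k : comPzRingType).

Lemma dsum_fmap (C D : kcat k) (F : kfun C D) n (X : 'I_n -> C) S :
  is_dsum X S -> is_dsum (fun i => F (X i)) (F S).
Proof.
move=> [p [q [qp1 qp0 pq]]]; exists (fun i => fmap F (p i)).
exists (fun i => fmap F (q i)); split=> [i|i j ne|].
- by rewrite -fmapM qp1 fmap1.
- by rewrite -fmapM qp0 // fmap0.
by rewrite -fmap1 -pq fmap_sum; apply: eq_bigr => i _; rewrite fmapM.
Qed.

Lemma dsum_iso (C : kcat k) n (X Y : 'I_n -> C) S T :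
  (forall i, inhabited (iso (X i) (Y i))) -> inhabited (iso S T) ->
  is_dsum X S -> is_dsum Y T.
Proof.
move=> iXY [s] [p [q [qp1 qp0 pq]]].
pose t i := witness (iXY i).
exists (fun i => fwd s \o (p i \o bwd (t i))).
exists (fun i => fwd (t i) \o (q i \o bwd s)).
have E i j : (fwd (t j) \o (q j \o bwd s)) \o (fwd s \o (p i \o bwd (t i))) =
    fwd (t j) \o ((q j \o p i) \o bwd (t i)).
  by rewrite -!cmpA; congr (_ \o (_ \o _)); rewrite !cmpA fwdK cmp1m.
split=> [i|i j ne|]; rewrite ?E ?qp1 ?cmp1m ?bwdK //.
  by rewrite qp0 // cmp0m cmpm0.
transitivity (fwd s \o ((\sum_i (p i \o q i))%R \o bwd s)); last first.
  by rewrite pq cmp1m bwdK.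
rewrite cmp_suml cmp_sumr; apply: eq_bigr => i _.
rewrite -!cmpA; congr (_ \o (_ \o _)).
by rewrite cmpA fwdK cmp1m.
Qed.

(** Both [t] and its inverse extend along [J]. The two composites of the extensions restrict to
    identities, hence are identities by the uniqueness part of the universal property. *)
Lemma fds_completion_endo (A C : kcat k) (J : kfun A C) (H : kfun C C) :
  is_fds_completion J -> niso (kcompf H J) J -> inhabited (niso H (kid C)).
Proof.
move=> [C_fds _ C_two] t.
have [s [sJ _]] := C_two C C_fds H (kid C)
  (fun=> @NTrans k A C (kcompf H J) (kcompf (kid C) J) (fun X => fwd (t X))
    (nicN t)).
have [r [rJ _]] := C_two C C_fds (kid C) H
  (fun=> @NTrans k A C (kcompf (kid C) J) (kcompf H J)
    (fun X => fwd (niso_inv t X)) (nicN (niso_inv t))).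
have id_uniq (F : kfun C C) (v : ntrans F F) :
  (forall X, v (J X) = idm _) -> forall X, v X = idm _.
  move=> vJ X; have idN Y Z (f : hom Y Z) : fmap F f \o idm _ = idm _ \o fmap F f.
    by rewrite cmpm1 cmp1m.
  have [w [wJ w_uniq]] := C_two C C_fds F F
    (fun=> @NTrans k A C (kcompf F J) (kcompf F J) (fun X => idm _)
      (fun _ _ _ => idN _ _ _)).
  rewrite (w_uniq v) => [|_ Y]; last exact: vJ.
  by rewrite -(w_uniq (NTrans idN)).
pose comp (F F' F'' : kfun C C) (v' : ntrans F' F'') (v : ntrans F F') :=
  @NTrans k C C F F'' (fun X => v' X \o v X) (fun X Y f =>
    etrans (cmpA _ _ _) (etrans (congr1 (fun g => g \o _) (ntcN v' f))
      (etrans (esym (cmpA _ _ _)) (etrans (congr1 _ (ntcN v f)) (cmpA _ _ _))))).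
have rs := id_uniq _ (comp _ _ _ r s); have sr := id_uniq _ (comp _ _ _ s r).
have rsK X : r X \o s X = idm _.
  by apply: rs => Y /=; rewrite (rJ tt) (sJ tt) /= fwdK.
have srK X : s X \o r X = idm _.
  by apply: sr => Y /=; rewrite (rJ tt) (sJ tt) /= bwdK.
constructor; exact: (@NIso k C C H (kid C) (fun X => Iso (rsK X) (srK X)) (ntcN s)).
Qed.

End CompletionUnique.

Section CompletionChar.

Variables (k : comPzRingType) (A C : kcat k) (J : kfun A C).

Program Definition niso_whisker (X Y Z : kcat k) (F F' : kfun X Y)
    (H : kfun Y Z) (t : niso F F') : niso (kcompf H F) (kcompf H F') :=
  @NIso k X Z (kcompf H F) (kcompf H F') (fun x => iso_fmap H (t x)) _.
Next Obligation.
by move=> X Y Z F F' H t x y f; rewrite /= -!fmapM (nicN t).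
Qed.

Program Definition niso_assoc (X Y Z T : kcat k) (F : kfun X Y) (F' : kfun Y Z)
    (F'' : kfun Z T) :
    niso (kcompf (kcompf F'' F') F) (kcompf F'' (kcompf F' F)) :=
  @NIso k X T (kcompf (kcompf F'' F') F) (kcompf F'' (kcompf F' F))
    (fun x => iso_id _) _.
Next Obligation. by move=> *; rewrite cmpm1 cmp1m. Qed.

Lemma fds_completion_equiv (E : kcat k) (K : kfun A E) :
  is_fds_completion J -> is_fds_completion K ->
  exists2 H : kfun C E, is_equiv H & inhabited (niso (kcompf H J) K).
Proof.
move=> cJ cK; have [C_fds J_ext _] := cJ; have [E_fds K_ext _] := cK.
have [H /(_ tt) [t]] := J_ext E E_fds (fun=> K).
have [H' /(_ tt) [t']] := K_ext C C_fds (fun=> J).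
exists H; last by constructor.
exists H'; split.
  apply: fds_completion_endo cJ _.
  exact: niso_comp t' (niso_comp (niso_whisker H' t) (niso_assoc _ _ _)).
apply: fds_completion_endo cK _.
exact: niso_comp t (niso_comp (niso_whisker H t') (niso_assoc _ _ _)).
Qed.

Lemma fds_completionP :
  is_fds_completion J -> [/\ is_full J, is_faithful J, dense J & has_fds C].
Proof.
move=> cJ; have [H eH [t]] := fds_completion_equiv cJ (@sng_embed_completion k A).
have [H' eH' [[r] _]] := is_equiv_sym eH.
have [C_fds _ _] := cJ; split=> //.
- move=> X Y v.
  have [u uE] := sng_embed_full (t Y \o (fmap H v \o bwd (t X))).
  exists u; apply: (is_equiv_faithful eH).
  apply: (@iso_inj _ _ _ _ _ (t Y)).
  apply: etrans (esym (nicN t u)) _.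
  by rewrite uE -!cmpA fwdK cmpm1.
- move=> X Y u v e; apply: (@sng_embed_faithful k A).
  have [Nu Nv] := (nicN t u, nicN t v).
  by apply: (@iso_surj _ _ _ _ _ (t X)); rewrite Nu Nv /= e.
move=> X; have [n [o oX]] := @sng_embed_dense k A (H X); exists n, o.
apply: dsum_iso (dsum_fmap H' oX) => [i|]; last by constructor; exact: (r X).
constructor; apply: iso_comp (r (J (o i))) (iso_fmap H' (iso_inv (t (o i)))).
Qed.

End CompletionChar.

(** Tags and degrees do not enter the hom-modules, so both sides are convertible. *)
Lemma comp_dsum (k : comPzRingType) (G : groupType) (P : precrossed k G) a n
    (X : 'I_n -> comp_of (completion P) a) (S : comp_of (completion P) a) :
  @is_dsum k (mat P) n (fun i => projT1 (sval (X i))) (projT1 (sval S)) ->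
  is_dsum X S.
Proof. by []. Qed.

Section UnitHom.

Variables (k : comPzRingType) (G : groupType) (M : monoidale k G).

Let B := coprod (fun a : G => M a).

Lemma sng_fmap_full a (X Y : M a)
    (v : @hom k (mat B) (sng (cpair X : B)) (sng (cpair Y : B))) :
  exists u, sng_fmap u = v.
Proof.
exists (v tt tt erefl); apply: mhomP => -[] [].
by rewrite /sng_fmap /sng_map diag_sngE [RHS]cin0_out.
Qed.

Lemma sng_fmap_inj a (X Y : M a) : injective (@sng_fmap k G M a X Y).
Proof.
move=> u v e; have /(congr1 (fun f => f erefl)) : cin0 u = cin0 v.
  have := congr1 (fun f : @hom k (mat B) (sng (cpair X : B))
    (sng (cpair Y : B)) => f tt tt) e.
  by rewrite /sng_fmap /sng_map !diag_sngE.
by rewrite !cin0K.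
Qed.

Lemma unit_full a : is_full (unit_hom M a).
Proof. by move=> X Y v; exact: (sng_fmap_full v). Qed.

Lemma unit_faithful a : is_faithful (unit_hom M a).
Proof. by move=> X Y; exact: (@sng_fmap_inj a X Y). Qed.

Lemma unit_dense a : dense (unit_hom M a).
Proof.
(* The tag of a homogeneous object forces each of its entries to lie in the summand [M a]. *)
move=> X; have Xi i : exists A : M a, projT1 (sval X) i = cpair A.
  have : projT1 (projT1 (sval X) i) = a := cdegP i (svalP X).
  by case: (projT1 (sval X) i) => b A /= ba; subst b; exists A.
pose A i := sval (cid (Xi i)).
exists #|idx (projT1 (sval X))|, (fun i => A (enum_val i)).
apply: (@comp_dsum k G (precrossed_of M) a _
  (fun i => unit_hom M a (A (enum_val i))) X).
apply: (@dsum_mat k B _ (fun i : 'I__ => sng (cpair (A (enum_val i)) : B))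
  (projT1 (sval X)) (fun i _ => enum_val i)
  (fun i _ => cin_iso erefl (svalP (cid (Xi (enum_val i)))) (iso_id _))).
- by move=> s; exists (enum_rank s), tt; exact: enum_rankK.
- by move=> i [] [].
- by move=> i j _ _ /enum_val_inj.
Qed.

End UnitHom.

(** * Direct sums of direct sums *)

Section DoubleSums.

Variables (k : comPzRingType) (C : kcat k).

Lemma dsum_fin (T : finType) (X : T -> C) S (p : forall t, hom (X t) S)
    (q : forall t, hom S (X t)) :
  (forall t, q t \o p t = idm (X t)) ->
  (forall s t, s <> t -> q t \o p s = 0%R) ->
  (\sum_t (p t \o q t))%R = idm S ->
  is_dsum (fun i : 'I_#|T| => X (enum_val i)) S.
Proof.
move=> qp1 qp0 pq; exists (fun i => p (enum_val i)), (fun i => q (enum_val i)).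
split=> [i|i j ne|]; [exact: qp1 | by apply: qp0 => /enum_val_inj |].
by rewrite -pq; exact: esym (big_enum_val _).
Qed.

Lemma dsum_dsum n (Y : 'I_n -> C) X (m : 'I_n -> nat)
    (Z : forall i, 'I_(m i) -> C) :
  is_dsum Y X -> (forall i, is_dsum (Z i) (Y i)) ->
  is_dsum (fun l : 'I_#|{: {i : 'I_n & 'I_(m i)}}| =>
    Z (tag (enum_val l)) (tagged (enum_val l))) X.
Proof.
move=> [p [q [qp1 qp0 pq]]] YZ.
pose T := {i : 'I_n & 'I_(m i)}.
pose p' i := sval (cid (YZ i)); pose q' i := sval (cid (svalP (cid (YZ i)))).
have YZP i : [/\ forall j, q' i j \o p' i j = idm (Z i j),
    forall j l, j <> l -> q' i l \o p' i j = 0%R &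
    (\sum_j (p' i j \o q' i j))%R = idm (Y i)].
  exact: (svalP (cid (svalP (cid (YZ i))))).
apply: (@dsum_fin T (fun t => Z (tag t) (tagged t)) X
  (fun t => p (tag t) \o p' (tag t) (tagged t))
  (fun t => q' (tag t) (tagged t) \o q (tag t))).
- case=> i j /=; have [qp1' _ _] := YZP i.
  by rewrite -cmpA (cmpA (q i)) qp1 cmp1m qp1'.
- case=> i j [i' j'] /= ne; have [_ qp0' _] := YZP i.
  case: (i =P i') => [ii|ni]; last first.
    by rewrite -cmpA (cmpA (q i')) qp0 // cmp0m cmpm0.
  subst i'; rewrite -cmpA (cmpA (q i)) qp1 cmp1m qp0' // => jj.
  by apply: ne; rewrite jj.
rewrite -pq -(sig_big_dep predT (fun _ => predT) (fun i j =>
  (p i \o p' i j) \o (q' i j \o q i))) /=; apply: eq_bigr => i _.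
have [_ _ pq'] := YZP i.
rewrite -[X in _ = p i \o X]cmp1m -pq' cmp_suml cmp_sumr.
by apply: eq_bigr => j _; rewrite !cmpA.
Qed.

End DoubleSums.

(** * Extension of morphisms to crossed categories *)

Section Unfold.

Variables (k : comPzRingType) (G : groupType) (M : monoidale k G).
Variables (C : crossed k G) (T : monoidale_hom M (monoidale_of C)).

Definition unfull_iso (P : C -> Prop) (X Y : full P) (i : iso X Y) :
    iso (sval X) (sval Y) :=
  @Iso k C (sval X) (sval Y) (fwd i) (bwd i) (fwdK i) (bwdK i).

(** The components of all degrees now land in the single category [C], where tensor products and
    actions of mixed degrees can be compared without passing through full subcategories. *)
Definition hom_fun a : kfun (M a) C := kcompf (full_incl (deg C a)) (T a).

Lemma hom_fun_deg a A : deg C a (hom_fun a A).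
Proof. exact: svalP (T a A). Qed.

Definition hom_box a b c (e : a * b = c) (A : M a) (B : M b) :
    iso (ten C (hom_fun a A) (hom_fun b B)) (hom_fun c (box M e A B)) :=
  unfull_iso (hbox T e A B).

Definition hom_unit : iso (Defs.one C) (hom_fun 1 (munit M)) := unfull_iso (hunit T).

(* The action of [f] is [phi C f^-1], but the action on [C] is indexed by all
   [a], and [a^-1^-1] is only propositionally equal to [a]. *)
Definition hom_act (a f b c : G) (p : f^-1 = a) (e : gaut f b c) (A : M b) :
    iso (phi C a (hom_fun b A)) (hom_fun c (mact M e A)) :=
  match p in _ = a return iso (phi C a (hom_fun b A)) (hom_fun c (mact M e A)) with
  | erefl => unfull_iso (hact T e A)
  end.

Lemma hom_boxN a b c (e : a * b = c) A A' B B' (u : hom A A') (v : hom B B') :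
  fmap (hom_fun c) (bmap (box M e) u v) \o hom_box e A B =
  hom_box e A' B' \o bmap (ten C) (fmap (hom_fun a) u) (fmap (hom_fun b) v).
Proof. exact: (hboxN T e u v). Qed.

Lemma hom_box_assoc a b c ab bc abc (e1 : a * b = ab) (e2 : ab * c = abc)
    (e3 : b * c = bc) (e4 : a * bc = abc) (X : M a) (Y : M b) (Z : M c) :
  fmap (hom_fun abc) (massoc e1 e2 e3 e4 X Y Z) \o
    (hom_box e2 (box M e1 X Y) Z \o bmap (ten C) (hom_box e1 X Y) (idm (hom_fun c Z))) =
  hom_box e4 X (box M e3 Y Z) \o
    (bmap (ten C) (idm (hom_fun a X)) (hom_box e3 Y Z) \o
      asso (hom_fun a X) (hom_fun b Y) (hom_fun c Z)).
Proof. exact: (hassoc T e1 e2 e3 e4 X Y Z). Qed.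

Lemma hom_box_lun a (e : 1 * a = a) (X : M a) :
  fmap (hom_fun a) (mlun e X) \o
    (hom_box e (munit M) X \o bmap (ten C) hom_unit (idm (hom_fun a X))) = lun (hom_fun a X).
Proof. exact: (hlun T e X). Qed.

Lemma hom_box_run a (e : a * 1 = a) (X : M a) :
  fmap (hom_fun a) (mrun e X) \o
    (hom_box e X (munit M) \o bmap (ten C) (idm (hom_fun a X)) hom_unit) = run (hom_fun a X).
Proof. exact: (hrun T e X). Qed.

Lemma hom_actN (a f b c : G) (p : f^-1 = a) (e : gaut f b c) (X Y : M b)
    (u : hom X Y) :
  fmap (hom_fun c) (fmap (mact M e) u) \o hom_act p e X =
  hom_act p e Y \o fmap (phi C a) (fmap (hom_fun b) u).
Proof. by subst a; exact: (nicN (hact T e) u). Qed.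

Lemma hom_act_comp (a b c f g h x y z : G) (pa : f^-1 = a) (pb : g^-1 = b)
    (pc : h^-1 = c) (ef : gaut f x y) (eg : gaut g y z) (eh : gaut h x z)
    (e : g * f = h) (e' : a * b = c) (A : M x) :
  hom_act pc eh A \o phi_mul C e' (hom_fun x A) =
  fmap (hom_fun z) (mactM M ef eg eh e A) \o
    (hom_act pb eg (mact M ef A) \o fmap (phi C b) (hom_act pa ef A)).
Proof.
subst a b c; rewrite (Prop_irrelevance e' (inv_prod e)).
exact: (hact_comp T ef eg eh e A).
Qed.

Lemma hom_act_box (a f x y z x' y' z' : G) (p : f^-1 = a) (e : x * y = z)
    (e' : x' * y' = z') (ex : gaut f x x') (ey : gaut f y y')
    (ez : gaut f z z') (A : M x) (B : M y) :
  hom_act p ez (box M e A B) \o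
    (fmap (phi C a) (hom_box e A B) \o mu (phi C a) (hom_fun x A) (hom_fun y B)) =
  fmap (hom_fun z') (boxM e e' ex ey ez A B) \o
    (hom_box e' (mact M ex A) (mact M ey B) \o bmap (ten C) (hom_act p ex A) (hom_act p ey B)).
Proof. by subst a; exact: (hboxM T e e' ex ey ez A B). Qed.

Lemma hom_act_unit (a f : G) (p : f^-1 = a) (e : gaut f 1 1) :
  hom_act p e (munit M) \o (fmap (phi C a) hom_unit \o eps (phi C a)) =
  fmap (hom_fun 1) (unitM M e) \o hom_unit.
Proof. by subst a; exact: (hunitM T e). Qed.

Lemma hom_act_one (x : G) (p : 1^-1 = 1) (e : gaut 1 x x) (A : M x) :
  hom_act p e A \o phi_one C (hom_fun x A) = fmap (hom_fun x) (mact1 M e A).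
Proof.
(* [monoidale_of] transports the unit along 1 = [1^-1], and [hom_act] transports the action back;
   the two cancel. *)
have cast v (q : 1 = v) (r : v = 1) (X Y : C) (i : iso (phi C v X) Y) :
    match r in _ = a return iso (phi C a X) Y with erefl => i end
      \o phi_one C X = i \o phi_one_at C q X.
  by case: v / q r i => r i; rewrite (Prop_irrelevance r erefl).
apply: etrans (hact_one T e A).
exact: (cast _ (esym (invg1 G)) p _ _ (unfull_iso (hact T e A))).
Qed.

End Unfold.

Section IsoAlgebra.

Variables (k : comPzRingType) (C : kcat k).

Lemma fwdKl (X Y Z : C) (i : iso X Y) (f : hom Z X) : bwd i \o (fwd i \o f) = f.
Proof. by rewrite cmpA fwdK cmp1m. Qed.

Lemma bwdKl (X Y Z : C) (i : iso X Y) (f : hom Z Y) : fwd i \o (bwd i \o f) = f.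
Proof. by rewrite cmpA bwdK cmp1m. Qed.

Definition bmap_iso (D E : kcat k) (B : kbifun C D E) (X X' : C) (Y Y' : D)
    (i : iso X X') (j : iso Y Y') : iso (B X Y) (B X' Y').
Proof.
apply: (@Iso k E _ _ (bmap B (fwd i) (fwd j)) (bmap B (bwd i) (bwd j))).
  by rewrite -bmapM !fwdK bmap1.
by rewrite -bmapM !bwdK bmap1.
Defined.

Lemma bmap_isoE (D E : kcat k) (B : kbifun C D E) (X X' : C) (Y Y' : D)
    (i : iso X X') (j : iso Y Y') :
  fwd (bmap_iso B i j) = bmap B (fwd i) (fwd j).
Proof. by []. Qed.

Lemma iso_fmapE (D : kcat k) (F : kfun C D) (X Y : C) (i : iso X Y) :
  fwd (iso_fmap F i) = fmap F (fwd i).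
Proof. by []. Qed.

End IsoAlgebra.

Section ExtElements.

Variables (k : comPzRingType) (C D : kcat k) (O : Type) (u : O -> C).
Variables (H : kfun (ind u) D) (S : C -> D) (dec : forall X, decomp H X (S X)).

Lemma xi_coxi X Y o (y : hom (u o) Y) (p : hom X (u o)) :
  xi dec y \o coxi dec p = fmap (ext dec) (y \o p).
Proof.
apply: (xi_epi (dec := dec)) => o' x; rewrite -cmpA coxi_xi -xiM.
by rewrite [RHS]ext_mapE cmpA.
Qed.

Variables (E : kcat k).

(** Joint epimorphy is witnessed by the finite sum [xi_sum], an equation that every linear functor
    preserves; it therefore also holds after tensoring or acting. *)
Lemma xi_epi_fun (F : kfun D E) X Z (f g : hom (F (S X)) Z) :
  (forall o (x : hom (u o) X), f \o fmap F (xi dec x) = g \o fmap F (xi dec x)) ->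
  f = g.
Proof.
move=> fg; rewrite -(cmpm1 f) -(cmpm1 g) -fmap1 -(xi_sum dec) fmap_sum !cmp_sumr.
by apply: eq_bigr => i _; rewrite fmapM !cmpA fg.
Qed.

Lemma xi_epi_bifun (A : kcat k) (B : kbifun A D E) W X Z
    (f g : hom (B W (S X)) Z) :
  (forall o (x : hom (u o) X),
    f \o bmap B (idm W) (xi dec x) = g \o bmap B (idm W) (xi dec x)) ->
  f = g.
Proof.
move=> fg; rewrite -(cmpm1 f) -(cmpm1 g) -bmap1 -(xi_sum dec) bmap_sumr !cmp_sumr.
by apply: eq_bigr => i _; rewrite bmapMr !cmpA fg.
Qed.

Lemma xi_epi_bifunl (A : kcat k) (B : kbifun D A E) W X Z
    (f g : hom (B (S X) W) Z) :
  (forall o (x : hom (u o) X),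
    f \o bmap B (xi dec x) (idm W) = g \o bmap B (xi dec x) (idm W)) ->
  f = g.
Proof.
move=> fg; rewrite -(cmpm1 f) -(cmpm1 g) -bmap1 -(xi_sum dec) bmap_suml !cmp_sumr.
by apply: eq_bigr => i _; rewrite bmapMl !cmpA fg.
Qed.

End ExtElements.

(** * The extension and its tensor constraint *)

Section CrossedExt.

Variables (k : comPzRingType) (G : groupType) (M : monoidale k G).
Variables (C D : crossed k G).
Variables (K : monoidale_hom M (monoidale_of C)).
Variables (H : monoidale_hom M (monoidale_of D)).
Hypothesis Kfull : forall a, is_full (hom_fun K a).
Hypothesis Kfaithful : forall a, is_faithful (hom_fun K a).

Lemma hom_fun_orth (T : monoidale_hom M (monoidale_of C)) i j (X : M i) (Y : M j) :
  i <> j -> forall f : hom (hom_fun T i X) (hom_fun T j Y), f = 0%R.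
Proof. exact: deg_hom0 (hom_fun_deg _ _) (hom_fun_deg _ _). Qed.

Let O := {a : G & M a}.
Local Notation uK := (fam_obj (hom_fun K)).
Local Notation uH := (lam_obj (hom_fun H)).
Local Notation tC := (ten C).
Local Notation tD := (ten D).

Definition ext_lam : kfun (ind uK) D := lam Kfull Kfaithful (@hom_fun_orth K) (hom_fun H).

Variables (S : C -> D) (dec : forall X, decomp ext_lam X (S X)).
Hypothesis S_deg : forall a X, deg C a X -> deg D a (S X).

Local Notation Lm o o' f := (@fmap k (ind uK) D ext_lam o o' f).
Local Notation xi := (xi dec).
Local Notation coxi := (coxi dec).

Definition tO (o o' : O) c (e : projT1 o * projT1 o' = c) : O :=
  existT _ c (box M e (projT2 o) (projT2 o')).
Definition aO (f : G) (o : O) c (e : gaut f (projT1 o) c) : O :=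
  existT _ c (mact M e (projT2 o)).
Definition oU : O := existT _ 1 (munit M).

Definition kB (o o' : O) c (e : projT1 o * projT1 o' = c) :
  iso (tC (uK o) (uK o')) (uK (tO e)) := hom_box K e (projT2 o) (projT2 o').
Definition hB (o o' : O) c (e : projT1 o * projT1 o' = c) :
  iso (tD (uH o) (uH o')) (uH (tO e)) := hom_box H e (projT2 o) (projT2 o').
Definition kA a (f : G) (p : f^-1 = a) (o : O) c (e : gaut f (projT1 o) c) :
  iso (phi C a (uK o)) (uK (aO e)) := hom_act K p e (projT2 o).
Definition hA a (f : G) (p : f^-1 = a) (o : O) c (e : gaut f (projT1 o) c) :
  iso (phi D a (uH o)) (uH (aO e)) := hom_act H p e (projT2 o).
Definition kU : iso (Defs.one C) (uK oU) := hom_unit K.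
Definition hU : iso (Defs.one D) (uH oU) := hom_unit H.

Lemma LmE a (X Y : M a) (v : hom X Y) :
  Lm (existT _ a X) (existT _ a Y) (fmap (hom_fun K a) v) = fmap (hom_fun H a) v.
Proof. exact: lam_mapE. Qed.

(** Naturality of [hB] with respect to all morphisms of [C] between named objects, not just images
    of morphisms of [M]. Tensor products of such morphisms are brought back to named objects by
    conjugating with [kB]. *)
Lemma Lm_box (o1 o1' o2 o2' : O) c c' (e : projT1 o1 * projT1 o2 = c)
    (e' : projT1 o1' * projT1 o2' = c') (f : hom (uK o1) (uK o1'))
    (g : hom (uK o2) (uK o2')) :
  hB e' \o bmap tD (Lm o1 o1' f) (Lm o2 o2' g) =
  Lm (tO e) (tO e') (kB e' \o (bmap tC f g \o bwd (kB e))) \o hB e.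
Proof.
move: o1 o1' f e e'; apply: (fam_ind Kfull (@hom_fun_orth K)) => [i X X' v|o1 o1'] e e'; last first.
  by rewrite fmap0 !bmap0m cmp0m !cmpm0 fmap0 cmp0m.
move: o2 o2' g e e'; apply: (fam_ind Kfull (@hom_fun_orth K)) => [j Y Y' w|o2 o2'] e e'; last first.
  by rewrite fmap0 !bmapm0 cmp0m !cmpm0 fmap0 cmp0m.
simpl in e, e'; subst c c'; rewrite !LmE.
have E : kB (o := existT _ i X') (o' := existT _ j Y') erefl \o
    (bmap tC (fmap (hom_fun K i) v) (fmap (hom_fun K j) w) \o
      bwd (kB (o := existT _ i X) (o' := existT _ j Y) erefl)) =
    fmap (hom_fun K (i * j)) (bmap (box M erefl) v w).
  by rewrite cmpA -hom_boxN -cmpA bwdK cmpm1.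
apply: etrans (esym (hom_boxN H _ v w)) _; congr (_ \o _).
by apply: etrans (esym (LmE _)) _; rewrite -E.
Qed.

Lemma Lm_act a f (p : f^-1 = a) (o o' : O) c c' (e : gaut f (projT1 o) c)
    (e' : gaut f (projT1 o') c') (g : hom (uK o) (uK o')) :
  hA p e' \o fmap (phi D a) (Lm o o' g) =
  Lm (aO e) (aO e') (kA p e' \o (fmap (phi C a) g \o bwd (kA p e))) \o hA p e.
Proof.
move: o o' g e e'.
apply: (fam_ind Kfull (@hom_fun_orth K)) => [i X Y v|o o'] e e'; last first.
  by rewrite !fmap0 cmp0m !cmpm0 fmap0 cmp0m.
unfold gaut in e, e'; simpl in e, e'; subst c c'; rewrite LmE.
set e := (erefl : gaut f i _).
have E : kA (o := existT _ i Y) p e \o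
    (fmap (phi C a) (fmap (hom_fun K i) v) \o bwd (kA (o := existT _ i X) p e)) =
    fmap (hom_fun K _) (fmap (mact M e) v).
  by rewrite cmpA -hom_actN -cmpA bwdK cmpm1.
apply: etrans (esym (hom_actN H p e v)) _; congr (_ \o _).
by apply: etrans (esym (LmE _)) _; rewrite -E.
Qed.

Lemma xi_mapE X Y (f : hom X Y) o (x : hom (uK o) X) :
  fmap (ext dec) f \o xi x = xi (f \o x).
Proof. exact: ext_mapE. Qed.

Lemma xi_sumE X o I (r : seq I) P (F : I -> hom (uK o) X) :
  xi (\sum_(i <- r | P i) F i)%R = (\sum_(i <- r | P i) xi (F i))%R.
Proof. exact: (lin_sum (@xi_lin _ _ _ _ _ _ _ dec X o)). Qed.

Ltac xi_congr := match goal with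
  |- cmp (xi ?x) ?w = cmp (xi ?y) ?v =>
    let e := fresh in have e : x = y; [|rewrite e; reflexivity] end.

(* Characterized on generalized elements by [ext_mu_xi]; all the coherence
   conditions below are checked there. *)
Definition ext_mu_fwd X Y : hom (tD (S X) (S Y)) (S (tC X Y)) :=
  (\sum_i \sum_j (xi (o := tO erefl) (bmap tC (dinj (dec X) i) (dinj (dec Y) j) \o bwd (kB erefl))
     \o (hB erefl \o bmap tD (sproj (dec X) i) (sproj (dec Y) j))))%R.

Definition ext_mu_bwd X Y : hom (S (tC X Y)) (tD (S X) (S Y)) :=
  (\sum_i \sum_j (bmap tD (sinj (dec X) i) (sinj (dec Y) j) \o
     (bwd (hB erefl) \o coxi (o := tO erefl)
       (kB erefl \o bmap tC (dproj (dec X) i) (dproj (dec Y) j)))))%R.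

Lemma bmap_dsum X Y :
  (\sum_i \sum_j (bmap tC (dinj (dec X) i) (dinj (dec Y) j) \o
    bmap tC (dproj (dec X) i) (dproj (dec Y) j)))%R = idm (tC X Y).
Proof.
rewrite -bmap1 -(dsum (dec X)) -(dsum (dec Y)) bmap_suml.
apply: eq_bigr => i _; rewrite bmap_sumr; apply: eq_bigr => j _.
by rewrite bmapM.
Qed.

(** The chosen decompositions disappear: by [sproj_xi] and [Lm_box] the terms of the sum recombine
    into [x] and [y] through [bmap_dsum]. *)
Lemma ext_mu_xi X Y (o o' : O) c (e : projT1 o * projT1 o' = c)
    (x : hom (uK o) X) (y : hom (uK o') Y) :
  ext_mu_fwd X Y \o bmap tD (xi x) (xi y) =
  xi (o := tO e) (bmap tC x y \o bwd (kB e)) \o hB e.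
Proof.
rewrite /ext_mu_fwd cmp_suml -[in RHS](cmp1m (bmap tC x y)) -(bmap_dsum X Y).
rewrite !cmp_suml (xi_sumE (o := tO e)) cmp_suml; apply: eq_bigr => i _.
rewrite !cmp_suml (xi_sumE (o := tO e)) cmp_suml; apply: eq_bigr => j _.
rewrite -!cmpA -bmapM !sproj_xi (Lm_box e) [LHS]cmpA -(xiM dec).
by rewrite -!cmpA fwdKl bmapM -!cmpA.
Qed.

Lemma xi_epi2 X Y Z (f g : hom (tD (S X) (S Y)) Z) :
  (forall o o' (x : hom (uK o) X) (y : hom (uK o') Y),
    f \o bmap tD (xi x) (xi y) = g \o bmap tD (xi x) (xi y)) -> f = g.
Proof.
move=> fg; apply: (xi_epi_bifun (dec := dec)) => o' y.
apply: (xi_epi_bifunl (dec := dec)) => o x.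
by rewrite -!cmpA -bmapM !cmp1m cmpm1 fg.
Qed.

Lemma SS_sum X Y : (\sum_i \sum_j
    (bmap tD (xi (dinj (dec X) i)) (xi (dinj (dec Y) j)) \o
     bmap tD (coxi (dproj (dec X) i)) (coxi (dproj (dec Y) j))))%R =
  idm (tD (S X) (S Y)).
Proof.
rewrite -bmap1 -(xi_sum dec X) -(xi_sum dec Y) bmap_suml.
apply: eq_bigr => i _; rewrite bmap_sumr; apply: eq_bigr => j _.
by rewrite bmapM.
Qed.

Lemma xi_epi3 X Y Z W (f g : hom (tD (tD (S X) (S Y)) (S Z)) W) :
  (forall o1 o2 o3 (x : hom (uK o1) X) (y : hom (uK o2) Y) (z : hom (uK o3) Z),
    f \o bmap tD (bmap tD (xi x) (xi y)) (xi z) =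
    g \o bmap tD (bmap tD (xi x) (xi y)) (xi z)) -> f = g.
Proof.
move=> fg; apply: (xi_epi_bifun (dec := dec)) => o3 z.
rewrite -(SS_sum X Y) bmap_suml !cmp_sumr; apply: eq_bigr => i _.
rewrite bmap_suml !cmp_sumr; apply: eq_bigr => j _.
by rewrite -[xi z]cmpm1 bmapM !cmpA fg.
Qed.

Lemma ext_muK X Y : ext_mu_bwd X Y \o ext_mu_fwd X Y = idm _.
Proof.
apply: xi_epi2 => o o' x y; rewrite cmp1m -cmpA (ext_mu_xi erefl).
rewrite /ext_mu_bwd cmp_suml [xi x]xi_def bmap_suml; apply: eq_bigr => i _.
rewrite cmp_suml [xi y]xi_def bmap_sumr; apply: eq_bigr => j _.
rewrite -!cmpA (cmpA (coxi _)) coxi_xi bmapM; congr (_ \o _).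
apply: (@iso_inj _ _ _ _ _ (hB erefl)); rewrite bwdKl (Lm_box erefl).
by congr (Lm _ _ _ \o _); rewrite bmapM -!cmpA.
Qed.

Lemma ext_muV X Y : ext_mu_fwd X Y \o ext_mu_bwd X Y = idm _.
Proof.
rewrite /ext_mu_bwd cmp_sumr -(fmap1 (ext dec)) -(bmap_dsum X Y) fmap_sum.
apply: eq_bigr => i _; rewrite cmp_sumr fmap_sum; apply: eq_bigr => j _.
rewrite -!xi_dinj cmpA (ext_mu_xi erefl) -cmpA bwdKl xi_coxi.
by rewrite -cmpA fwdKl.
Qed.

Definition ext_mu X Y : iso (tD (ext dec X) (ext dec Y)) (ext dec (tC X Y)) :=
  Iso (ext_muK X Y) (ext_muV X Y).

Lemma ext_epsK :
  (bwd hU \o coxi (o := oU) kU) \o (xi (o := oU) (bwd kU) \o hU) = idm _.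
Proof.
rewrite -cmpA (cmpA (coxi _)) coxi_xi bwdK.
by rewrite [fmap _ _](fmap1 ext_lam) cmp1m fwdK.
Qed.

Lemma ext_epsV :
  (xi (o := oU) (bwd kU) \o hU) \o (bwd hU \o coxi (o := oU) kU) = idm _.
Proof. by rewrite -cmpA bwdKl xi_coxi fwdK; exact: (fmap1 (ext dec)). Qed.

Definition ext_eps : iso (Defs.one D) (ext dec (Defs.one C)) :=
  Iso ext_epsK ext_epsV.

Lemma ext_mu_xiE X Y (o o' : O) c (e : projT1 o * projT1 o' = c)
    (x : hom (uK o) X) (y : hom (uK o') Y) :
  ext_mu X Y \o bmap tD (xi x) (xi y) =
  xi (o := tO e) (bmap tC x y \o bwd (kB e)) \o hB e.
Proof. exact: ext_mu_xi. Qed.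

Lemma ext_mu_nat X X' Y Y' (f : hom X X') (g : hom Y Y') :
  fmap (ext dec) (bmap tC f g) \o ext_mu X Y =
  ext_mu X' Y' \o bmap tD (fmap (ext dec) f) (fmap (ext dec) g).
Proof.
apply: xi_epi2 => o o' x y; rewrite -!cmpA -bmapM !xi_mapE.
by rewrite !(ext_mu_xiE erefl) cmpA xi_mapE bmapM cmpA.
Qed.

(** The hinge of the coherence proofs: a constraint of [M] arising on the side of [H] is absorbed
    into the element as the same constraint seen through [K], leaving an identity in [C] that the
    axioms of [K] settle. *)
Lemma LmK a (X Y : M a) (v : hom X Y) Z (x : hom (hom_fun K a Y) Z) :
  xi (o := existT _ a Y) x \o fmap (hom_fun H a) v =
  xi (o := existT _ a X) (x \o fmap (hom_fun K a) v).
Proof.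
rewrite -LmE; exact: esym (@xiM _ _ _ _ _ _ _ dec _ (existT _ a X)
  (existT _ a Y) x (fmap (hom_fun K a) v)).
Qed.

Lemma kB_assoc X Y Z (o1 o2 o3 : O) ab bc abc (e1 : projT1 o1 * projT1 o2 = ab)
    (e2 : ab * projT1 o3 = abc) (e3 : projT1 o2 * projT1 o3 = bc)
    (e4 : projT1 o1 * bc = abc)
    (x : hom (uK o1) X) (y : hom (uK o2) Y) (z : hom (uK o3) Z) :
  asso X Y Z \o
    (bmap tC (bmap tC x y \o bwd (kB e1)) z \o bwd (kB (o := tO e1) e2)) =
  (bmap tC x (bmap tC y z \o bwd (kB e3)) \o bwd (kB (o' := tO e3) e4)) \o
    fmap (hom_fun K abc) (massoc e1 e2 e3 e4 (projT2 o1) (projT2 o2) (projT2 o3)).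
Proof.
have KK : fmap (hom_fun K abc) (massoc e1 e2 e3 e4 (projT2 o1) (projT2 o2) (projT2 o3)) \o
    (kB (o := tO e1) e2 \o bmap tC (kB e1) (idm (uK o3))) =
  kB (o' := tO e3) e4 \o (bmap tC (idm (uK o1)) (kB e3) \o asso _ _ _).
  exact: hom_box_assoc.
(* Precomposing with the constraints of [K] cancels their inverses; what remains is naturality of
   the associator of [C]. *)
apply: (@iso_surj _ _ _ _ _ (kB (o := tO e1) e2)).
apply: (@iso_surj _ _ _ _ _ (bmap_iso tC (kB e1) (iso_id (uK o3)))).
rewrite [fwd (bmap_iso _ _ _)]bmap_isoE -!cmpA KK fwdKl.
rewrite (cmpA (bwd _) (fwd _)) fwdK cmp1m !(cmpA (bmap _ _ _) (bmap _ _ _)).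
rewrite -!bmapM -!cmpA !fwdK !cmpm1.
exact: esym (assoN x y z).
Qed.

Lemma ext_muA X Y Z :
  fmap (ext dec) (asso X Y Z) \o
    (ext_mu (tC X Y) Z \o bmap tD (ext_mu X Y) (idm (S Z))) =
  ext_mu X (tC Y Z) \o
    (bmap tD (idm (S X)) (ext_mu Y Z) \o asso (S X) (S Y) (S Z)).
Proof.
apply: xi_epi3 => o1 o2 o3 x y z.
(* The right-hand bracketing is given the degree of the left-hand one, so that both composites are
   values of [xi] at the same name. *)
have e := mulgA (projT1 o1) (projT1 o2) (projT1 o3).
rewrite -!cmpA -assoN -bmapM cmp1m (ext_mu_xiE erefl).
rewrite (cmpA (bmap tD (idm _) _)) -bmapM cmp1m (ext_mu_xiE erefl).
rewrite -[xi z in LHS]cmpm1 bmapM (cmpA (ext_mu _ _) (bmap tD _ _)).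
rewrite (ext_mu_xiE (o := tO (o := o1) (o' := o2) erefl) (o' := o3) erefl).
rewrite -[xi x in RHS]cmpm1 bmapM -!cmpA (cmpA (ext_mu _ _) (bmap tD _ _)).
rewrite (ext_mu_xiE (o := o1) (o' := tO (o := o2) (o' := o3) erefl) e) [LHS]cmpA xi_mapE.
have HH : fmap (hom_fun H _) (massoc erefl erefl erefl e (projT2 o1) (projT2 o2)
      (projT2 o3)) \o
    (hB (o := tO (o := o1) (o' := o2) erefl) erefl \o
      bmap tD (hB erefl) (idm (ext_lam o3))) =
  hB (o := o1) (o' := tO (o := o2) (o' := o3) erefl) e \o
    (bmap tD (idm (ext_lam o1)) (hB erefl) \o asso _ _ _).
  exact: hom_box_assoc.
rewrite -[RHS]cmpA -HH [RHS]cmpA LmK; congr (xi _ \o _).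
exact: kB_assoc.
Qed.

Lemma ext_mu1m X :
  fmap (ext dec) (lun X) \o
    (ext_mu (Defs.one C) X \o bmap tD ext_eps (idm (S X))) = lun (S X).
Proof.
apply: (xi_epi_bifun (dec := dec)) => -[a A] x.
set o : O := existT _ a A.
rewrite -lunN -!cmpA -bmapM cmp1m cmpm1 -[xi x in LHS]cmpm1 bmapM.
rewrite (cmpA (ext_mu _ _) (bmap tD _ _)).
rewrite (ext_mu_xiE (o := oU) (o' := o) (mul1g a)) [LHS]cmpA cmpA xi_mapE.
have HH : fmap (hom_fun H _) (mlun (mul1g a) A) \o
  (hB (o := oU) (o' := o) (mul1g a) \o bmap tD hU (idm (ext_lam o))) = lun (ext_lam o).
  exact: hom_box_lun.
rewrite -HH -cmpA [RHS]cmpA LmK; congr (xi _ \o _).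
have KK : fmap (hom_fun K _) (mlun (mul1g a) A) \o
  (kB (o := oU) (o' := o) (mul1g a) \o bmap tC kU (idm (uK o))) = lun (uK o).
  exact: hom_box_lun.
apply: (@iso_surj _ _ _ _ _ (kB (o := oU) (o' := o) (mul1g a))).
apply: (@iso_surj _ _ _ _ _ (bmap_iso tC kU (iso_id (uK o)))).
rewrite [fwd (bmap_iso _ _ _)]bmap_isoE -!cmpA KK fwdKl -bmapM fwdK cmpm1.
exact: esym (lunN x).
Qed.

Lemma ext_mum1 X :
  fmap (ext dec) (run X) \o
    (ext_mu X (Defs.one C) \o bmap tD (idm (S X)) ext_eps) = run (S X).
Proof.
apply: (xi_epi_bifunl (dec := dec)) => -[a A] x.
set o : O := existT _ a A.
rewrite -runN -!cmpA -bmapM cmp1m cmpm1 -[xi x in LHS]cmpm1 bmapM.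
rewrite (cmpA (ext_mu _ _) (bmap tD _ _)).
rewrite (ext_mu_xiE (o := o) (o' := oU) (mulg1 a)) [LHS]cmpA cmpA xi_mapE.
have HH : fmap (hom_fun H _) (mrun (mulg1 a) A) \o
  (hB (o := o) (o' := oU) (mulg1 a) \o bmap tD (idm (ext_lam o)) hU) = run (ext_lam o).
  exact: hom_box_run.
rewrite -HH -cmpA [RHS]cmpA LmK; congr (xi _ \o _).
have KK : fmap (hom_fun K _) (mrun (mulg1 a) A) \o
  (kB (o := o) (o' := oU) (mulg1 a) \o bmap tC (idm (uK o)) kU) = run (uK o).
  exact: hom_box_run.
apply: (@iso_surj _ _ _ _ _ (kB (o := o) (o' := oU) (mulg1 a))).
apply: (@iso_surj _ _ _ _ _ (bmap_iso tC (iso_id (uK o)) kU)).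
rewrite [fwd (bmap_iso _ _ _)]bmap_isoE -!cmpA KK fwdKl -bmapM fwdK cmpm1.
exact: esym (runN x).
Qed.

Definition ext_sm : smfun C D :=
  @SMFun k C D (ext dec) ext_mu ext_mu_nat ext_eps ext_muA ext_mu1m ext_mum1.

(** * The action constraint of the extension *)

Section Action.

Variable a : G.

Let gautV (b : G) : gaut a^-1 b (a^-1 * b * a^-1^-1) := erefl.

Let kV (o : O) := kA (invgK a) (o := o) (gautV (projT1 o)).
Let hV (o : O) := hA (invgK a) (o := o) (gautV (projT1 o)).

Definition ext_phi_fwd X : hom (phi D a (S X)) (S (phi C a X)) :=
  (\sum_i (xi (o := aO (gautV _)) (fmap (phi C a) (dinj (dec X) i) \o bwd (kV _))
     \o (hV _ \o fmap (phi D a) (sproj (dec X) i))))%R.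

Definition ext_phi_bwd X : hom (S (phi C a X)) (phi D a (S X)) :=
  (\sum_i (fmap (phi D a) (sinj (dec X) i) \o
     (bwd (hV _) \o coxi (o := aO (gautV _))
       (kV _ \o fmap (phi C a) (dproj (dec X) i)))))%R.

Lemma phi_dsum X :
  (\sum_i (fmap (phi C a) (dinj (dec X) i) \o
    fmap (phi C a) (dproj (dec X) i)))%R = idm (phi C a X).
Proof.
rewrite -fmap1 -(dsum (dec X)) fmap_sum.
by apply: eq_bigr => i _; rewrite fmapM.
Qed.

(** Any [f] with [f^-1 = a] is allowed: usually it is [a^-1], but for the unit condition [f] and [a]
    are both 1, where replacing [f] by [1^-1] would need a transport. *)
Lemma ext_phi_xi0 X (f : G) (p : f^-1 = a) (o : O) c (e : gaut f (projT1 o) c)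
    (x : hom (uK o) X) :
  ext_phi_fwd X \o fmap (phi D a) (xi x) =
  xi (o := aO e) (fmap (phi C a) x \o bwd (kA p e)) \o hA p e.
Proof.
have fE : f = a^-1 by rewrite -p invgK.
subst f; rewrite (Prop_irrelevance p (invgK a)).
rewrite /ext_phi_fwd cmp_suml -[in RHS](cmp1m (fmap _ x)) -(phi_dsum X).
rewrite !cmp_suml (xi_sumE (o := aO e)) cmp_suml; apply: eq_bigr => i _.
rewrite -!cmpA -fmapM sproj_xi (Lm_act (invgK a) e) [LHS]cmpA -(xiM dec).
by rewrite -!cmpA fwdKl fmapM -!cmpA.
Qed.

Lemma ext_phiK X : ext_phi_bwd X \o ext_phi_fwd X = idm _.
Proof.
apply: (xi_epi_fun (dec := dec)) => o x.
rewrite cmp1m -cmpA (ext_phi_xi0 (invgK a) (gautV _)).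
rewrite /ext_phi_bwd cmp_suml [xi x in RHS]xi_def fmap_sum; apply: eq_bigr => i _.
rewrite -!cmpA (cmpA (coxi _)) coxi_xi fmapM; congr (_ \o _).
apply: (@iso_inj _ _ _ _ _ (hV _)).
rewrite bwdKl (Lm_act (invgK a) (gautV _)).
by congr (Lm _ _ _ \o _); rewrite fmapM -!cmpA.
Qed.

Lemma ext_phiV X : ext_phi_fwd X \o ext_phi_bwd X = idm _.
Proof.
rewrite /ext_phi_bwd cmp_sumr -(fmap1 (ext dec)) -(phi_dsum X) fmap_sum.
apply: eq_bigr => i _.
rewrite -!xi_dinj cmpA (ext_phi_xi0 (invgK a) (gautV _)) -cmpA bwdKl xi_coxi.
by rewrite -cmpA fwdKl.
Qed.

Definition ext_phi X : iso (phi D a (ext dec X)) (ext dec (phi C a X)) :=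
  Iso (ext_phiK X) (ext_phiV X).

Lemma ext_phi_xi X (f : G) (p : f^-1 = a) (o : O) c (e : gaut f (projT1 o) c)
    (x : hom (uK o) X) :
  ext_phi X \o fmap (phi D a) (xi x) =
  xi (o := aO e) (fmap (phi C a) x \o bwd (kA p e)) \o hA p e.
Proof. exact: ext_phi_xi0. Qed.

Lemma ext_phiN X Y (f : hom X Y) :
  fmap (ext dec) (fmap (phi C a) f) \o ext_phi X =
  ext_phi Y \o fmap (phi D a) (fmap (ext dec) f).
Proof.
apply: (xi_epi_fun (dec := dec)) => o x.
rewrite -!cmpA -fmapM xi_mapE !(ext_phi_xi (invgK a) (gautV _)) cmpA xi_mapE.
by rewrite fmapM cmpA.
Qed.

Lemma xi_epi_phi2 X Y Z (f g : hom (tD (phi D a (S X)) (phi D a (S Y))) Z) :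
  (forall o o' (x : hom (uK o) X) (y : hom (uK o') Y),
    f \o bmap tD (fmap (phi D a) (xi x)) (fmap (phi D a) (xi y)) =
    g \o bmap tD (fmap (phi D a) (xi x)) (fmap (phi D a) (xi y))) -> f = g.
Proof.
move=> fg; apply: (@iso_surj _ _ _ _ _ (bmap_iso tD (iso_id _) (iso_id _))).
rewrite [fwd (bmap_iso _ _ _)]bmap_isoE /= -!fmap1 -(xi_sum dec X).
rewrite -(xi_sum dec Y) fmap_sum bmap_suml !cmp_sumr; apply: eq_bigr => i _.
rewrite fmap_sum bmap_sumr !cmp_sumr; apply: eq_bigr => j _.
by rewrite !fmapM bmapM !cmpA fg.
Qed.

Lemma ext_phi_mu X Y :
  ext_phi (tC X Y) \o
    (fmap (phi D a) (ext_mu X Y) \o mu (phi D a) (S X) (S Y)) =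
  (fmap (ext dec) (mu (phi C a) X Y) \o ext_mu (phi C a X) (phi C a Y)) \o
    bmap tD (ext_phi X) (ext_phi Y).
Proof.
apply: xi_epi_phi2 => -[b B] [c A] x y.
set o : O := existT _ b B; set o' : O := existT _ c A.
pose e := erefl (b * c); pose e' := cbox_deg a^-1 b c.
rewrite -!cmpA -muN (cmpA (fmap _ (ext_mu _ _))) -fmapM.
rewrite (ext_mu_xiE (o := o) (o' := o') e) fmapM.
rewrite (cmpA (fwd (ext_phi _))) (cmpA (fwd (ext_phi _)) (fmap _ (xi _))).
rewrite (ext_phi_xi (o := tO (o := o) (o' := o') e) (invgK a) (gautV _)).
rewrite -bmapM !(ext_phi_xi (invgK a) (gautV _)) bmapM.
rewrite (cmpA (fwd (ext_mu _ _))).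
rewrite (ext_mu_xiE (o := aO (o := o) (gautV b)) (o' := aO (o := o') (gautV c)) e').
have HH : hA (o := tO (o := o) (o' := o') e) (invgK a) (gautV (b * c)) \o
    (fmap (phi D a) (hB (o := o) (o' := o') e) \o mu (phi D a) (ext_lam o) (ext_lam o')) =
  fmap (hom_fun H _) (boxM e e' (gautV b) (gautV c) (gautV (b * c)) B A) \o
    (hB (o := aO (o := o) (gautV b)) (o' := aO (o := o') (gautV c)) e' \o
      bmap tD (hA (o := o) (invgK a) (gautV b)) (hA (o := o') (invgK a) (gautV c))).
  exact: hom_act_box.
rewrite -!cmpA HH [LHS]cmpA LmK [RHS]cmpA xi_mapE;  xi_congr.
have KK : kA (o := tO (o := o) (o' := o') e) (invgK a) (gautV (b * c)) \o
    (fmap (phi C a) (kB (o := o) (o' := o') e) \o mu (phi C a) (uK o) (uK o')) =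
  fmap (hom_fun K _) (boxM e e' (gautV b) (gautV c) (gautV (b * c)) B A) \o
    (kB (o := aO (o := o) (gautV b)) (o' := aO (o := o') (gautV c)) e' \o
      bmap tC (kA (o := o) (invgK a) (gautV b)) (kA (o := o') (invgK a) (gautV c))).
  exact: hom_act_box.
apply: (@iso_surj _ _ _ _ _
  (kB (o := aO (o := o) (gautV b)) (o' := aO (o := o') (gautV c)) e')).
apply: (@iso_surj _ _ _ _ _ (bmap_iso tC (kA (o := o) (invgK a) (gautV b))
  (kA (o := o') (invgK a) (gautV c)))).
rewrite [fwd (bmap_iso _ _ _)]bmap_isoE -!cmpA -KK !fwdKl fmapM.
rewrite -cmpA (cmpA (fmap _ (bwd _))) -fmapM fwdK fmap1 cmp1m.
rewrite -bmapM -!cmpA !fwdK !cmpm1.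
exact: muN.
Qed.

Lemma ext_phi_eps :
  ext_phi (Defs.one C) \o (fmap (phi D a) ext_eps \o eps (phi D a)) =
  fmap (ext dec) (eps (phi C a)) \o ext_eps.
Proof.
rewrite fmapM cmpA (cmpA (fwd (ext_phi _))).
have e := gaut_one a^-1.
rewrite (ext_phi_xi (o := oU) (invgK a) e) -!cmpA.
have HH : hA (o := oU) (invgK a) e \o (fmap (phi D a) hU \o eps (phi D a)) =
  fmap (hom_fun H 1) (unitM M e) \o hU by exact: hom_act_unit.
rewrite HH [LHS]cmpA LmK [RHS]cmpA xi_mapE.
xi_congr.
have KK : kA (o := oU) (invgK a) e \o (fmap (phi C a) kU \o eps (phi C a)) =
  fmap (hom_fun K 1) (unitM M e) \o kU by exact: hom_act_unit.
apply: (@iso_surj _ _ _ _ _ kU); rewrite -!cmpA -KK fwdKl cmpA -fmapM fwdK.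
by rewrite fmap1 cmp1m cmpm1.
Qed.

Definition ext_phi_smniso :
    smniso (smcomp (phi D a) ext_sm) (smcomp ext_sm (phi C a)) :=
  @SMNIso k C D (smcomp (phi D a) ext_sm) (smcomp ext_sm (phi C a))
    (@NIso k C D (smcomp (phi D a) ext_sm) (smcomp ext_sm (phi C a))
      ext_phi ext_phiN) ext_phi_mu ext_phi_eps.

End Action.

Lemma ext_phi_mul a b c (e : b * a = c) X :
  ext_phi c X \o phi_mul D e (S X) =
  fmap (ext dec) (phi_mul C e X) \o
    (ext_phi a (phi C b X) \o fmap (phi D a) (ext_phi b X)).
Proof.
apply: (xi_epi_fun (dec := dec) (F := kcompf (phi D a) (phi D b))) => -[x A] t.
set o : O := existT _ x A.
have e' := cinv_prod e.
have ef : gaut b^-1 x (b^-1 * x * b^-1^-1) by [].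
have eh : gaut c^-1 x (c^-1 * x * c^-1^-1) by [].
(* Acting by b and then by a must end in the degree written with c, or the two sides would carry
   different names; [gaut_comp] supplies this. *)
have eg : gaut a^-1 (b^-1 * x * b^-1^-1) (c^-1 * x * c^-1^-1) := gaut_comp x e'.
have N := nicN (phi_mul D e) (xi (o := o) t); rewrite -[LHS]cmpA -N.
rewrite [LHS]cmpA (ext_phi_xi (o := o) (invgK c) eh) -[LHS]cmpA.
have HH : hA (o := o) (invgK c) eh \o phi_mul D e (ext_lam o) =
  fmap (hom_fun H _) (mactM M ef eg eh e' A) \o
    (hA (o := aO (o := o) ef) (invgK a) eg \o fmap (phi D a) (hA (o := o) (invgK b) ef)).
  exact: hom_act_comp.
rewrite HH [LHS]cmpA LmK -!cmpA -[fmap (kcompf _ _) _]/(fmap (phi D a) (fmap (phi D b) (xi (o := o) t))).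
have F2 := esym (fmapM (phi D a) (fwd (ext_phi b X)) (fmap (phi D b) (xi (o := o) t))).
rewrite F2 (ext_phi_xi (o := o) (invgK b) ef) fmapM (cmpA (fwd (ext_phi _ _))).
rewrite (ext_phi_xi (o := aO (o := o) ef) (invgK a) eg) [RHS]cmpA [X in _ = X \o _]cmpA xi_mapE.
rewrite -[RHS]cmpA; xi_congr.
have KK : kA (o := o) (invgK c) eh \o phi_mul C e (uK o) =
  fmap (hom_fun K _) (mactM M ef eg eh e' A) \o
    (kA (o := aO (o := o) ef) (invgK a) eg \o fmap (phi C a) (kA (o := o) (invgK b) ef)).
  exact: hom_act_comp.
apply: (@iso_surj _ _ _ _ _ (kA (o := aO (o := o) ef) (invgK a) eg)).
apply: (@iso_surj _ _ _ _ _ (iso_fmap (phi C a) (kA (o := o) (invgK b) ef))).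
rewrite [fwd (iso_fmap _ _)]iso_fmapE -!cmpA -KK !fwdKl -fmapM -cmpA fwdK cmpm1.
exact: (nicN (phi_mul C e) t).
Qed.

Lemma ext_phi_one X :
  ext_phi 1 X \o phi_one D (S X) = fmap (ext dec) (phi_one C X).
Proof.
apply: (xi_epi (dec := dec)) => -[x A] t; set o : O := existT _ x A.
have N := nicN (phi_one D) (xi (o := o) t); rewrite -[LHS]cmpA -[_ \o xi t]N.
rewrite [LHS]cmpA (ext_phi_xi (o := o) (invg1 G) (gaut1 x)) -[LHS]cmpA.
have HH : hA (o := o) (invg1 G) (gaut1 x) \o phi_one D (ext_lam o) =
  fmap (hom_fun H x) (mact1 M (gaut1 x) A) by exact: hom_act_one.
rewrite HH LmK [RHS]xi_mapE; congr (xi (o := o) _).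
have KK : kA (o := o) (invg1 G) (gaut1 x) \o phi_one C (uK o) =
  fmap (hom_fun K x) (mact1 M (gaut1 x) A) by exact: hom_act_one.
rewrite -cmpA -KK fwdKl.
exact: (nicN (phi_one C) t).
Qed.

Definition ext_crossed : crossed_fun C D :=
  @CrossedFun k G C D ext_sm S_deg ext_phi_smniso ext_phi_mul ext_phi_one.

End CrossedExt.

Lemma dsum_unique (k : comPzRingType) (C : kcat k) n (X : 'I_n -> C) S T :
  is_dsum X S -> is_dsum X T -> inhabited (iso S T).
Proof.
move=> [p [q [qp1 qp0 pq]]] [p' [q' [qp1' qp0' pq']]].
have aux S' T' (r : forall i, hom (X i) S') s (r' : forall i, hom (X i) T') s' :
    (forall i, s' i \o r' i = idm (X i)) ->
    (forall i j, i <> j -> s' j \o r' i = 0%R) ->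
    (\sum_i (r i \o s i))%R = idm S' ->
    (\sum_i (r i \o s' i))%R \o (\sum_i (r' i \o s i))%R = idm S'.
  move=> sr1 sr0 <-; rewrite cmp_suml; apply: eq_bigr => i _.
  rewrite cmp_sumr (bigD1 i) //= big1 => [|j /eqP ne].
    by rewrite addr0 -cmpA (cmpA (s' i)) sr1 cmp1m.
  by rewrite -cmpA (cmpA (s' i)) sr0 // cmp0m cmpm0.
constructor; exists (\sum_i (p' i \o q i))%R (\sum_i (p i \o q' i))%R.
  exact: aux.
exact: aux.
Qed.

(** * Generating morphisms and equivalences *)

Section Generating.

Variables (k : comPzRingType) (G : groupType).

(** For components of a crossed category this is the same as being a completion in each degree.
    Unlike the universal property it makes sense without direct sums in the target, and it is
    visibly closed under composition. *)
Definition generating (M N : monoidale k G) (T : monoidale_hom M N) : Prop :=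
  forall a, [/\ is_full (T a), is_faithful (T a) & dense (T a)].

Section Crossed.

Variables (M : monoidale k G) (C : crossed k G).
Variables (T : monoidale_hom M (monoidale_of C)).
Hypothesis T_gen : generating T.

Lemma hom_fun_full a : is_full (hom_fun T a).
Proof. by move=> X Y v; have [Tfull _ _] := T_gen a; exact: Tfull. Qed.

Lemma hom_fun_faithful a : is_faithful (hom_fun T a).
Proof.
by move=> X Y; have [_ Tfaithful _] := T_gen a; exact: (@Tfaithful X Y).
Qed.

Lemma hom_fun_dense_deg X a : deg C a X -> exists n (A : 'I_n -> M a),
  is_dsum (fun i => hom_fun T a (A i)) X.
Proof.
move=> Xa; have [_ _ Tdense] := T_gen a.
have [n [A AX]] := Tdense (exist (deg C a) X Xa).
by exists n, A.
Qed.

(** The second clause is what lets the extension preserve degrees. The splitting axiom alone does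
    not give it, since a homogeneous object might split with zero summands of foreign degrees; hence
    the case distinction. *)
Lemma hom_fun_dense X : exists n (o : 'I_n -> {a : G & M a}),
  is_dsum (fun i => fam_obj (hom_fun T) (o i)) X /\
  (forall a, deg C a X -> forall i, projT1 (o i) = a).
Proof.
have [[a Xa]|nX] := pselect (exists a, deg C a X).
  have [n [A AX]] := hom_fun_dense_deg Xa.
  exists n, (fun i => existT (fun a => M a : Type) a (A i)); split=> // b Xb i.
  exact: deg_disj Xa Xb.
have [n [a [Y [_ Ya YX]]]] := deg_split X.
pose m i := sval (cid (hom_fun_dense_deg (Ya i))).
pose A i : 'I_(m i) -> M (a i) := sval (cid (svalP (cid (hom_fun_dense_deg (Ya i))))).
have AY i : is_dsum (fun j => hom_fun T (a i) (A i j)) (Y i).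
  exact: (svalP (cid (svalP (cid (hom_fun_dense_deg (Ya i)))))).
exists _, (fun l : 'I_#|{: {i : 'I_n & 'I_(m i)}}| =>
  existT (fun a => M a : Type) (a (tag (enum_val l)))
    (A (tag (enum_val l)) (tagged (enum_val l)))); split.
  exact: (dsum_dsum YX AY).
by move=> b Xb; case: nX; exists b.
Qed.

Lemma hom_fun_fam_dense : dense (fam_obj (hom_fun T)).
Proof. by move=> X; have [n [o [oX _]]] := hom_fun_dense X; exists n, o. Qed.

Lemma completion_crossed : is_fds_completion_of_coprod (hom_fun T).
Proof.
exact: (@fds_completion_fam k G M C (hom_fun T) hom_fun_full hom_fun_faithful (@hom_fun_orth _ _ _ _ T)
  hom_fun_fam_dense (@gcat_fds _ _ C)).
Qed.

Lemma completion_comp a : is_fds_completion (T a).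
Proof.
have [fT hT dT] := T_gen a.
exact: fds_completionI fT hT (@deg_fds _ _ C a) dT.
Qed.

End Crossed.

(** * Equivalences from spans of generating morphisms *)

Section Extend.

Variables (M : monoidale k G) (C D : crossed k G).
Variables (K : monoidale_hom M (monoidale_of C)).
Variables (H : monoidale_hom M (monoidale_of D)).
Hypotheses (K_gen : generating K) (H_gen : generating H).

Let LK := ext_lam H (hom_fun_full K_gen) (hom_fun_faithful K_gen).

Lemma ext_data X : exists S, inhabited (decomp LK X S) /\
  forall a, deg C a X -> deg D a S.
Proof.
have [n [o [oX o_deg]]] := hom_fun_dense K_gen X.
have [[a Xa]|nX] := pselect (exists a, deg C a X); last first.
  have [S oS] := @gcat_fds _ _ D n (fun i => LK (o i)).
  exists S; split; first exact: decompP oX oS.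
  by move=> b Xb; case: nX; exists b.
(* The sum is formed inside the subcategory of degree [a]: a sum chosen in the whole of [D] would
   only be isomorphic to a homogeneous object. *)
have oa i : deg D a (LK (o i)) by rewrite -(o_deg a Xa i); exact: hom_fun_deg.
have [[S Sa] oS] := @deg_fds _ _ D a n (fun i => exist _ _ (oa i)).
exists S; split; first exact: decompP oX oS.
by move=> b Xb; rewrite (deg_disj Xb Xa).
Qed.

Let S X := sval (cid (ext_data X)).
Let dec X : decomp LK X (S X) := witness (proj1 (svalP (cid (ext_data X)))).
Let S_deg a X : deg C a X -> deg D a (S X) := proj2 (svalP (cid (ext_data X))) a.

Lemma Lm_full o o' (v : hom (LK o) (LK o')) :
  exists f, @fmap k (ind (fam_obj (hom_fun K))) D LK o o' f = v.
Proof.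
case: o o' v => i X [j Y] v; case: (i =P j) => [p|ne]; last first.
  by exists 0%R; rewrite fmap0 (hom_fun_orth ne (v : hom (hom_fun H i X) (hom_fun H j Y))).
subst j; have [u uE] := hom_fun_full H_gen (v : hom (hom_fun H i X) (hom_fun H i Y)).
by exists (fmap (hom_fun K i) u); rewrite -uE; exact: LmE.
Qed.

Lemma Lm_inj o o' : injective (@fmap k (ind (fam_obj (hom_fun K))) D LK o o').
Proof.
case: o o' => i X [j Y] f g; case: (i =P j) => [p|ne] e; last first.
  by rewrite (hom_fun_orth ne (f : hom (hom_fun K i X) (hom_fun K j Y)))
    (hom_fun_orth ne (g : hom (hom_fun K i X) (hom_fun K j Y))).
subst j; have [u uE] := hom_fun_full K_gen (f : hom (hom_fun K i X) (hom_fun K i Y)).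
have [v vE] := hom_fun_full K_gen (g : hom (hom_fun K i X) (hom_fun K i Y)).
subst f g; congr (fmap _ _); apply: (hom_fun_faithful H_gen).
by apply: etrans (esym (LmE _ _ _ _)) (etrans e (LmE _ _ _ _)).
Qed.

Lemma ext_equiv : is_equiv (ext dec).
Proof.
apply: is_equivI => [X Y v|X Y f g e|Y].
(* The entries of [v] between summands lie in the image of [LK]; their preimages are the entries of
   a preimage of [v]. *)
- pose midP i j := cid (Lm_full (coxi dec (dproj (dec Y) j) \o
    (v \o xi dec (dinj (dec X) i)))).
  pose mid i j : hom (fam_obj (hom_fun K) (dob (dec X) i))
    (fam_obj (hom_fun K) (dob (dec Y) j)) := sval (midP i j).
  have midE i j : fmap LK (mid i j : hom (_ : ind (fam_obj (hom_fun K))) _) = _ :=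
    svalP (midP i j).
  exists (\sum_i \sum_j (dinj (dec Y) j \o (mid i j \o dproj (dec X) i)))%R.
  rewrite -[RHS]cmpm1 -(xi_sum dec X) fmap_sum cmp_sumr.
  apply: eq_bigr => i _; rewrite -[RHS]cmp1m -(xi_sum dec Y) fmap_sum cmp_suml.
  apply: eq_bigr => j _.
  rewrite cmpA -(xi_coxi dec) xiM midE.
  by rewrite !cmpA.
- rewrite -[f]cmpm1 -[g]cmpm1 -(dsum (dec X)) !cmp_sumr.
  apply: eq_bigr => i _; rewrite !cmpA; congr (_ \o _).
  rewrite -[f]cmp1m -[g]cmp1m -(dsum (dec Y)) !cmp_suml.
  apply: eq_bigr => j _; rewrite -!cmpA; congr (_ \o _).
  have E h : coxi dec (dproj (dec Y) j) \o
      (fmap (ext dec) h \o xi dec (dinj (dec X) i)) =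
      fmap LK (dproj (dec Y) j \o (h \o dinj (dec X) i) : hom (_ : ind (fam_obj (hom_fun K))) _).
    by rewrite [_ \o xi _ _]ext_mapE coxi_xi.
  by apply: Lm_inj; rewrite -!E e.
(* Decompose [Y] over [H], and form in [C] the direct sum of the images under [K] of the same
   objects of [M]. *)
have [n [o oY]] := hom_fun_fam_dense H_gen Y.
have [X oX] := @gcat_fds _ _ C n (fun i => fam_obj (hom_fun K) (o i)).
exists X; apply: dsum_unique oY; apply: dsum_iso (dsum_fmap (ext dec) oX) => [i|].
  by constructor; exact: iso_inv (ext_iso dec (o i)).
by constructor; exact: iso_id.
Qed.

Lemma crossed_equiv_ext : crossed_equiv C D.
Proof.
exists (ext_crossed dec S_deg).
exact: ext_equiv.
Qed.

End Extend.

End Generating.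

Lemma cmp_swap (k : comPzRingType) (C : kcat k) (X X' Y Y' Z : C)
    (f1 : hom Y Z) (f2 : hom X Y) (g1 : hom Y' Z) (g2 : hom X Y')
    (r : hom X' X) :
  f1 \o f2 = g1 \o g2 -> f1 \o (f2 \o r) = g1 \o (g2 \o r).
Proof. by move=> E; rewrite !cmpA E. Qed.

(** * Identities, composites and restrictions of morphisms of monoidales *)

Section Homs.

Variables (k : comPzRingType) (G : groupType).

Program Definition mhom_id (N : monoidale k G) : monoidale_hom N N :=
  @MonoidaleHom k G N N (fun a => kid (N a))
    (fun f a b e => @NIso k _ _ (kcompf (mact N e) (kid (N a)))
       (kcompf (kid (N b)) (mact N e)) (fun A => iso_id _) _)
    _ _ (fun a b c e A B => iso_id _) _ _ (iso_id _) _ _ _ _.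
Next Obligation. by move=> *; rewrite cmpm1 cmp1m. Qed.
Next Obligation. by move=> *; rewrite /= fmap1 !cmpm1 !cmp1m. Qed.
Next Obligation. by move=> *; rewrite /= cmp1m. Qed.
Next Obligation. by move=> *; rewrite /= cmpm1 cmp1m. Qed.
Next Obligation. by move=> *; rewrite /= fmap1 bmap1 !cmpm1 !cmp1m. Qed.
Next Obligation. by move=> *; rewrite /= fmap1 cmpm1 !cmp1m. Qed.
Next Obligation. by move=> *; rewrite /= !bmap1 !cmpm1 !cmp1m. Qed.
Next Obligation. by move=> *; rewrite /= !bmap1 !cmpm1. Qed.
Next Obligation. by move=> *; rewrite /= !bmap1 !cmpm1. Qed.

Section Comp.

Variables (M N P : monoidale k G).
Variables (T : monoidale_hom N P) (S : monoidale_hom M N).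

Program Definition mhom_comp : monoidale_hom M P :=
  @MonoidaleHom k G M P (fun a => kcompf (T a) (S a))
    (fun f a b e => @NIso k _ _ (kcompf (mact P e) (kcompf (T a) (S a)))
       (kcompf (kcompf (T b) (S b)) (mact M e))
       (fun A => iso_comp (iso_fmap (T b) (hact S e A)) (hact T e (S a A))) _)
    _ _
    (fun a b c e A B =>
       iso_comp (iso_fmap (T c) (hbox S e A B)) (hbox T e (S a A) (S b B)))
    _ _ (iso_comp (iso_fmap (T 1) (hunit S)) (hunit T)) _ _ _ _.
Next Obligation.
move=> f a b e X Y u /=.
have H := congr1 (@fmap _ _ _ (T b) _ _) (nicN (hact S e) u).
rewrite !fmapM /= in H; rewrite cmpA H -!cmpA; congr (_ \o _).
exact: (nicN (hact T e) (fmap (S a) u)).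
Qed.
Next Obligation.
move=> a b c f g h ef eg eh e A /=.
have H := hact_comp T ef eg eh e (S a A).
have H' := congr1 (@fmap _ _ _ (T c) _ _) (hact_comp S ef eg eh e A).
have N' := nicN (hact T eg) (hact S ef A).
rewrite !fmapM /= in H' N'; rewrite -cmpA H; apply: etrans (cmpA _ _ _) _.
apply: etrans (congr1 (fun t => t \o _) H') _.
rewrite -!cmpA fmapM; congr (_ \o (_ \o _)).
apply: etrans (cmpA _ _ _) _; apply: etrans (congr1 (fun t => t \o _) N') _.
by rewrite -cmpA.
Qed.
Next Obligation.
move=> a e A /=; rewrite -cmpA (hact_one T).
apply: etrans (esym (fmapM (T a) (hact S e A) (mact1 N e (S a A)))) _.
by rewrite (hact_one S).
Qed.
Next Obligation.
move=> a b c e A A' B B' u v /=.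
by rewrite cmpA -fmapM (hboxN S) fmapM -!cmpA (hboxN T).
Qed.
Next Obligation.
move=> f a b c a' b' c' e e' ea eb ec A B /=.
have H := hboxM T e e' ea eb ec (S a A) (S b B).
have H' := congr1 (@fmap _ _ _ (T c') _ _) (hboxM S e e' ea eb ec A B).
have N1 := nicN (hact T ec) (hbox S e A B).
have N2 := hboxN T e' (hact S ea A) (hact S eb B).
rewrite !fmapM /= in H' N1 N2; rewrite fmapM bmapM -!cmpA.
apply: etrans (congr1 (fun t => _ \o t) (cmp_swap _ (esym N1))) _.
rewrite H; apply: esym.
apply: etrans (congr1 (fun t => _ \o (_ \o t)) (cmp_swap _ (esym N2))) _.
by rewrite !cmpA in H' *; rewrite H'.
Qed.
Next Obligation.
move=> f e /=.
have H := hunitM T e.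
have H' := congr1 (@fmap _ _ _ (T 1) _ _) (hunitM S e).
have N1 := nicN (hact T e) (hunit S).
rewrite !fmapM /= in H' N1.
rewrite fmapM -!cmpA.
apply: etrans (congr1 (fun t => _ \o t) (cmp_swap _ (esym N1))) _.
by rewrite H; rewrite !cmpA in H' *; rewrite H'.
Qed.
Next Obligation.
move=> a b c ab bc abc e1 e2 e3 e4 X Y Z /=.
have H := hassoc T e1 e2 e3 e4 (S a X) (S b Y) (S c Z).
have H' := congr1 (@fmap _ _ _ (T abc) _ _) (hassoc S e1 e2 e3 e4 X Y Z).
have N1 := hboxN T e2 (hbox S e1 X Y) (idm (S c Z)).
have N2 := hboxN T e4 (idm (S a X)) (hbox S e3 Y Z).
rewrite !fmapM /= in H'; rewrite !fmap1 in N1 N2.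
rewrite bmapMl bmapMr -!cmpA.
apply: etrans (congr1 (fun t => _ \o (_ \o t)) (cmp_swap _ (esym N1))) _.
apply: esym.
apply: etrans (congr1 (fun t => _ \o t) (cmp_swap _ (esym N2))) _.
by rewrite -H; rewrite !cmpA in H' *; rewrite H'.
Qed.
Next Obligation.
move=> a e A /=.
have H' := congr1 (@fmap _ _ _ (T a) _ _) (hlun S e A).
have N1 := hboxN T e (hunit S) (idm (S a A)).
rewrite !fmapM /= in H'; rewrite !fmap1 in N1.
rewrite bmapMl -!cmpA.
apply: etrans (congr1 (fun t => _ \o (_ \o t)) (cmp_swap _ (esym N1))) _.
rewrite -(hlun T) -H'; rewrite !cmpA; reflexivity.
Qed.
Next Obligation.
move=> a e A /=.
have H' := congr1 (@fmap _ _ _ (T a) _ _) (hrun S e A).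
have N1 := hboxN T e (idm (S a A)) (hunit S).
rewrite !fmapM /= in H'; rewrite !fmap1 in N1.
rewrite bmapMr -!cmpA.
apply: etrans (congr1 (fun t => _ \o (_ \o t)) (cmp_swap _ (esym N1))) _.
rewrite -(hrun T) -H'; rewrite !cmpA; reflexivity.
Qed.

End Comp.

Section Restrict.

Variables (C D : crossed k G) (F : crossed_fun C D).

Definition res_fun a : kfun (comp_of C a) (comp_of D a) :=
  full_fun (@cfun_deg _ _ _ _ F a).

Definition res_act f a b (e : gaut f a b) :
    niso (kcompf (act_of D e) (res_fun a)) (kcompf (res_fun b) (act_of C e)) :=
  @NIso k _ _ (kcompf (act_of D e) (res_fun a)) (kcompf (res_fun b) (act_of C e))
    (fun X => @full_iso k D (deg D b) (kcompf (act_of D e) (res_fun a) X)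
      (kcompf (res_fun b) (act_of C e) X) (cfun_phi F f^-1 (sval X)))
    (fun X Y u => nicN (cfun_phi F f^-1) (u : hom (sval X) (sval Y))).

Definition res_box a b c (e : a * b = c) (X : comp_of C a) (Y : comp_of C b) :
    iso (box_of D e (res_fun a X) (res_fun b Y)) (res_fun c (box_of C e X Y)) :=
  @full_iso k D (deg D c) (box_of D e (res_fun a X) (res_fun b Y))
    (res_fun c (box_of C e X Y)) (mu F (sval X) (sval Y)).

Definition res_unit : iso (unit_of D) (res_fun 1 (unit_of C)) :=
  @full_iso k D (deg D 1) (unit_of D) (res_fun 1 (unit_of C)) (eps F).

Lemma cfun_phi_one_at u (eu : 1 = u) X :
  cfun_phi F u X \o phi_one_at D eu (F X) = fmap F (phi_one_at C eu X).
Proof. by subst u; exact: cfun_phi_one. Qed.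

Program Definition restrict : monoidale_hom (monoidale_of C) (monoidale_of D) :=
  @MonoidaleHom k G (monoidale_of C) (monoidale_of D) res_fun res_act _ _
    res_box _ _ res_unit _ _ _ _.
Next Obligation.
move=> a b c f g h ef eg eh e A.
exact: (cfun_phi_mul F (inv_prod e) (sval A)).
Qed.
Next Obligation. by move=> a e A; exact: cfun_phi_one_at. Qed.
Next Obligation. by move=> a b c e A A' B B' u v; exact: (muN F). Qed.
Next Obligation.
move=> f a b c a' b' c' e e' ea eb ec A B.
apply: etrans (smnic_mu (cfun_phi F f^-1) (sval A) (sval B)) _.
exact: esym (cmpA _ _ _).
Qed.
Next Obligation. by move=> f e; exact: (smnic_eps (cfun_phi F f^-1)). Qed.
Next Obligation. by move=> *; exact: (muA F). Qed.
Next Obligation. by move=> *; exact: (mu1m F). Qed.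
Next Obligation. by move=> *; exact: (mum1 F). Qed.

Hypothesis F_equiv : is_equiv F.

(** The quasi-inverse of [F] is not known to preserve degrees, so a preimage [X] of [Y] may have
    pieces in several. Only the piece of degree [a] matters: [Y] admits no nonzero morphism to the
    images of the others. *)
Lemma restrict_equiv a : is_equiv (restrict a).
Proof.
apply: is_equivI => [X Y v|X Y|Y].
- exact: (is_equiv_full F_equiv).
- exact: (is_equiv_faithful F_equiv).
have [X [i]] := is_equiv_surj F_equiv (sval Y).
have [n [b [Z [inj_b Zb [p [q [qp _ pq]]]]]]] := deg_split X.
have sum1 : (\sum_j (fwd i \o fmap F (p j) \o (fmap F (q j) \o bwd i)))%R =
    idm (sval Y).
  rewrite -(bwdK i) -[in RHS](cmp1m (bwd i)) -(fmap1 F) -pq fmap_sum.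
  rewrite cmp_suml cmp_sumr; apply: eq_bigr => j _.
  by rewrite fmapM !cmpA.
have r0 j : b j <> a -> fmap F (q j) \o bwd i = 0%R.
  move=> ne; apply: deg_hom0 (svalP Y) (@cfun_deg _ _ _ _ F _ _ (Zb j)) _ _.
  exact: nesym.
have [[j bj]|nj] := pselect (exists j, b j = a).
  have Zja : deg C a (Z j) by rewrite -bj.
  exists (exist (deg C a) (Z j) Zja); constructor.
  apply: (@Iso k (comp_of D a) (restrict a (exist (deg C a) (Z j) Zja)) Y
    (fwd i \o fmap F (p j)) (fmap F (q j) \o bwd i)).
    have E : (fmap F (q j) \o bwd i) \o (fwd i \o fmap F (p j)) =
        fmap F (q j \o p j).
      by rewrite fmapM -!cmpA (cmpA (bwd i)) fwdK cmp1m.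
    by apply: etrans E _; rewrite qp fmap1.
  apply: etrans _ sum1; rewrite (bigD1 j) //= big1 ?addr0 // => l /eqP ne.
  by rewrite r0 ?cmpm0 // -bj => /inj_b.
(* No piece has degree [a], so the identity of [Y] is zero and the empty direct sum in degree [a] is
   a preimage. *)
have [Z0 [p0 [q0 [_ _ pq0]]]] := @deg_fds _ _ C a 0
  (fun l : 'I_0 => match (notF (ltn_ord l)) with end).
rewrite big_ord0 in pq0.
exists Z0; constructor; apply: (@Iso k (comp_of D a) (restrict a Z0) Y 0%R 0%R).
  rewrite cmp0m; apply: esym; apply: etrans (esym (fmap1 (restrict a) Z0)) _.
  by rewrite -pq0; exact: fmap0.
rewrite cmp0m -[RHS]sum1 big1 // => j _.
by rewrite r0 ?cmpm0 // => bj; apply: nj; exists j.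
Qed.

End Restrict.

Lemma generating_id (N : monoidale k G) : generating (mhom_id N).
Proof.
move=> a; split=> [X Y v|X Y u v //|X]; first by exists v.
exists 1%N, (fun=> X), (fun=> idm X), (fun=> idm X); split=> [i|i j ne|].
- exact: cmp1m.
- by case: ne; rewrite (ord1 i) (ord1 j).
by rewrite big_ord1; exact: cmp1m.
Qed.

Lemma generating_comp (M N P : monoidale k G) (T : monoidale_hom N P)
    (S : monoidale_hom M N) :
  generating T -> generating S -> generating (mhom_comp T S).
Proof.
move=> gT gS a; have [fT hT dT] := gT a; have [fS hS dS] := gS a.
split=> [X Y v|X Y u v e|X].
- have [w wE] := fT _ _ v; have [u uE] := fS _ _ w.
  by exists u; rewrite -wE -uE.
- exact: (hS _ _ _ _ (hT _ _ _ _ e)).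
have [n [Y YX]] := dT X.
pose m i := sval (cid (dS (Y i))).
pose Z i : 'I_(m i) -> M a := sval (cid (svalP (cid (dS (Y i))))).
have ZY i : is_dsum (fun j => S a (Z i j)) (Y i).
  exact: (svalP (cid (svalP (cid (dS (Y i)))))).
have := dsum_dsum YX (fun i => dsum_fmap (T a) (ZY i)).
by exists _, (fun l : 'I_#|{: {i : 'I_n & 'I_(m i)}}| =>
  Z (tag (enum_val l)) (tagged (enum_val l))).
Qed.

Lemma is_equiv_generating (M N : monoidale k G) (T : monoidale_hom M N) :
  (forall a, is_equiv (T a)) -> generating T.
Proof.
move=> eT a; split; [exact: is_equiv_full | exact: is_equiv_faithful | move=> Y].
have [X [i]] := is_equiv_surj (eT a) Y.
exists 1%N, (fun=> X), (fun=> fwd i), (fun=> bwd i); split=> [j|j l ne|].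
- exact: fwdK.
- by case: ne; rewrite (ord1 j) (ord1 l).
by rewrite big_ord1; exact: bwdK.
Qed.

Lemma unit_generating (M : monoidale k G) : generating (unit_hom M).
Proof.
by move=> a; split; [exact: unit_full | exact: unit_faithful | exact: unit_dense].
Qed.

Lemma fds_generating (M P : monoidale k G) (S : monoidale_hom M P) :
  (forall a, is_fds_completion (S a)) -> generating S.
Proof. by move=> cS a; have [? ? ? _] := fds_completionP (cS a). Qed.

Lemma restrict_generating (C D : crossed k G) (F : crossed_fun C D) :
  is_equiv F -> generating (restrict F).
Proof. by move=> eF; apply: is_equiv_generating; exact: restrict_equiv. Qed.

(** The span has the identity of [monoidale_of C] as one leg and the composite of the restrictions
    as the other, so no coherence of a composite crossed functor has to be checked. *)
Lemma crossed_equiv_trans (C D E : crossed k G) :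
  crossed_equiv C D -> crossed_equiv D E -> crossed_equiv C E.
Proof.
move=> [F eF] [F' eF'].
apply: (crossed_equiv_ext (generating_id (monoidale_of C))).
exact: generating_comp (restrict_generating eF') (restrict_generating eF).
Qed.

End Homs.

(** The second and third clauses give a bijection between equivalence classes; the first identifies
    [Phi M] as the completion of the coproduct, with structure induced from [M], so that the
    bijection is the intended one. The last says that between crossed categories no further
    completion is involved. *)
Theorem proposition7p3 (k : comPzRingType) (G : groupType) :
  exists Phi : monoidale k G -> crossed k G,
  [/\ forall M : monoidale k G,
        exists T : monoidale_hom M (monoidale_of (Phi M)),
          is_fds_completion_of_coprod
            (fun a : G => kcompf (full_incl (deg (Phi M) a)) (T a)) /\
          forall a : G, is_fds_completion (T a),
      forall C : crossed k G, crossed_equiv (Phi (monoidale_of C)) C,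
      forall M N : monoidale k G,
        monoidale_equiv_fds M N <-> crossed_equiv (Phi M) (Phi N) &
      forall C D : crossed k G,
        crossed_equiv C D <-> monoidale_equiv (monoidale_of C) (monoidale_of D)].
Proof.
exists (@Phi k G); split=> [M|C|M N|C D].
- exists (unit_hom M); split; first exact: completion_crossed (unit_generating M).
  exact: completion_comp (unit_generating M).
- exact: crossed_equiv_ext (unit_generating _) (generating_id _).
- split=> [[P [S [T ST]]]|[F eF]].
    (* A common completion [P] mediates: [M] maps by generating morphisms to both [Phi M] and
       [Phi P], and [N] to both [Phi P] and [Phi N]. *)
    have gS := fds_generating (fun a => (ST a).1).
    have gT := fds_generating (fun a => (ST a).2).
    apply: (@crossed_equiv_trans _ _ _ (Phi P)).
      apply: crossed_equiv_ext (unit_generating M) _.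
      exact: generating_comp (unit_generating P) gS.
    apply: crossed_equiv_ext _ (unit_generating N).
    exact: generating_comp (unit_generating P) gT.
  (* Conversely the monoidale of [Phi N] is a common completion: [N] reaches it by its unit, and [M]
     by its unit followed by the given equivalence. *)
  have gF := generating_comp (restrict_generating eF) (unit_generating M).
  exists (monoidale_of (Phi N)), (mhom_comp (restrict F) (unit_hom M)), (unit_hom N).
  by move=> a; split; apply: completion_comp => //; exact: unit_generating.
split=> [[F eF]|[T eT]].
  by exists (restrict F); exact: restrict_equiv.
apply: crossed_equiv_ext (generating_id _) _.
exact: is_equiv_generating eT.
Qed.
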